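(* Let $a,b>-1$ and $\alpha>0$, let $(u_0,\mu_0)$ be the pair in $\mathcal{D}$ whose spectral measure is the Jacobi measure $$\rho_\alpha^{(a,b)}(d\lambda)=(\lambda-\alpha)^b(1+\alpha-\lambda)^a\mathbf{1}_{(\alpha,1+\alpha)}(\lambda)\,d\lambda,$$ and let $x_n(t)$, $\omega_n(t)$, $n\in\mathbb{N}$, be the peakon positions and weights of the solution $(u(\cdot,t),\mu(\cdot,t))=\Phi^t(u_0,\mu_0)$. For every fixed $n\in\mathbb{N}$ the following asymptotics hold: (i) As $t\to\infty$ one has $$\omega_n(t)=\frac{1}{1+\alpha}+o(1),\qquad x_n(t)=\frac{t}{2(1+\alpha)}+(2n+a-1)\log\frac{t}{2(1+\alpha)}-\log j_n^++o(1),$$ where $j_n^+=(1+\alpha)^{a+1}(n-1)!\,\Gamma(n+a)$. (ii) As $t\to-\infty$ one has $$\omega_n(t)=\frac1\alpha+o(1),\qquad x_n(t)=\frac{t}{2\alpha}+(2n+b-1)\log\frac{|t|}{2\alpha}-\log j_n^-+o(1),$$ where $j_n^-=\alpha^{b+1}(n-1)!\,\Gamma(n+b)$.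
   Context: Phase space. $\mathcal{D}$ is the set of all pairs $(u,\mu)$ where $u\in H^1_{\mathrm{loc}}(\mathbb{R})$ is real-valued and $\mu$ is a positive Borel measure on $\mathbb{R}$ with $\int_B u^2+u'^2\,dx\le\mu(B)$ for every Borel set $B\subseteq\mathbb{R}$ such that, with $\upsilon$ the positive Borel measure defined by $\mu(B)=\upsilon(B)+\int_B u^2+u'^2\,dx$, one has $$\int_{-\infty}^0 e^{-s}(u(s)^2+u'(s)^2)\,ds+\int_{-\infty}^0 e^{-s}\upsilon(ds)<\infty,\qquad \limsup_{x\to\infty}e^{x}\Big(\int_x^\infty e^{-s}(u(s)+u'(s))^2ds+\int_x^\infty e^{-s}\upsilon(ds)\Big)<\infty.$$ The real distribution $\omega\in H^{-1}_{\mathrm{loc}}(\mathbb{R})$ is $\omega=u-u''$, that is, $\omega(h)=\int_{\mathbb{R}}uh\,dx+\int_{\mathbb{R}}u'h'\,dx$ for $h\in H^1(\mathbb{R})$ with compact support. Spectral measure. For $z\in\mathbb{C}$, a solution of $-f''+\frac14 f=z\,\omega f+z^2\upsilon f$ is a function $f\in H^1_{\mathrm{loc}}(\mathbb{R})$ with $\int f'h'\,dx+\frac14\int fh\,dx=z\,\omega(fh)+z^2\int fh\,d\upsilon$ for all compactly supported $h\in H^1(\mathbb{R})$; its quasi-derivative $f^{[1]}$ is the unique left-continuous function with $f^{[1]}=f'+\frac12 f-z(u+u')f$ a.e. There are (known) solutions $\phi(z,\cdot),\theta(z,\cdot)$ with $\phi(z,x)\sim e^{x/2}$, $\theta(z,x)\sim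 e^{-x/2}$, $\phi^{[1]}(z,x)\sim e^{x/2}$, $\theta^{[1]}(z,x)=o(e^{x/2})$ as $x\to-\infty$. The Weyl--Titchmarsh function $m(z)=-\lim_{x\to\infty}\frac{\theta(z,x)}{z\phi(z,x)}$, $z\in\mathbb{C}\setminus\mathbb{R}$, has the form $m(z)=\int_{\mathbb{R}}\frac{z}{\lambda(\lambda-z)}\rho(d\lambda)$ for a unique positive Borel measure $\rho$ on $\mathbb{R}$ with $\int\frac{\rho(d\lambda)}{1+\lambda^2}<\infty$ and $0\notin\operatorname{supp}\rho$; $\rho$ is the spectral measure of $(u,\mu)$. (Known: $(u,\mu)\mapsto\rho$ is a bijection from $\mathcal{D}$ onto the set of all such measures.) Flow. For $(u,\mu)\in\mathcal{D}$ with spectral measure $\rho$ and $t\in\mathbb{R}$, $\Phi^t(u,\mu)$ is the unique pair in $\mathcal{D}$ with spectral measure $B\mapsto\int_B e^{-\frac{t}{2\lambda}}\rho(d\lambda)$. Positions and weights. For each $t\in\mathbb{R}$ the solution has the form $\omega(\cdot,t)=\sum_{n=1}^\infty\omega_n(t)\delta_{x_n(t)}$, $\upsilon(\cdot,t)=0$, with $x_1(t)<x_2(t)<\dots$, $x_n(t)\to\infty$ as $n\to\infty$, $\omega_n(t)>0$, and explicitly $$x_n(t)=\log\frac{\Delta_{2,n-1}(t)}{\Delta_{0,n}(t)},\qquad \omega_n(t)=\frac{\Delta_{0,n}(t)\Delta_{2,n-1}(t)}{\Delta_{1,n-1}(t)\Delta_{1,n}(t)},$$ where $\Delta_{l,k}(t)=\det(s_{l+i+j}(t))_{i,j=0}^{k-1}$,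 $\Delta_{l,0}=1$, $s_k(t)=\int\lambda^ke^{-\frac{t}{2\lambda}}\rho_\alpha^{(a,b)}(d\lambda)$. $\Gamma$ is the gamma function. *)

(* Defs.v *)
From HB Require Import structures.
From mathcomp Require Import all_boot all_order all_algebra.
From mathcomp Require Import all_classical all_reals all_analysis.
From mathcomp Require Import measurable_realfun complex.
Set Implicit Arguments.
Unset Strict Implicit.
Unset Printing Implicit Defensive.
Import Order.TTheory GRing.Theory Num.Theory.
Import numFieldNormedType.Exports.
Local Open Scope classical_set_scope.
Local Open Scope ring_scope.
Local Open Scope complex_scope.

Notation borel_measure R := {measure set (measurableTypeR R) -> \bar R}.

Section Density.
Context {R : realType} (nu : borel_measure R) (g : R -> R).
Hypothesis mg : measurable_fun [set: R] g.
Hypothesis g0 : forall x, 0 <= g x.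

Definition density_measure
    of measurable_fun [set: R] g
     & (forall x, 0 <= g x) :=
  fun B : set (measurableTypeR R) => (\int[nu]_(x in B) (g x)%:E)%E.

Local Notation dm := (density_measure mg g0).

Let dm0 : dm set0 = 0%E.
Proof. by rewrite /density_measure integral_set0. Qed.

Let dm_ge0 B : (0 <= dm B)%E.
Proof. by apply: integral_ge0 => x _; rewrite lee_fin. Qed.

Let dm_sigma_additive : semi_sigma_additive dm.
Proof.
apply: (@semi_sigma_additive_nng_induced _ _ _ nu (fun x => (g x)%:E)) => //.
  exact/measurable_EFinP.
Qed.

HB.instance Definition _ := isMeasure.Build _ _ _ dm dm0 dm_ge0 dm_sigma_additive.

End Density.

Section Sobolev.
Context {R : realType}.
Local Notation leb := (@lebesgue_measure R).

(* Elements of H^1_loc are identified with their continuous representatives,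
   i.e. with the primitives of locally square-integrable functions. *)
Definition is_wderiv (f g : R -> R) : Prop :=
  [/\ measurable_fun [set: R] g,
      forall p q : R, (\int[leb]_(x in `[p, q]) ((g x) ^+ 2)%:E < +oo)%E &
      forall p q : R, p <= q -> f q - f p = \int[leb]_(x in `[p, q]) g x].

Definition H1loc (f : R -> R) : Prop := exists g, is_wderiv f g.

(* A representative of the weak derivative, which is determined a.e. *)
Definition wderiv (f : R -> R) : R -> R := xget (fun=> 0) (is_wderiv f).

Definition cH1loc (f : R -> R[i]) : Prop :=
  H1loc (fun x => complex.Re (f x)) /\ H1loc (fun x => complex.Im (f x)).

Definition cwderiv (f : R -> R[i]) (x : R) : R[i] :=
  wderiv (fun y => complex.Re (f y)) x +i* wderiv (fun y => complex.Im (f y)) x.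

(* compactly supported elements of H^1 *)
Definition cH1c (h : R -> R[i]) : Prop :=
  cH1loc h /\ exists M : R, forall x, M < `|x| -> h x = 0.

Definition cintegral (nu : borel_measure R) (D : set R) (f : R -> R[i]) : R[i] :=
  (\int[nu]_(x in D) complex.Re (f x)) +i* (\int[nu]_(x in D) complex.Im (f x)).

End Sobolev.

Section PhaseSpace.
Context {R : realType}.
Local Notation leb := (@lebesgue_measure R).

Definition energy (u : R -> R) (x : R) : R := u x ^+ 2 + wderiv u x ^+ 2.

Definition is_upsilon (u : R -> R) (mu nu : borel_measure R) : Prop :=
  forall B : set (measurableTypeR R), measurable B ->
    (mu B = nu B + \int[leb]_(x in B) (energy u x)%:E)%E.

(* The Borel measure mu minus the measure with density energy u.  The latter is
   sigma-finite for u in H^1_loc, so the difference exists and is determined on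
   Borel sets as soon as it is dominated by a locally finite mu, as is required
   in phase_space; mzero is a junk value. *)
Definition upsilon (u : R -> R) (mu : borel_measure R) : borel_measure R :=
  if pselect (exists nu, is_upsilon u mu nu) is left ex then sval (cid ex)
  else mzero.

Definition phase_space (u : R -> R) (mu : borel_measure R) : Prop :=
  [/\ H1loc u,
      forall p q : R, (mu `[p, q]%classic < +oo)%E,
      forall B : set (measurableTypeR R), measurable B ->
        (\int[leb]_(x in B) (energy u x)%:E <= mu B)%E,
      (\int[leb]_(s in `]-oo, 0%R[) (expR (- s) * energy u s)%:E
         + \int[upsilon u mu]_(s in `]-oo, 0%R[) (expR (- s))%:E < +oo)%E &
      (limf_esup (fun x : R => (expR x)%:E *
           (\int[leb]_(s in `[x, +oo[)
               (expR (- s) * (u s + wderiv u s) ^+ 2)%:E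
            + \int[upsilon u mu]_(s in `[x, +oo[) (expR (- s))%:E))
         (pinfty_nbhs R) < +oo)%E].

Definition omega (u : R -> R) (h : R -> R[i]) : R[i] :=
  cintegral leb setT (fun x => (u x)%:C * h x)
  + cintegral leb setT (fun x => (wderiv u x)%:C * cwderiv h x).

End PhaseSpace.

Section Spectral.
Context {R : realType}.
Local Notation leb := (@lebesgue_measure R).
Implicit Types (u : R -> R) (mu rho : borel_measure R) (z : R[i]).

Definition is_solution u mu z (f : R -> R[i]) : Prop :=
  cH1loc f /\
  forall h : R -> R[i], cH1c h ->
    cintegral leb setT (fun x => cwderiv f x * cwderiv h x)
      + 4^-1 * cintegral leb setT (fun x => f x * h x)
    = z * omega u (fun x => f x * h x)
      + z ^+ 2 * cintegral (upsilon u mu) setT (fun x => f x * h x).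

Definition is_quasideriv u z (f f1 : R -> R[i]) : Prop :=
  (forall x : R, (f1 : R -> R[i]^o) y @[y --> x^'-] --> (f1 x : R[i]^o)) /\
  {ae leb, forall x, f1 x = cwderiv f x + 2^-1 * f x
                            - z * (u x + wderiv u x)%:C * f x}.

Definition is_phi u mu z (phi : R -> R[i]) : Prop :=
  is_solution u mu z phi /\
  exists phi1, [/\ is_quasideriv u z phi phi1,
    (phi x / (expR (x / 2))%:C : R[i]^o) @[x --> -oo] --> (1 : R[i]^o) &
    (phi1 x / (expR (x / 2))%:C : R[i]^o) @[x --> -oo] --> (1 : R[i]^o)].

Definition is_theta u mu z (theta : R -> R[i]) : Prop :=
  is_solution u mu z theta /\
  exists theta1, [/\ is_quasideriv u z theta theta1,
    (theta x / (expR (- x / 2))%:C : R[i]^o) @[x --> -oo] --> (1 : R[i]^o) &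
    (theta1 x / (expR (x / 2))%:C : R[i]^o) @[x --> -oo] --> (0 : R[i]^o)].

Definition is_Weyl_Titchmarsh u mu (m : R[i] -> R[i]) : Prop :=
  forall z, complex.Im z != 0 ->
    exists phi theta, [/\ is_phi u mu z phi, is_theta u mu z theta &
      (- (theta x / (z * phi x)) : R[i]^o) @[x --> +oo] --> (m z : R[i]^o)].

Definition msupport rho : set R :=
  [set x : R | forall e : R, 0 < e -> (0 < rho (ball x e))%E].

Definition is_spectral_measure u mu rho : Prop :=
  [/\ (\int[rho]_l ((1 + l ^+ 2)^-1)%:E < +oo)%E,
      ~ msupport rho 0 &
      is_Weyl_Titchmarsh u mu
        (fun z => cintegral rho setT (fun l : R => z / (l%:C * (l%:C - z))))].

End Spectral.

Section Flow.
Context {R : realType}.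
Implicit Types (u v : R -> R) (mu nu rho : borel_measure R).

Definition flow_weight (t l : R) : R := expR (- (t / (2 * l))).

Lemma measurable_flow_weight (t : R) :
  measurable_fun [set: R] (flow_weight t).
Proof.
have minv : measurable_fun [set: R] (fun l : R => l^-1).
  have -> : [set: R] = [set 0] `|` ~` [set 0] by rewrite setUv.
  have m0 : measurable ([set 0] : set R) by exact: measurable_set1.
  apply/(measurable_funU _ m0 (measurableC m0)).
  split; first exact: measurable_fun_set1.
  apply: open_continuous_measurable_fun.
    apply: closed_openC; apply: accessible_closed_set1.
    exact/hausdorff_accessible/norm_hausdorff.
  move=> x /set_mem /= x0; apply: inv_continuous; exact/eqP.
rewrite /flow_weight.
apply: measurableT_comp => //.
rewrite (_ : (fun l => _) = (fun l : R => - (t / 2) * l^-1)).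
  exact: measurable_funM.
by apply/funext => l; rewrite invfM mulNr mulrA.
Qed.

Lemma flow_weight_ge0 (t l : R) : 0 <= flow_weight t l.
Proof. exact: expR_ge0. Qed.

Definition flow_measure (t : R) rho : borel_measure R :=
  density_measure rho (measurable_flow_weight t) (flow_weight_ge0 t).

(* (v, nu) is the value at time t of the flow started at (u, mu).  The spectral
   measure rho of (u, mu) is unique (on Borel sets), whence the quantification. *)
Definition is_flow (t : R) u mu v nu : Prop :=
  phase_space v nu /\
  forall rho, is_spectral_measure u mu rho ->
    is_spectral_measure v nu (flow_measure t rho).

(* Peakons are indexed from 1; x 0 and w 0 play no role.  Since h has compact
   support and x n tends to infinity, only finitely many terms of the series
   over n are nonzero, so that its value is an eventual value of the partial
   sums. *)
Definition peakon_data u mu (x w : nat -> R) : Prop :=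
  [/\ forall n, (1 <= n)%N -> x n < x n.+1,
      x n @[n --> \oo] --> +oo,
      forall n, (1 <= n)%N -> 0 < w n,
      forall h : R -> R[i], cH1c h ->
        \forall N \near \oo, omega u h = \sum_(1 <= n < N) (w n)%:C * h (x n) &
      forall B : set (measurableTypeR R), measurable B -> upsilon u mu B = 0%E].

End Flow.

Section Jacobi.
Context {R : realType}.
Variables a b alpha : R.

Definition jacobi_weight : R -> R :=
  (fun l => (l - alpha) `^ b * (1 + alpha - l) `^ a) \_ `]alpha, 1 + alpha[.

Lemma measurable_jacobi_weight :
  measurable_fun [set: R] jacobi_weight.
Proof.
apply/(measurable_restrictT _ (measurable_itv `]alpha, 1 + alpha[)).
apply/measurable_funTS/measurable_funM.
- apply: (measurableT_comp (measurable_powR b)).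
  exact: measurable_funB.
- apply: (measurableT_comp (measurable_powR a)).
  exact: measurable_funB.
Qed.

Lemma jacobi_weight_ge0 l : 0 <= jacobi_weight l.
Proof. by apply: restrict_ge0 => x _; rewrite mulr_ge0 ?powR_ge0. Qed.

Definition jacobi_measure : borel_measure R :=
  density_measure (@lebesgue_measure R)
    measurable_jacobi_weight jacobi_weight_ge0.

End Jacobi.

(* The Gamma function, for s > 0. *)
Definition Gamma {R : realType} (s : R) : R :=
  \int[@lebesgue_measure R]_(x in `]0, +oo[) (x `^ (s - 1) * expR (- x)).

(* Main.v *)
(** Divided by [exp (x / 2)], a solution of the spectral problem is affine in
    [y = exp (- x)] between the peaks, so that the problem is that of a string with
    masses [m_k = w_(k+1) / y_k] at the points [y_k = exp (- x_(k+1))].  Bounding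
    the difference between the Weyl-Titchmarsh function and its rational
    approximants on the negative half-line (by a Wronskian identity, letting
    [Im z] tend to 0) shows that the polynomials [G_n] with [G_n(0) = 1] that give
    the values of [phi] at the peaks satisfy [int l^k G_n = 0] for [1 <= k <= n]
    and [int G_n = y_n], where the integrals are with respect to the spectral measure.
    Hence [y_n] is the minimum of [int p^2] over all [p] of degree at most [n] with
    [p(0) = 1], it is attained at [G_n], and [w_(n+1) = int G_n^2 / int l G_n^2].

    For large [|t|] the measure [exp (- t / (2 l)) rho] concentrates at an endpoint
    [c] of the support on the scale [1 / |t|], where by Watson's lemma its moments
    become those of [s^a exp (- s)].  The extremal problem for the limiting weight
    is solved by Laguerre polynomials; the squared norm [n! Gamma(n + a + 1)] of the
    monic one is the constant in the expansion of [x_(n+1)], and [w_(n+1)]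
    tends to [1 / c]. *)
Require Import Defs.
From HB Require Import structures.
From mathcomp Require Import all_boot all_order all_algebra.
From mathcomp Require Import all_classical all_reals all_analysis.
From mathcomp Require Import complex measurable_realfun.
From mathcomp Require Import ring lra.
Set Implicit Arguments.
Unset Strict Implicit.
Unset Printing Implicit Defensive.
Import Order.TTheory GRing.Theory Num.Theory.
Import numFieldNormedType.Exports.
Local Open Scope classical_set_scope.
Local Open Scope ring_scope.

(** * Integration with respect to densities and affine changes of variable *)

(** The spectral problem is given weakly, so it is only ever tested against hats made of hyperbolic
    sines. Each test is an exact linear relation between three values of a solution, and these
    relations are the string recursion; no regularity beyond H^1_loc is required. The approximants
    are controlled on the negative half-line because the ratios - E / G keep a nonnegative real part
    there, as in a Stieltjes continued fraction. The denominators therefore grow at least like X^n,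
    and the resulting error O(X^(- 2 n - 1)) is just small enough to give L (X^k G_n) for all k <=
    n. The extremal problem allows an affine change of the spectral variable before the limit: the
    endpoint [c] becomes 0, and 0 becomes [sigma * (c * X)], which escapes to infinity. At such a
    remote point a polynomial is governed by its leading coefficient, whence the norm of the monic
    polynomial and the factor (c X)^(2 n) behind the term 2 n log. The two ends differ only in [c],
    in the sign [sigma] and in the roles of [a] and [b], so one argument serves both. *)

Section Density_integral.
Context {R : realType} (nu : borel_measure R) (g : R -> R).
Hypothesis mg : measurable_fun [set: R] g.
Hypothesis g0 : forall x, 0 <= g x.
Import HBNNSimple.

Lemma ge0_integral_density (f : R -> \bar R) :
  measurable_fun [set: R] f -> (forall x, (0 <= f x)%E) ->
  (\int[density_measure nu mg g0]_x f x = \int[nu]_x (f x * (g x)%:E))%E.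
Proof.
move=> mf f0.
pose f_ := nnsfun_approx (measurableT : measurable [set: measurableTypeR R]) mf.
have f_f x : EFin \o f_ ^~ x @ \oo --> f x by apply: cvg_nnsfun_approx.
transitivity (limn (fun n => (\int[density_measure nu mg g0]_x (f_ n x)%:E)%E)).
  rewrite -monotone_convergence//.
  - by apply: eq_integral => y _; apply/esym/cvg_lim => //; exact: f_f.
  - by move=> n; exact/measurable_EFinP/measurable_funP.
  - by move=> n y _; rewrite lee_fin.
  - by move=> y _ m n mn; rewrite lee_fin; exact/lefP/nd_nnsfun_approx.
transitivity (limn (fun n => (\int[nu]_x ((f_ n x)%:E * (g x)%:E))%E)); last first.
  rewrite -monotone_convergence//.
  - apply: eq_integral => y _; apply/cvg_lim => //.
    apply: cvgeZr; first by [].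
    exact: f_f.
  - by move=> n; apply: emeasurable_funM; apply/measurable_EFinP.
  - by move=> n y _; rewrite mule_ge0// lee_fin.
  - move=> y _ m n mn; rewrite lee_wpmul2r ?lee_fin//.
    exact/lefP/nd_nnsfun_approx.
congr (limn _); apply/funext => n.
have mA r : measurable (f_ n @^-1` [set r]) by exact: measurable_sfunP.
rewrite integralT_nnsfun sintegralE.
under [RHS]eq_integral.
  move=> x _; rewrite fimfunE -fsumEFin// ge0_mule_fsuml; last first.
    by move=> r; rewrite EFinM nnfun_muleindic_ge0.
  over.
rewrite ge0_integral_fsum//; last 2 first.
- move=> r; apply: emeasurable_funM; apply/measurable_EFinP => //.
  exact: measurable_funM.
- by move=> r x _; rewrite mule_ge0 ?lee_fin// -lee_fin EFinM nnfun_muleindic_ge0.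
apply: eq_fsbigr => r _; have [r0|r0] := ltP r 0.
  rewrite preimage_nnfun0// measure0 mule0 integral0_eq// => x _.
  by rewrite indic0 mulr0 mul0e.
under eq_integral do rewrite EFinM -muleA.
rewrite ge0_integralZl_EFin//; last 2 first.
- by move=> x _; rewrite mule_ge0 ?lee_fin.
- by apply: emeasurable_funM; apply/measurable_EFinP.
congr (_ * _)%E; rewrite /density_measure [LHS]integral_mkcond.
apply: eq_integral => x _; rewrite patchE indicE.
by case: (x \in _); rewrite ?mul1e ?mul0e.
Qed.
End Density_integral.

Section Affine_substitution.
Context {R : realType}.
Local Notation leb := (@lebesgue_measure R).

Let aff (c k : R) (x : measurableTypeR R) : measurableTypeR R := c + k * (x : R).

Let measurable_aff c k : measurable_fun [set: measurableTypeR R] (aff c k).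
Proof. by apply: measurable_funD => //; exact: measurable_funM. Qed.

(** Lebesgue measure is determined by its values on the intervals ]a, b], so only these are
    compared. For [k < 0] their preimages are closed on the left and open on the right, hence the
    two cases. *)
Lemma lebesgue_measure_affine (c k : R) (A : set (measurableTypeR R)) : k != 0 ->
  measurable A ->
  (leb A = `|k|%:E * pushforward leb (aff c k) A)%E.
Proof.
move=> k0 mA.
pose pm : borel_measure R :=
  measure_function_pushforward__canonical__measure_function_Measure
    leb (measurable_aff c k).
pose nk := NngNum (normr_ge0 k).
change (leb A = mscale nk pm A).
apply: lebesgue_measure_unique => // _ [[a b]] _ <-.
change (leb `]a, b]%classic = (`|k|%:E * leb (aff c k @^-1` `]a, b]%classic))%E).
have eqi (B C : set (measurableTypeR R)) : B = C -> leb B = leb C by move=> ->.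
have [kp|kn|/eqP] := ltgtP k 0; last by rewrite (negbTE k0).
  rewrite (eqi (aff c k @^-1` _) `[(b - c) / k, (a - c) / k[%classic); last first.
    apply/seteqP; split => x /=; rewrite !in_itv/= /aff.
      by rewrite ler_ndivrMr// ltr_ndivlMr// => /andP[h1 h2]; lra.
    by rewrite ler_ndivrMr// ltr_ndivlMr// => /andP[h1 h2]; lra.
  rewrite !lebesgue_measure_itv/= !lte_fin.
  rewrite ltr_nM2r ?invr_lt0// ltrD2r; case: ifPn => // _; last by rewrite mule0.
  by rewrite -!EFinD -EFinM ltr0_norm//; congr EFin; field.
rewrite (eqi (aff c k @^-1` _) `](a - c) / k, (b - c) / k]%classic); last first.
  apply/seteqP; split => x /=; rewrite !in_itv/= /aff.
    by rewrite ler_pdivlMr// ltr_pdivrMr// => /andP[h1 h2]; lra.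
  by rewrite ler_pdivlMr// ltr_pdivrMr// => /andP[h1 h2]; lra.
rewrite !lebesgue_measure_itv/= !lte_fin.
rewrite ltr_pM2r ?invr_gt0// ltrD2r; case: ifPn => // _; last by rewrite mule0.
by rewrite -!EFinD -EFinM gtr0_norm//; congr EFin; field.
Qed.

Lemma ge0_integral_affine (c k : R) (f : R -> \bar R) : k != 0 ->
  measurable_fun [set: R] f -> (forall x, (0 <= f x)%E) ->
  (\int[leb]_x f x = `|k|%:E * \int[leb]_x f (c + k * x)%R)%E.
Proof.
move=> k0 mf f0.
pose pm : borel_measure R :=
  measure_function_pushforward__canonical__measure_function_Measure
    leb (measurable_aff c k).
pose nk := NngNum (normr_ge0 k).
rewrite (eq_measure_integral (mscale nk pm)); last first.
  by move=> A mA _; exact: lebesgue_measure_affine.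
rewrite ge0_integral_mscale//=; congr (_ * _)%E.
rewrite (@ge0_integral_pushforward _ _ _ _ _ _ (measurable_aff c k)) //.
Qed.
End Affine_substitution.

(** * The Gamma function *)

Section Calculus.
Context {R : realType}.
Local Notation leb := (@lebesgue_measure R).

Lemma integrable_continuous_itv (a b : R) (f : R -> R) :
  {in `[a, b], forall x, {for x, continuous f}} ->
  leb.-integrable `[a, b] (EFin \o f).
Proof.
move=> cf; apply: continuous_compact_integrable; first exact: segment_compact.
apply: continuous_in_subspaceT => x /set_mem xab; apply: cf; exact: xab.
Qed.

Lemma integral_is_derive (F f : R -> R) (a b : R) : a <= b ->
  {in `[a, b], forall x : R, is_derive x (1 : R) F (f x)} ->
  {in `[a, b], forall x, {for x, continuous f}} ->
  \int[leb]_(x in `[a, b]) f x = F b - F a.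
Proof.
rewrite le_eqVlt => /predU1P[<- _ _|ab dF cf].
  by rewrite set_itv1 Rintegral_set1 subrr.
have cF x : x \in `[a, b] -> {for x, continuous F}.
  move=> /dF h; apply: differentiable_continuous; apply/derivable1_diffP.
  exact: ex_derive.
have aab : a \in `[a, b] by rewrite in_itv/= lexx ltW.
have bab : b \in `[a, b] by rewrite in_itv/= lexx ltW.
rewrite /Rintegral (@continuous_FTC2 _ f F)//.
- by apply: continuous_in_subspaceT => x /set_mem xab; apply: cf; exact: xab.
- split.
  + by move=> x xab; have h := dF x (subset_itv_oo_cc xab); exact: ex_derive.
  + by apply: cvg_at_right_filter; exact: (cF _ aab).
  + by apply: cvg_at_left_filter; exact: (cF _ bab).
- move=> x xab; have h := dF x (subset_itv_oo_cc xab).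
  by rewrite derive1E; exact: derive_val.
Qed.

End Calculus.

Section GammaFunction.
Context {R : realType}.
Local Notation leb := (@lebesgue_measure R).
Implicit Types s p k : R.

(** The extended-real integral of which [Gamma] is the finite part. The recursion is proved for it
    without any convergence, and convergence for small [s] is then deduced from the recursion. *)
Definition gammaE s : \bar R :=
  (\int[leb]_(x in `]0%R, +oo[) (x `^ (s - 1) * expR (- x))%:E)%E.

Lemma continuous_powR_pos p x : 0 < x -> {for x, continuous (fun y : R => y `^ p)}.
Proof.
move=> x0; apply: differentiable_continuous; apply/derivable1_diffP.
by apply: derivable_powR; rewrite in_itv/= x0.
Qed.

Lemma continuous_expRM k : continuous (fun y : R => expR (k * y)).
Proof.
move=> x; apply: continuous_comp; last exact: continuous_expR.
by apply: continuousM => //; exact: cst_continuous.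
Qed.

Lemma continuous_expRN : continuous (fun y : R => expR (- y)).
Proof.
by move=> x; under eq_fun do rewrite -mulN1r; exact: continuous_expRM.
Qed.

Lemma measurable_gamma_integrand p k :
  measurable_fun [set: R] (fun x : R => x `^ p * expR (k * x)).
Proof.
apply: measurable_funM; first exact: measurable_powR.
by apply: continuous_measurable_fun; exact: continuous_expRM.
Qed.

Lemma measurable_gamma_integrandN p :
  measurable_fun [set: R] (fun x : R => x `^ p * expR (- x)).
Proof.
by under eq_fun do rewrite -mulN1r; exact: measurable_gamma_integrand.
Qed.

Lemma gamma_by_parts s (a b : R) : 0 < s -> 0 < a -> a <= b ->
  \int[leb]_(x in `[a, b]) (x `^ s * expR (- x)) =
  s * \int[leb]_(x in `[a, b]) (x `^ (s - 1) * expR (- x))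
  + (a `^ s * expR (- a) - b `^ s * expR (- b)).
Proof.
move=> s0 a0 ab.
have pos x : x \in `[a, b] -> 0 < x.
  by rewrite in_itv/= => /andP[ax _]; exact: lt_le_trans ax.
have cpow p x : x \in `[a, b] ->
    {for x, continuous (fun y : R => y `^ p * expR (- y))}.
  move=> /pos x0; apply: continuousM; first exact: continuous_powR_pos.
  exact: continuous_expRN.
have i1 := integrable_continuous_itv (cpow s).
have i2 := integrable_continuous_itv (cpow (s - 1)).
rewrite -RintegralZl//.
apply/eqP; rewrite addrC -subr_eq; apply/eqP.
rewrite -RintegralB//; last first.
  exact: (integrableZl _ s i2).
rewrite (@integral_is_derive _ (fun x => - (x `^ s * expR (- x)))) //.
- by rewrite opprK addrC.
- move=> x /pos x0; have := is_derive1_powR s x0 => dp.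
  apply: is_derive_eq; rewrite /GRing.scale/=; ring.
- move=> x xab; apply: continuousB; first exact: cpow.
  by apply: continuousM; [exact: cst_continuous|exact: cpow].
Qed.


Lemma gammaE_ge0 s : (0 <= gammaE s)%E.
Proof.
by apply: integral_ge0 => x _; rewrite lee_fin mulr_ge0 ?powR_ge0 ?expR_ge0.
Qed.

(** Compact intervals exhausting the open half-line: the integrand is continuous on each of them,
    whereas for [s < 1] it is singular at 0. *)
Let I n : set R := `[n.+1%:R^-1, n.+1%:R]%classic.

Let bigcupI : \bigcup_n I n = `]0, +oo[%classic.
Proof.
apply/seteqP; split => [x [n _]|x]; rewrite /I /= !in_itv/= ?andbT.
  by move=> /andP[+ _]; apply: lt_le_trans; rewrite invr_gt0.
move=> x0; exists (Num.truncn (x + x^-1)) => //=.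
have := truncnS_gt (x + x^-1); set N := _%:R => hN.
have N0 : 0 < N by rewrite ltr0n.
rewrite in_itv/=; apply/andP; split.
  rewrite -[leRHS]invrK lef_pV2 ?posrE ?invr_gt0//.
  by apply/ltW; apply: le_lt_trans hN; rewrite lerDr ltW.
by apply/ltW; apply: le_lt_trans hN; rewrite lerDl invr_ge0 ltW.
Qed.

Let gammaE_lim s :
  (\int[leb]_(x in I n) (x `^ (s - 1) * expR (- x))%:E)%E @[n --> \oo] -->
  gammaE s.
Proof.
rewrite /gammaE -bigcupI; apply: ge0_nondecreasing_set_cvg_integral.
- move=> m n mn; apply/subsetPset => x /=; rewrite /I/= !in_itv/= => /andP[h1 h2].
  rewrite (le_trans _ h1) ?(le_trans h2) ?ler_nat//.
  by rewrite lef_pV2 ?posrE ?ler_nat.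
- by move=> n; exact: measurable_itv.
- move=> n; apply/measurable_funTS/measurable_EFinP.
  exact: measurable_gamma_integrandN.
- by move=> n x _; rewrite lee_fin mulr_ge0 ?powR_ge0 ?expR_ge0.
Qed.

Lemma expr_le_expR (x : R) (n : nat) : 0 <= x -> x ^+ n.+1 <= n.+1`!%:R * expR x.
Proof.
move=> x0; rewrite -ler_pdivrMl ?ltr0n ?fact_gt0// mulrC.
by apply: le_trans (expR_ge1Dxn n x0); rewrite lerDr.
Qed.

(** The exponential series gives (x / 2)^(n + 1) <= (n + 1)! exp (x / 2), with n + 1 above |p|. Only
    exp (x / 2) is spent, so that multiplication by exp (- x) still leaves a decaying factor. *)
Lemma powR_le_expR (p : R) : {C : R | 0 < C &
  forall x : R, 1 <= x -> x `^ p <= C * expR (x / 2)}.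
Proof.
set n := Num.truncn `|p|.
exists (2 ^+ n.+1 * n.+1`!%:R) => [|x x1].
  by rewrite mulr_gt0 ?exprn_gt0// ltr0n fact_gt0.
have x0 : 0 < x by exact: lt_le_trans x1.
apply: (@le_trans _ _ (x ^+ n.+1)).
  rewrite -powR_mulrn ?(ltW x0)//; apply: ler_powR => //.
  apply: le_trans (ler_norm p) _; exact/ltW/truncnS_gt.
rewrite -mulrA -ler_pdivrMl ?exprn_gt0//.
by rewrite mulrC -expr_div_n; apply: expr_le_expR; rewrite divr_ge0 ?ltW.
Qed.

Lemma powR_expRN_cvg0 s : (n.+1%:R `^ s * expR (- n.+1%:R : R)) @[n --> \oo] --> (0 : R).
Proof.
have [C C0 hC] := powR_le_expR s.
apply: (@squeeze_cvgr _ _ _ _ (cst 0) (fun n => C * 2 * n.+1%:R^-1)).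
- apply: nearW => n; rewrite mulr_ge0 ?powR_ge0 ?expR_ge0//=.
  have := hC n.+1%:R; rewrite ler1n => /(_ isT) h.
  have e : n.+1%:R / 2 <= expR (n.+1%:R / 2) :> R.
    by apply: le_trans (expR_ge1Dx _); rewrite lerDr.
  rewrite [X in expR (- X)](splitr (n.+1%:R : R)) opprD expRD mulrA expRN.
  move: (expR _) (expR_gt0 (n.+1%:R / 2 : R)) h e => E E0 h e.
  apply: (@le_trans _ _ (C / E)).
    by rewrite ler_pM2r ?invr_gt0// ler_pdivrMr.
  rewrite -mulrA (ler_pM2l C0) -[2]invrK -invfM lef_pV2 ?posrE ?mulr_gt0 ?invr_gt0//.
  by rewrite mulrC.
- exact: cvg_cst.
- rewrite -[0](mulr0 (C * 2)); apply: cvgM; first exact: cvg_cst.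
  exact: cvg_harmonic.
Qed.

Lemma powR_inv_expRN_cvg0 s : 0 < s ->
  (n.+1%:R^-1 `^ s * expR (- n.+1%:R^-1 : R)) @[n --> \oo] --> (0 : R).
Proof.
move=> s0.
apply: (@squeeze_cvgr _ _ _ _ (cst 0) (fun n => n.+1%:R^-1 `^ s)).
- apply: nearW => n; rewrite mulr_ge0 ?powR_ge0 ?expR_ge0//=.
  rewrite ler_piMr ?powR_ge0// -expR0 ler_expR oppr_le0 invr_ge0//.
- exact: cvg_cst.
- have /cvg_at_rightP := powR_cvg0 s0; apply; split => [n|]; first by rewrite invr_gt0.
  exact: cvg_harmonic.
Qed.

Lemma gammaES s : 0 < s -> gammaE (s + 1) = (s%:E * gammaE s)%E.
Proof.
move=> s0.
have l1 := @gammaE_lim (s + 1).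
apply: (cvg_unique _ l1) => //.
have l2 := @gammaE_lim s.
have : (s%:E * \int[leb]_(x in I n) (x `^ (s - 1) * expR (- x))%:E
  + (n.+1%:R^-1 `^ s * expR (- n.+1%:R^-1) - n.+1%:R `^ s * expR (- n.+1%:R))%:E)%E
  @[n --> \oo] --> (s%:E * gammaE s + 0)%E.
  apply: cvgeD.
  - by rewrite fin_num_adde_defl.
  - apply: cvgeZl => //.
  - apply: cvg_EFin; first by apply: nearW.
    rewrite -[0](subr0 0).
    by apply: cvgB; [exact: powR_inv_expRN_cvg0|exact: powR_expRN_cvg0].
rewrite adde0; apply: cvg_trans; apply: near_eq_cvg; apply: nearW => n.
have ab : (n.+1%:R : R)^-1 <= n.+1%:R.
  by rewrite (@le_trans _ _ 1)// ?ler1n// invf_le1 ?ler1n.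
have pos x : x \in `[n.+1%:R^-1, n.+1%:R] -> 0 < x.
  by rewrite in_itv/= => /andP[ax _]; apply: lt_le_trans ax; rewrite invr_gt0.
have i p : leb.-integrable (I n) (EFin \o (fun y => y `^ p * expR (- y))).
  apply: integrable_continuous_itv => x /pos x0; apply: continuousM.
    exact: continuous_powR_pos.
  exact: continuous_expRN.
have := @gamma_by_parts s _ _ s0 _ ab; rewrite invr_gt0 ltr0n => /(_ isT).
rewrite /Rintegral => h.
rewrite addrK.
rewrite -(fineK (integrable_fin_num _ (i s))) ?h//; last exact: measurable_itv.
rewrite -[in LHS](fineK (integrable_fin_num _ (i (s - 1)))); last exact: measurable_itv.
by rewrite EFinD EFinM.
Qed.

Lemma gammaE_lty s : 0 < s -> (gammaE s < +oo)%E.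
Proof.
(* The value at s + 1 is s times the value at s, so finiteness at s + 1 >= 1 excludes the value +oo
   at s. *)
suff ge1 q : 1 <= q -> (gammaE q < +oo)%E.
  move=> s0; have : (gammaE (s + 1) < +oo)%E by apply: ge1; rewrite lerDr ltW.
  rewrite gammaES// => h; rewrite ltey; apply/eqP => hy; move: h.
  by rewrite hy gt0_muley// lte_fin.
move=> q1; have [C C0 hC] := powR_le_expR (q - 1).
have C1 : 0 <= C + 1 by lra.
(* The dominating function is a multiple of the exponential density of rate 1/2, whose total mass is
   1. *)
apply: (@le_lt_trans _ _
    (\int[leb]_(x in `]0%R, +oo[) ((C + 1) * 2 * exponential_pdf (2^-1) x)%:E)%E).
  apply: ge0_le_integral => //.
  - by move=> x _; rewrite lee_fin mulr_ge0 ?powR_ge0 ?expR_ge0.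
  - by apply/measurable_funTS/measurable_EFinP; exact: measurable_gamma_integrandN.
  - apply/measurable_funTS/measurable_EFinP/measurable_funM => //.
    exact: measurable_exponential_pdf.
  move=> x /=; rewrite in_itv/= andbT => x0; rewrite lee_fin.
  rewrite exponential_pdfE ?(ltW x0)// mulNr !expRN.
  have -> : expR x = expR (x / 2) * expR (x / 2) by rewrite -expRD -splitr.
  rewrite (mulrC _ x).
  have e1 : 1 <= expR (x / 2) by rewrite -[leLHS]expR0 ler_expR divr_ge0// (ltW x0).
  suff h : x `^ (q - 1) <= (C + 1) * expR (x / 2).
    move: (expR _) (expR_gt0 (x / 2)) h => E E0 h.
    rewrite (_ : _ * 2 * _ = (C + 1) * E / (E * E)); last by field; lra.
    by rewrite ler_wpM2r// invr_ge0 mulr_ge0// ltW.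
  have [x1|x1] := leP 1 x.
    by apply: (le_trans (hC _ x1)); rewrite ler_wpM2r ?expR_ge0//; lra.
  apply: (@le_trans _ _ 1); last by nra.
  have q0 : 0 <= q - 1 by lra.
  have {}q0 := ge0_ler_powR q0; have e11 : 1 `^ (q - 1) = 1 :> R by rewrite powR1.
  rewrite -[leRHS]e11.
  by apply: q0; rewrite ?nnegrE// ltW.
apply: (@le_lt_trans _ _
    (\int[leb]_x ((C + 1) * 2 * exponential_pdf (2^-1) x)%:E)%E).
  apply: ge0_subset_integral => //.
  - apply/measurable_EFinP/measurable_funM => //.
    exact: measurable_exponential_pdf.
  - move=> x _; rewrite lee_fin mulr_ge0 ?mulr_ge0// exponential_pdf_ge0//.
under eq_integral do rewrite EFinM.
rewrite ge0_integralZl_EFin//; last 3 first.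
- by move=> x _; rewrite lee_fin exponential_pdf_ge0.
- by apply/measurable_EFinP; exact: measurable_exponential_pdf.
- by rewrite mulr_ge0.
by rewrite integral_exponential_pdf// mule1 ltry.
Qed.

Lemma EFin_Gamma s : 0 < s -> (Gamma s)%:E = gammaE s.
Proof.
by move=> s0; rewrite /Gamma /Rintegral fineK// ge0_fin_numE ?gammaE_lty ?gammaE_ge0.
Qed.

Lemma GammaS s : 0 < s -> Gamma (s + 1) = s * Gamma s.
Proof.
move=> s0; apply: EFin_inj; rewrite EFinM !EFin_Gamma ?gammaES//.
by rewrite addr_gt0.
Qed.

Lemma Gamma_gt0 s : 0 < s -> 0 < Gamma s.
Proof.
move=> s0; rewrite -lte_fin EFin_Gamma//.
(* A lower bound of the integrand on [1, 2]: the power is at least the smaller of its values at the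
   ends, the exponential at least exp (- 2). *)
pose c : R := Num.min 1 (2 `^ (s - 1)) * expR (- 2).
have c0 : 0 < c by rewrite mulr_gt0 ?expR_gt0// lt_min ltr01 powR_gt0.
have h12 : (\int[leb]_(x in `[1%R, 2%R]) c%:E = c%:E)%E.
  rewrite integral_cst//= lebesgue_measure_itv/= lte_fin ltr1n -EFinD.
  by rewrite (_ : 2 - 1 = 1 :> R) ?mule1//; ring.
apply: (@lt_le_trans _ _ c%:E); first by rewrite lte_fin.
rewrite -h12; apply: (@le_trans _ _
    (\int[leb]_(x in `[1%R, 2%R]) (x `^ (s - 1) * expR (- x))%:E)%E); last first.
  apply: ge0_subset_integral => //.
  - by apply/measurable_funTS/measurable_EFinP; exact: measurable_gamma_integrandN.
  - by move=> x _; rewrite lee_fin mulr_ge0 ?powR_ge0 ?expR_ge0.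
  - by move=> x /=; rewrite !in_itv/= andbT => /andP[x1 _]; exact: lt_le_trans x1.
apply: ge0_le_integral => //.
- by move=> x _; rewrite lee_fin ltW.
- by apply/measurable_funTS/measurable_EFinP; exact: measurable_gamma_integrandN.
move=> x /=; rewrite in_itv/= => /andP[x1 x2]; rewrite lee_fin.
have x0 : 0 < x by exact: lt_le_trans x1.
apply: ler_pM; rewrite ?expR_ge0 ?ler_expR ?lerN2//.
rewrite ge_min; have [s1|s1] := leP 1 s.
  have q0 : 0 <= s - 1 by lra.
  have {}q0 := ge0_ler_powR q0; have e11 : 1 `^ (s - 1) = 1 :> R by rewrite powR1.
  rewrite -[leLHS]e11.
  by rewrite q0 ?nnegrE// ltW.
apply/orP; right.
have q0 : 0 <= 1 - s by lra.
have {}q0 := ge0_ler_powR q0.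
rewrite -(opprB 1 s) !powRN lef_pV2 ?posrE ?powR_gt0//.
by rewrite q0 ?nnegrE// ltW.
Qed.

End GammaFunction.

(** * Local Sobolev functions on the line *)

Section RealIntegrable.
Context d {T : measurableType d} {R : realType} (nu : {measure set T -> \bar R}).
Implicit Types (D : set T) (f g h : T -> R).

Definition rint D f := nu.-integrable D (EFin \o f).

Lemma rint_measurable D f : rint D f -> measurable_fun D f.
Proof. by move=> /integrableP[/measurable_EFinP]. Qed.

Lemma rintD D f g : measurable D -> rint D f -> rint D g ->
  rint D (fun x => f x + g x).
Proof. by move=> mD; exact: integrableD. Qed.

Lemma rintB D f g : measurable D -> rint D f -> rint D g ->
  rint D (fun x => f x - g x).
Proof. by move=> mD; exact: integrableB. Qed.

Lemma rintZ D k f : measurable D -> rint D f -> rint D (fun x => k * f x).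
Proof. by move=> mD; exact: integrableZl. Qed.

Lemma le_rint D f g : measurable D -> measurable_fun D f ->
  (forall x, D x -> `|f x| <= `|g x|) -> rint D g -> rint D f.
Proof.
by move=> mD mf fg; apply: le_integrable => //; exact/measurable_EFinP.
Qed.

Lemma rintM_bounded D (M : R) f h : measurable D -> measurable_fun D h ->
  (forall x, D x -> `|h x| <= M) -> rint D f -> rint D (fun x => h x * f x).
Proof.
move=> mD mh hM fi.
apply: (@le_rint _ _ (fun x => M * f x)) => //; last exact: rintZ.
  by apply: measurable_funM => //; exact: rint_measurable fi.
move=> x Dx; rewrite !normrM ler_wpM2r//.
by rewrite (le_trans (hM _ Dx))// ler_norm.
Qed.

Lemma rint_norm D f : measurable D -> rint D f -> rint D (fun x => `|f x|).
Proof.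
move=> mD fi; apply: (le_rint mD _ _ fi).
  by apply: measurableT_comp => //; exact: rint_measurable fi.
by move=> x _; rewrite normr_id.
Qed.

Lemma rint_fin D f : measurable D -> rint D f ->
  (\int[nu]_(x in D) f x)%:E = (\int[nu]_(x in D) (f x)%:E)%E.
Proof. by move=> mD fi; rewrite /Rintegral fineK//; exact: integrable_fin_num. Qed.

End RealIntegrable.

Section WeakDerivative.
Context {R : realType}.
Local Notation leb := (@lebesgue_measure R).
Implicit Types (f g h : R -> R) (p q r x : R).

Lemma rint_itv_cst p q (c : R) : rint leb `[p, q] (fun=> c).
Proof.
apply/integrableP; split; first exact: measurable_cst.
rewrite integral_cst//= lebesgue_measure_itv/=; case: ifP => _.
  by rewrite -EFinD -EFinM ltry.
by rewrite mule0 ltry.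
Qed.

Lemma rint_sqr g p q : measurable_fun [set: R] g ->
  (\int[leb]_(x in `[p, q]) (g x ^+ 2)%:E < +oo)%E ->
  rint leb `[p, q] (fun x => g x ^+ 2).
Proof.
move=> mg g2; apply/integrableP; split.
  by apply/measurable_EFinP/measurable_funTS; exact: measurable_funX.
by under eq_integral do rewrite /= ger0_norm ?sqr_ge0//.
Qed.

Lemma rint_of_sqr g p q : measurable_fun [set: R] g ->
  (\int[leb]_(x in `[p, q]) (g x ^+ 2)%:E < +oo)%E -> rint leb `[p, q] g.
Proof.
move=> mg g2; have := @le_rint _ _ _ leb `[p, q]%classic g (fun x => 1 + g x ^+ 2).
apply => //.
- exact: measurable_funTS.
- move=> x _; rewrite [leRHS]ger0_norm ?addr_ge0 ?sqr_ge0//.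
  by rewrite -(real_normK (num_real (g x))); nra.
- by apply: rintD => //; [exact: rint_itv_cst|exact: rint_sqr].
Qed.

Lemma wd_int f g p q : is_wderiv f g -> rint leb `[p, q] g.
Proof. by move=> [mg g2 _]; exact: rint_of_sqr. Qed.

Lemma wd_eq f g p q : is_wderiv f g -> p <= q ->
  f q = f p + \int[leb]_(x in `[p, q]) g x.
Proof. by move=> [_ _ h] pq; rewrite -h// addrC subrK. Qed.

Lemma wd_continuous f g : is_wderiv f g -> continuous f.
Proof.
move=> fg x.
have ab : x - 1 <= x + 1 by lra.
have := parameterized_integral_continuous ab (wd_int _ _ fg).
rewrite continuous_within_itvP; last by lra.
move=> [/(_ x) + _ _]; rewrite in_itv/=.
have -> : (x - 1 < x < x + 1) = true by apply/andP; split; lra.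
move=> /(_ isT) c.
have : {for x, continuous (fun y => f (x - 1) + parameterized_integral leb (x - 1) y g)}.
  by apply: continuousD => //; exact: cst_continuous.
rewrite /prop_for /continuous_at -(wd_eq fg); last by lra.
apply: cvg_trans; apply: near_eq_cvg; near=> y.
rewrite -(wd_eq fg)//; near: y.
by apply: lt_le_nbhsr; lra.
Unshelve. all: by end_near. Qed.

Lemma wd_measurable f g : is_wderiv f g -> measurable_fun [set: R] f.
Proof. by move=> /wd_continuous; exact: continuous_measurable_fun. Qed.

Lemma wd_bounded f g p q : is_wderiv f g ->
  {M : R | 0 <= M & forall x, x \in `[p, q] -> `|f x| <= M}.
Proof.
move=> fg; exists (`|f p| + \int[leb]_(x in `[p, q]) `|g x|).
  by rewrite addr_ge0// Rintegral_ge0.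
move=> x; rewrite in_itv/= => /andP[px xq].
rewrite (wd_eq fg px) (le_trans (ler_normD _ _))// lerD2l.
rewrite (le_trans (le_normr_Rintegral _ (wd_int _ _ fg)))//.
rewrite -lee_fin !rint_fin//; last 2 first.
- exact: (rint_norm _ (wd_int _ _ fg)).
- exact: (rint_norm _ (wd_int _ _ fg)).
apply: ge0_subset_integral => //.
- apply/measurable_EFinP; apply: measurableT_comp => //.
  by have [mg _ _] := fg; exact: measurable_funTS.
- by move=> y; rewrite /= !in_itv/= => /andP[-> /le_trans]; apply.
Qed.

Lemma wd_locally_integrable f g : is_wderiv f g -> locally_integrable setT g.
Proof.
move=> fg; have [mg _ _] := fg; split => //; first exact: openT.
move=> K _ cK.
have [M [Mr hM]] := compact_bounded cK.
have KM : K `<=` `[- (`|M| + 1), `|M| + 1].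
  move=> x Kx; rewrite /= in_itv/= -ler_norml; apply: hM => //.
  by rewrite (le_lt_trans (ler_norm M))// ltrDl.
have mK : measurable K by apply: closed_measurable; exact: compact_closed.
have /integrableP[_ hi] := wd_int (- (`|M| + 1)) (`|M| + 1) fg.
apply: le_lt_trans hi; apply: ge0_subset_integral => //.
by apply/measurable_EFinP; apply: measurableT_comp => //; exact: measurable_funTS.
Qed.

Lemma ae_impl (P Q : R -> Prop) : (forall x, P x -> Q x) ->
  {ae leb, forall x, P x} -> {ae leb, forall x, Q x}.
Proof. by move=> PQ; apply: filterS; first exact: (ae_filter_ringOfSetsType leb). Qed.

Lemma ae_impl2 (P1 P2 Q : R -> Prop) : (forall x, P1 x -> P2 x -> Q x) ->
  {ae leb, forall x, P1 x} -> {ae leb, forall x, P2 x} ->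
  {ae leb, forall x, Q x}.
Proof. by move=> PQ; apply: filterS2; first exact: (ae_filter_ringOfSetsType leb). Qed.

(** By Lebesgue's differentiation theorem both are almost everywhere the classical derivative of one
    and the same primitive. A primitive needs a base point to the left of x, hence the countably
    many points - n. *)
Lemma wd_unique f g1 g2 : is_wderiv f g1 -> is_wderiv f g2 ->
  {ae leb, forall x, g1 x = g2 x}.
Proof.
move=> w1 w2.
pose P (n : nat) x := - n%:R < x -> g1 x = g2 x.
suff : {ae leb, forall x, forall n, P n x}.
  apply: ae_impl => x /(_ (Num.truncn `|x|).+1); apply.
  rewrite ltrNl (le_lt_trans _ (truncnS_gt _))//.
  by rewrite -normrN ler_norm.
apply/ae_foralln => n.
have h1 := @FTC1 R g1 (BLeft (- n%:R)) (fun y => wd_int _ _ w1)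
  (wd_locally_integrable w1).
have h2 := @FTC1 R g2 (BLeft (- n%:R)) (fun y => wd_int _ _ w2)
  (wd_locally_integrable w2).
apply: (ae_impl2 _ h1 h2) => x {}h1 {}h2 nx.
have [|_ <-] := h1; first by rewrite /= lte_fin.
have [|_ <-] := h2; first by rewrite /= lte_fin.
congr (derive1 _ x); apply/funext => y.
have [ny|yn] := leP (- n%:R) y.
  by have [_ _ <-//] := w1; have [_ _ <-//] := w2.
by rewrite !set_itv_ge ?Rintegral_set0// bnd_simp -ltNge.
Qed.

Lemma wd_wderiv f g : is_wderiv f g -> is_wderiv f (wderiv f).
Proof. by move=> fg; rewrite /wderiv; apply: (xgetPex (fun=> 0)); exists g. Qed.

Lemma wderivE f g : is_wderiv f g -> {ae leb, forall x, wderiv f x = g x}.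
Proof. by move=> fg; exact: (wd_unique (wd_wderiv fg) fg). Qed.

Lemma wd_C1 f g : (forall x, is_derive x (1 : R) f (g x)) -> continuous g ->
  is_wderiv f g.
Proof.
move=> fg cg; split.
- exact: continuous_measurable_fun.
- move=> p q.
  have : leb.-integrable `[p, q] (EFin \o (fun x => g x ^+ 2)).
    by apply: integrable_continuous_itv => x _; exact: (continuousM (cg x) (cg x)).
  move=> /integrableP[_]; under eq_integral do rewrite /= ger0_norm ?sqr_ge0//.
  by [].
- by move=> p q pq; apply/esym/integral_is_derive => // x _; exact: cg.
Qed.

Lemma rint_itvD p r q g : p <= r -> r <= q -> rint leb `[p, q] g ->
  \int[leb]_(x in `[p, q]) g x =
  \int[leb]_(x in `[p, r]) g x + \int[leb]_(x in `[r, q]) g x.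
Proof.
move=> pr rq gi.
have gi1 : rint leb `[r, q] g.
  by apply: integrableS gi => //; apply: subset_itvr; rewrite bnd_simp.
rewrite -(@Rintegral_itv_obnd_cbnd _ r (BRight q) g); last first.
  by apply: integrableS gi1 => //; exact: subset_itv_oc_cc.
by rewrite -(Rintegral_itvB gi) ?bnd_simp// addrC subrK.
Qed.

(** Equality of the two values at [r] is the only compatibility condition, since a weak derivative
    may jump. *)
Lemma wd_glue f1 g1 f2 g2 r : is_wderiv f1 g1 -> is_wderiv f2 g2 ->
  f1 r = f2 r ->
  is_wderiv (fun x => if x < r then f1 x else f2 x)
            (fun x => if x < r then g1 x else g2 x).
Proof.
move=> w1 w2 e.
have [m1 _ _] := w1; have [m2 _ _] := w2.
have mg : measurable_fun [set: R] (fun x => if x < r then g1 x else g2 x).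
  by apply: measurable_fun_ifT => //; apply: measurable_fun_ltr.
have left p q : q <= r -> \int[leb]_(x in `[p, q]) (if x < r then g1 x else g2 x)
    = \int[leb]_(x in `[p, q]) g1 x.
  move=> qr.
  have mI (g : R -> R) : measurable_fun [set: R] g ->
      \int[leb]_(x in `[p, q]) g x = \int[leb]_(x in `[p, q[) g x.
    move=> m; rewrite /Rintegral integral_itv_bndo_bndc//.
    by apply/measurable_EFinP; exact: measurable_funTS.
  rewrite !mI//; apply: eq_Rintegral => x /set_mem/=; rewrite in_itv/= => /andP[_ xq].
  by rewrite (lt_le_trans xq qr).
have right p q : r <= p -> \int[leb]_(x in `[p, q]) (if x < r then g1 x else g2 x)
    = \int[leb]_(x in `[p, q]) g2 x.
  move=> rp; apply: eq_Rintegral => x /set_mem/=; rewrite in_itv/= => /andP[px _].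
  by rewrite ltNge (le_trans rp px).
have L2 p q : (\int[leb]_(x in `[p, q]) ((if x < r then g1 x else g2 x) ^+ 2)%:E < +oo)%E.
  apply: (@le_lt_trans _ _ (\int[leb]_(x in `[p, q]) ((g1 x ^+ 2)%:E + (g2 x ^+ 2)%:E))%E).
    apply: ge0_le_integral => //.
    - by move=> x _; rewrite lee_fin sqr_ge0.
    - by apply/measurable_EFinP/measurable_funTS/measurable_funX.
    - apply: emeasurable_funD; apply/measurable_EFinP/measurable_funTS;
      exact: measurable_funX.
    move=> x _; rewrite -EFinD lee_fin; case: ifP => _.
      by rewrite lerDl sqr_ge0.
    by rewrite lerDr sqr_ge0.
  rewrite ge0_integralD//.
  - by rewrite lte_add_pinfty//; [have [_ h _] := w1|have [_ h _] := w2]; exact: h.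
  - by move=> x _; rewrite lee_fin sqr_ge0.
  - by apply/measurable_EFinP/measurable_funTS/measurable_funX.
  - by move=> x _; rewrite lee_fin sqr_ge0.
  - by apply/measurable_EFinP/measurable_funTS/measurable_funX.
split => // p q pq.
have [rp|pr] := leP r p.
  by rewrite ltNge (le_trans rp pq)/= right//; have [_ _ ->] := w2.
have [rq|qr] := leP r q; last first.
  by rewrite left ?ltW//; have [_ _ ->] := w1.
rewrite (rint_itvD (ltW pr) rq); last exact: rint_of_sqr.
rewrite left ?lexx// right ?lexx//.
have [_ _ <-] := w1; last exact: ltW.
have [_ _ <-//] := w2.
by rewrite e; ring.
Qed.

End WeakDerivative.

(** * Integration by parts and the product rule for weak derivatives *)

Section ProductRule.
Context {R : realType}.
Local Notation leb := (@lebesgue_measure R).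
Implicit Types (f g h : R -> R) (p q r x y : R).

Lemma RFubini (k : R * R -> R) (H : rint (leb \x leb)%E [set: R * R] k) :
  (forall x, rint leb [set: R] (fun y => k (x, y))) ->
  (forall y, rint leb [set: R] (fun x => k (x, y))) ->
  \int[leb]_x \int[leb]_y k (x, y) = \int[leb]_y \int[leb]_x k (x, y).
Proof.
move=> i1 i2.
have := @Fubini _ _ _ _ R leb leb (EFin \o k) H.
rewrite /Rintegral => e; congr fine.
transitivity (\int[leb]_x \int[leb]_y (EFin \o k) (x, y))%E.
  by apply: eq_integral => x _; exact: rint_fin (i1 x).
rewrite e; apply: eq_integral => y _; symmetry; exact: rint_fin (i2 y).
Qed.

Lemma rint_triangle (a1 a2 : R -> R) :
  rint leb [set: R] a1 -> rint leb [set: R] a2 ->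
  rint (leb \x leb)%E [set: R * R] (fun z => a2 z.1 * (a1 z.2 * (z.2 <= z.1)%R%:R)).
Proof.
move=> i1 i2.
have m1 := rint_measurable i1; have m2 := rint_measurable i2.
have mk : measurable_fun [set: R * R]
    (fun z : R * R => a2 z.1 * (a1 z.2 * (z.2 <= z.1)%R%:R)).
  apply: measurable_funM; first exact: (measurableT_comp m2 (measurable_fst)).
  apply: measurable_funM; first exact: (measurableT_comp m1 (measurable_snd)).
  rewrite (_ : (fun z => _) = (fun z : R * R => if z.2 <= z.1 then 1 else 0 : R)).
    apply: measurable_fun_ifT => //; apply: measurable_fun_ler => //.
  by apply/funext => z; case: (_ <= _).
apply/(integrable12ltyP leb leb); first exact/measurable_EFinP.
apply: (@le_lt_trans _ _ (\int[leb]_x (`|a2 x|%:E * \int[leb]_y (`|a1 y|)%:E))%E).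
  apply: ge0_le_integral => //.
  - by move=> x _; exact: integral_ge0.
  - have mk' : measurable_fun [set: R * R] (fun z : R * R =>
        `|(a2 z.1 * (a1 z.2 * (z.2 <= z.1)%R%:R))%:E|%E).
      by apply: measurableT_comp => //; exact/measurable_EFinP.
    by apply: (measurable_fun_fubini_tonelli_F (m2 := leb) _ mk') => z; exact: abse_ge0.
  - apply: emeasurable_funM => //.
    by apply/measurable_EFinP; exact: measurableT_comp.
  move=> x _; rewrite -ge0_integralZl_EFin//; last first.
    by apply/measurable_EFinP; exact: measurableT_comp.
  apply: ge0_le_integral => //.
  - apply: measurableT_comp => //; apply/measurable_EFinP.
    exact: (measurableT_comp mk (measurable_pair1 x)).
  - apply: emeasurable_funM => //.
    by apply/measurable_EFinP; exact: measurableT_comp.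
  move=> y _; rewrite -EFinM lee_fin !normrM ler_wpM2l// ler_piMr//=.
  by case: (y <= x)%R; rewrite ?normr1 ?normr0.
have n1 := rint_fin measurableT (rint_norm measurableT i1).
have n2 := rint_fin measurableT (rint_norm measurableT i2).
rewrite -n1 ge0_integralZr//; last 2 first.
- by apply/measurable_EFinP; exact: measurableT_comp.
- by rewrite lee_fin Rintegral_ge0.
by rewrite -n2 -EFinM ltry.
Qed.

Lemma rint_patch D g : measurable D -> rint leb D g -> rint leb [set: R] (g \_ D).
Proof.
move=> mD gi; rewrite /rint -restrict_EFin.
by apply/integrable_restrict => //; rewrite setTI.
Qed.

(** Both sides are iterated integrals of g1(y) g2(x) over the triangle p <= y <= x <= q, taken in
    the two orders; Fubini's theorem applies. *)
Lemma wd_by_parts f1 g1 f2 g2 p q : is_wderiv f1 g1 -> is_wderiv f2 g2 -> p <= q ->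
  \int[leb]_(x in `[p, q]) (g2 x * (f1 x - f1 p)) =
  \int[leb]_(x in `[p, q]) (g1 x * (f2 q - f2 x)).
Proof.
move=> w1 w2 pq.
have i1 := rint_patch (measurable_itv _) (wd_int p q w1).
have i2 := rint_patch (measurable_itv _) (wd_int p q w2).
set a1 := g1 \_ _ in i1; set a2 := g2 \_ _ in i2.
have k1 x : x \in `[p, q] ->
    (fun y => a1 y * (y <= x)%R%:R) = g1 \_ `[p, x]%classic.
  rewrite in_itv/= => /andP[px xq].
  apply/funext => y; rewrite /a1 !patchE; have [yx|xy] := leP y x.
    rewrite mulr1 !mem_setE !in_itv/= yx; case: (p <= y) => //=.
    by rewrite (le_trans yx xq).
  by rewrite mulr0 !mem_setE !in_itv/= [y <= x]leNgt xy andbF.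
have k2 y : y \in `[p, q] ->
    (fun x => a2 x * (y <= x)%R%:R) = g2 \_ `[y, q]%classic.
  rewrite in_itv/= => /andP[py yq].
  apply/funext => x; rewrite /a2 !patchE; have [yx|xy] := leP y x.
    rewrite mulr1 !mem_setE !in_itv/= yx; case: (x <= q) => //=; rewrite ?andbT ?andbF//.
    by rewrite (le_trans py yx).
  by rewrite mulr0 !mem_setE !in_itv/= [y <= x]leNgt xy.
have b1 x : rint leb [set: R] (fun y => a1 y * (y <= x)%R%:R).
  apply: (le_rint _ _ _ i1) => //.
    apply: measurable_funM; first exact: rint_measurable i1.
    rewrite (_ : (fun z => _) = (fun z : R => if z <= x then 1 else 0 : R)).
      by apply: measurable_fun_ifT => //; apply: measurable_fun_ler.
    by apply/funext => z; case: (_ <= _).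
  move=> y _; rewrite normrM ler_piMr//.
  by case: (y <= x)%R; rewrite ?normr1 ?normr0.
have b2 y : rint leb [set: R] (fun x => a2 x * (y <= x)%R%:R).
  apply: (le_rint _ _ _ i2) => //.
    apply: measurable_funM; first exact: rint_measurable i2.
    rewrite (_ : (fun z => _) = (fun z : R => if y <= z then 1 else 0 : R)).
      by apply: measurable_fun_ifT => //; apply: measurable_fun_ler.
    by apply/funext => z; case: (_ <= _).
  move=> x _; rewrite normrM ler_piMr//.
  by case: (y <= x)%R; rewrite ?normr1 ?normr0.
have := RFubini (rint_triangle i1 i2).
rewrite [X in X -> _]/=.
have -> : \int[leb]_x \int[leb]_y (a2 x * (a1 y * (y <= x)%R%:R)) =
    \int[leb]_(x in `[p, q]) (g2 x * (f1 x - f1 p)).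
  rewrite [RHS]Rintegral_mkcond; apply: eq_Rintegral => x _.
  rewrite (RintegralZl _ measurableT (b1 x)) /a2 !patchE; case: ifPn => [|_]; last by rewrite mul0r.
  move=> /set_mem xpq; rewrite (k1 _ xpq) -Rintegral_mkcond.
  by have [_ _ ->//] := w1; move: xpq; rewrite /= in_itv/= => /andP[].
have -> : \int[leb]_y \int[leb]_x (a2 x * (a1 y * (y <= x)%R%:R)) =
    \int[leb]_(y in `[p, q]) (g1 y * (f2 q - f2 y)).
  rewrite [RHS]Rintegral_mkcond; apply: eq_Rintegral => y _.
  under eq_Rintegral do rewrite mulrCA.
  rewrite (RintegralZl _ measurableT (b2 y)) /a1 !patchE; case: ifPn => [|_]; last by rewrite mul0r.
  move=> /set_mem ypq; rewrite (k2 _ ypq) -Rintegral_mkcond.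
  by have [_ _ ->//] := w2; move: ypq; rewrite /= in_itv/= => /andP[].
apply => [x|y]; first exact: rintZ.
by under [X in rint _ _ X]eq_fun do rewrite mulrCA; exact: rintZ.
Qed.

Lemma wd_bounded_mul f g h k p q : is_wderiv f g -> is_wderiv h k ->
  rint leb `[p, q] (fun x => f x * k x).
Proof.
move=> w1 w2; have [M M0 hM] := wd_bounded p q w1.
apply: (@rintM_bounded _ _ _ _ _ M) => //.
- by apply: measurable_funTS; exact: wd_measurable w1.
- exact: wd_int w2.
Qed.

Lemma wd_mul f1 g1 f2 g2 : is_wderiv f1 g1 -> is_wderiv f2 g2 ->
  is_wderiv (fun x => f1 x * f2 x) (fun x => f2 x * g1 x + f1 x * g2 x).
Proof.
move=> w1 w2; have [m1 _ _] := w1; have [m2 _ _] := w2.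
have mf1 := wd_measurable w1; have mf2 := wd_measurable w2.
split.
- by apply: measurable_funD; exact: measurable_funM.
- move=> p q.
  have [M1 M10 h1] := wd_bounded p q w1; have [M2 M20 h2] := wd_bounded p q w2.
  have [_ s1 _] := w1; have [_ s2 _] := w2.
  have r1 := rint_sqr m1 (s1 p q); have r2 := rint_sqr m2 (s2 p q).
  have : rint leb `[p, q] (fun x => (f2 x * g1 x + f1 x * g2 x) ^+ 2).
    have := @le_rint _ _ _ leb `[p, q]%classic
      (fun x => (f2 x * g1 x + f1 x * g2 x) ^+ 2)
      (fun x => 2 * M2 ^+ 2 * g1 x ^+ 2 + 2 * M1 ^+ 2 * g2 x ^+ 2).
    apply => //.
    + by apply/measurable_funTS/measurable_funX/measurable_funD; exact: measurable_funM.
    + move=> x xpq; rewrite [leLHS]ger0_norm ?sqr_ge0// [leRHS]ger0_norm; last first.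
        by apply: addr_ge0; apply: mulr_ge0; rewrite ?sqr_ge0// mulr_ge0 ?sqr_ge0.
      have := h1 _ xpq; have := h2 _ xpq.
      rewrite -!(ler_sqr (_ : `|_| \is Num.nneg)) ?nnegrE// !real_normK ?num_real//.
      move=> e2 e1.
      have : (f2 x * g1 x) ^+ 2 <= M2 ^+ 2 * g1 x ^+ 2.
        by rewrite exprMn ler_wpM2r// sqr_ge0.
      have : (f1 x * g2 x) ^+ 2 <= M1 ^+ 2 * g2 x ^+ 2.
        by rewrite exprMn ler_wpM2r// sqr_ge0.
      move: (f2 x * g1 x) (f1 x * g2 x) => A B; have := sqr_ge0 (A - B); nra.
    + have mI : measurable (`[p, q]%classic : set (measurableTypeR R)) by [].
      have z1 := rintZ (2 * M2 ^+ 2) mI r1.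
      have z2 := rintZ (2 * M1 ^+ 2) mI r2.
      exact: (rintD mI z1 z2).
  move=> /integrableP[_]; under eq_integral do rewrite /= ger0_norm ?sqr_ge0//.
  by [].
- move=> p q pq.
  have b12 := wd_bounded_mul p q w1 w2.
  have b21 := wd_bounded_mul p q w2 w1.
  have i1 := wd_int p q w1; have i2 := wd_int p q w2.
  rewrite RintegralD//.
  have := wd_by_parts w1 w2 pq.
  have -> : \int[leb]_(x in `[p, q]) (g2 x * (f1 x - f1 p)) =
     \int[leb]_(x in `[p, q]) (f1 x * g2 x) - f1 p * (f2 q - f2 p).
    have [_ _ ->//] := w2.
    rewrite -RintegralZl// -RintegralB//; last exact: rintZ.
    by apply: eq_Rintegral => x _; ring.
  have -> : \int[leb]_(x in `[p, q]) (g1 x * (f2 q - f2 x)) =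
     f2 q * (f1 q - f1 p) - \int[leb]_(x in `[p, q]) (f2 x * g1 x).
    have [_ _ ->//] := w1.
    rewrite -RintegralZl// -RintegralB//; last exact: rintZ.
    by apply: eq_Rintegral => x _; ring.
  by move=> e; lra.
Qed.

End ProductRule.

(** * Hyperbolic hats as test functions *)

Section Hat.
Context {R : realType}.
Local Notation leb := (@lebesgue_measure R).
Implicit Types (f g h : R -> R) (k p q r x y : R).

(** Here and in [dcosh], twice the hyperbolic function of [k * x]. The 2 is left in to avoid
    denominators and reappears in [dsinhD] and [hat_identity]. *)
Definition dsinh k x := expR (k * x) - expR (- (k * x)).
Definition dcosh k x := expR (k * x) + expR (- (k * x)).

Lemma dsinh0 k : dsinh k 0 = 0.
Proof. by rewrite /dsinh mulr0 oppr0 subrr. Qed.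

Lemma dcosh0 k : dcosh k 0 = 2.
Proof. by rewrite /dcosh mulr0 oppr0 expR0. Qed.

Lemma dsinhD k x y : dsinh k (x + y) * 2 = dsinh k x * dcosh k y + dcosh k x * dsinh k y.
Proof. by rewrite /dsinh /dcosh (mulrDr k x y) opprD !expRD; ring. Qed.

Lemma is_derive_dsinh k c x :
  is_derive x (1 : R) (fun y => dsinh k (y - c)) (k * dcosh k (x - c)).
Proof.
by rewrite /dsinh /dcosh; apply: is_derive_eq; rewrite /GRing.scale/=; ring.
Qed.

Lemma is_derive_dcosh k c x :
  is_derive x (1 : R) (fun y => dcosh k (y - c)) (k * dsinh k (x - c)).
Proof.
by rewrite /dsinh /dcosh; apply: is_derive_eq; rewrite /GRing.scale/=; ring.
Qed.

Lemma is_derive_continuous f g : (forall x, is_derive x (1 : R) f (g x)) -> continuous f.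
Proof.
move=> h x; have := h x => hx; apply: differentiable_continuous.
by apply/derivable1_diffP; exact: ex_derive.
Qed.

Lemma continuous_cM (c : R) f : continuous f -> continuous (fun x => c * f x).
Proof.
move=> cf x; apply: (@continuousM _ _ (fun=> c) f) => //; first exact: cst_continuous.
exact: cf.
Qed.

Lemma wd_dsinh k c d : is_wderiv (fun x => d * dsinh k (x - c)) (fun x => d * (k * dcosh k (x - c))).
Proof.
apply: wd_C1 => x.
  have h := is_derive_dsinh k c x; apply: is_derive_eq; rewrite /GRing.scale/=; ring.
apply: continuous_cM; apply: continuous_cM.
exact: (is_derive_continuous (is_derive_dcosh k c)).
Qed.

Lemma wd_dcosh k c d : is_wderiv (fun x => d * dcosh k (x - c)) (fun x => d * (k * dsinh k (x - c))).
Proof.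
apply: wd_C1 => x.
  have h := is_derive_dcosh k c x; apply: is_derive_eq; rewrite /GRing.scale/=; ring.
apply: continuous_cM; apply: continuous_cM.
exact: (is_derive_continuous (is_derive_dsinh k c)).
Qed.

Lemma wd_cst c : is_wderiv (fun=> c : R) (fun=> 0 : R).
Proof. by apply: wd_C1 => x; exact: cst_continuous. Qed.

(** The continuous solution of h'' = k^2 h off the three nodes that vanishes outside [p, q], scaled
    so that no division occurs. The value k = 1/2 matches the 1/4 of the spectral problem, and k = 1
    matches u - u''. *)
Definition hat k p r q x : R :=
  if x < p then 0 else if x < r then dsinh k (q - r) * dsinh k (x - p)
  else if x < q then - dsinh k (r - p) * dsinh k (x - q) else 0.

Definition hat' k p r q x : R :=
  if x < p then 0 else if x < r then dsinh k (q - r) * (k * dcosh k (x - p))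
  else if x < q then - dsinh k (r - p) * (k * dcosh k (x - q)) else 0.

Lemma dsinhN k x : dsinh k (- x) = - dsinh k x.
Proof. by rewrite /dsinh mulrN opprK opprB. Qed.

Lemma dcoshN k x : dcosh k (- x) = dcosh k x.
Proof. by rewrite /dcosh mulrN opprK addrC. Qed.

Lemma wd_hat k p r q : p < r -> r < q -> is_wderiv (hat k p r q) (hat' k p r q).
Proof.
move=> pr rq.
apply: wd_glue; [exact: wd_cst| |].
  apply: wd_glue; [exact: wd_dsinh| |].
    apply: wd_glue; [exact: wd_dsinh|exact: wd_cst|].
    by rewrite subrr dsinh0 mulr0.
  rewrite rq.
  by rewrite -(opprB q r) dsinhN; ring.
by rewrite pr subrr dsinh0 mulr0.
Qed.

Lemma hat_outside k p r q x : x <= p \/ q <= x -> p < r -> r < q -> hat k p r q x = 0.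
Proof.
move=> h pr rq; rewrite /hat; case: ltP => // px; case: h => [xp|qx].
  have -> : x = p by apply/eqP; rewrite eq_le xp px.
  by rewrite pr subrr dsinh0 mulr0.
by rewrite !ltNge (le_trans (ltW rq) qx) qx.
Qed.

Lemma hat'_outside k p r q x : x < p \/ q <= x -> p < r -> r < q -> hat' k p r q x = 0.
Proof.
move=> h pr rq; rewrite /hat'; case: ltP => // px; case: h => [xp|qx].
  by move: xp; rewrite ltNge px.
by rewrite !ltNge (le_trans (ltW rq) qx) qx.
Qed.

Lemma hat_peak k p r q : p < r -> r < q ->
  hat k p r q r = dsinh k (r - p) * dsinh k (q - r).
Proof.
move=> pr rq; rewrite /hat ltNge (ltW pr)/= ltxx rq.
by rewrite -(opprB q r) dsinhN; ring.
Qed.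

Lemma wd_integral_mul f g h (j : R -> R) p q :
  is_wderiv f g -> is_wderiv h j -> p <= q ->
  \int[leb]_(x in `[p, q]) (h x * g x + f x * j x) = f q * h q - f p * h p.
Proof. by move=> w1 w2 pq; have [_ _ ->] := wd_mul w1 w2. Qed.

Lemma Rintegral_support (F G : R -> R) p q :
  (forall x, x \notin `[p, q] -> F x = 0) ->
  \int[leb]_x F x = \int[leb]_(x in `[p, q]) F x.
Proof.
move=> F0; rewrite [RHS]Rintegral_mkcond; apply: eq_Rintegral => x _.
rewrite patchE mem_setE; case: ifPn => [|/F0 ->]//.
Qed.

Lemma rint_mul_bounded p q (f h : R -> R) M : rint leb `[p, q] f ->
  measurable_fun [set: R] h -> (forall x, x \in `[p, q] -> `|h x| <= M) ->
  rint leb `[p, q] (fun x => f x * h x).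
Proof.
move=> fi mh hM.
have mI : measurable (`[p, q]%classic : set (measurableTypeR R)) by [].
have := rintM_bounded mI (measurable_funTS mh) hM fi.
rewrite (_ : (fun x => h x * f x) = (fun x => f x * h x))//.
by apply/funext => x; rewrite mulrC.
Qed.

Lemma Rintegral_itvco p q (F G : R -> R) :
  measurable_fun [set: R] F -> measurable_fun [set: R] G ->
  (forall x, p <= x -> x < q -> F x = G x) ->
  \int[leb]_(x in `[p, q]) F x = \int[leb]_(x in `[p, q]) G x.
Proof.
move=> mF mG FG.
have mI (g : R -> R) : measurable_fun [set: R] g ->
    \int[leb]_(x in `[p, q]) g x = \int[leb]_(x in `[p, q[) g x.
  move=> m; rewrite /Rintegral integral_itv_bndo_bndc//.
  by apply/measurable_EFinP; exact: measurable_funTS.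
rewrite !mI//; apply: eq_Rintegral => x /set_mem/=; rewrite in_itv/=.
by move=> /andP[]; exact: FG.
Qed.

(** On either side of [r] one has h'' = k^2 h, so the integrand g h' + k^2 f h is the derivative of
    f h' and only boundary values remain. The jump of h' at [r] multiplies f(r), and the addition
    theorem turns it into the hyperbolic sine of the whole length q - p. *)
Lemma hat_identity k f g p r q : is_wderiv f g -> p < r -> r < q ->
  \int[leb]_x (g x * hat' k p r q x) + k ^+ 2 * \int[leb]_x (f x * hat k p r q x) =
  2 * k * (f r * dsinh k (q - p) - f p * dsinh k (q - r) - f q * dsinh k (r - p)).
Proof.
move=> w pr rq.
have pq : p <= q by lra.
have wh := wd_hat k pr rq.
have out x : x \notin `[p, q] -> x < p \/ q <= x.
  by rewrite in_itv/= negb_and -!ltNge => /orP[|/ltW] h; [left|right].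
rewrite (@Rintegral_support _ (fun=> 0) p q); last first.
  by move=> x /out h; rewrite hat'_outside// mulr0.
rewrite (@Rintegral_support (fun x => f x * hat k p r q x) (fun=> 0) p q); last first.
  by move=> x /out h; rewrite hat_outside ?mulr0//; case: h => ?; [left; exact: ltW|right].
have mI (s t : R) : measurable (`[s, t]%classic : set (measurableTypeR R)) by [].
have hb : rint leb `[p, q] (fun x => g x * hat' k p r q x).
  pose M := `|dsinh k (q - r)| * (`|k| * (expR (`|k| * (q - p)) *+ 2))
    + `|dsinh k (r - p)| * (`|k| * (expR (`|k| * (q - p)) *+ 2)).
  have dc x : - (q - p) <= x <= q - p -> `|dcosh k x| <= expR (`|k| * (q - p)) *+ 2.
    move=> /andP[h1 h2]; rewrite /dcosh ger0_norm ?addr_ge0 ?expR_ge0// mulr2n.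
    have hk : `|k * x| <= `|k| * (q - p) by rewrite normrM ler_wpM2l// ler_norml h1.
    apply: lerD; rewrite ler_expR (le_trans _ hk)// ?ler_norm// -normrN ler_norm//.
  apply: (@rint_mul_bounded _ _ _ _ M); first exact: wd_int w.
    by have [] := wh.
  move=> x; rewrite in_itv/= => /andP[px xq].
  have M0 : 0 <= `|k| * (expR (`|k| * (q - p)) *+ 2) by rewrite mulr_ge0// mulrn_wge0// expR_ge0.
  have MM : 0 <= M by rewrite addr_ge0// mulr_ge0.
  rewrite /hat'; case: ifP => _; first by rewrite normr0.
  case: ifP => _; [|case: ifP => _]; last by rewrite normr0.
  - rewrite !normrM /M ler_wpDr ?mulr_ge0// !ler_wpM2l// dc//; lra.
  - rewrite !normrM normrN /M ler_wpDl ?mulr_ge0// !ler_wpM2l// dc//; lra.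
have hb2 : rint leb `[p, q] (fun x => f x * hat k p r q x).
  apply: integrable_continuous_itv => x _; apply: continuousM.
    exact: (wd_continuous w).
  exact: (wd_continuous wh).
have hb3 : rint leb `[p, q] (fun x => k ^+ 2 * (f x * hat k p r q x)).
  exact: rintZ.
rewrite -RintegralZl// -RintegralD//.
rewrite (@rint_itvD _ p r q); [|exact: ltW|exact: ltW|exact: rintD].
have [mg _ _] := w; have [mh' _ _] := wh.
have mf := wd_measurable w; have mh := wd_measurable wh.
have mL : measurable_fun [set: R]
    (fun x => g x * hat' k p r q x + k ^+ 2 * (f x * hat k p r q x)).
  by apply: measurable_funD; apply: measurable_funM => //; exact: measurable_funM.
have mR c d : measurable_fun [set: R] (fun x => d * dcosh k (x - c) * g x
    + f x * (d * (k * dsinh k (x - c)))).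
  have wc := wd_dcosh k c d; have [mc _ _] := wc; have mc' := wd_measurable wc.
  by apply: measurable_funD; exact: measurable_funM.
have e1 : \int[leb]_(x in `[p, r]) (g x * hat' k p r q x + k ^+ 2 * (f x * hat k p r q x))
  = f r * (dsinh k (q - r) * k * dcosh k (r - p)) - f p * (dsinh k (q - r) * k * dcosh k (p - p)).
  rewrite -(wd_integral_mul w (wd_dcosh k p (dsinh k (q - r) * k)) (ltW pr)).
  apply: Rintegral_itvco => // x px xr.
  by rewrite /hat /hat' ltNge px/= xr; ring.
have e2 : \int[leb]_(x in `[r, q]) (g x * hat' k p r q x + k ^+ 2 * (f x * hat k p r q x))
  = f q * (- dsinh k (r - p) * k * dcosh k (q - q)) - f r * (- dsinh k (r - p) * k * dcosh k (r - q)).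
  rewrite -(wd_integral_mul w (wd_dcosh k q (- dsinh k (r - p) * k)) (ltW rq)).
  apply: Rintegral_itvco => // x rx xq.
  by rewrite /hat /hat' !ltNge rx (le_trans (ltW pr) rx)/= -ltNge xq; ring.
rewrite e1 e2 !subrr !dcosh0 -(opprB q r) dcoshN.
have := dsinhD k (r - p) (q - r); rewrite (_ : r - p + (q - r) = q - p); last by ring.
move: (dsinh k (q - p)) => D e.
have -> : D = (dsinh k (r - p) * dcosh k (q - r) + dcosh k (r - p) * dsinh k (q - r)) / 2.
  by rewrite -e; field.
by field.
Qed.

End Hat.

(** * Solutions of the spectral problem at and between the peaks *)

Section ThreePoint.
Context {R : realType}.
Local Notation leb := (@lebesgue_measure R).
Local Open Scope complex_scope.
Implicit Types (u : R -> R) (mu : borel_measure R) (f : R -> R[i]).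
Implicit Types (k p q r : R) (z : R[i]).

Lemma ReM (a b : R[i]) :
  complex.Re (a * b) = complex.Re a * complex.Re b - complex.Im a * complex.Im b.
Proof. by case: a => ? ?; case: b. Qed.

Lemma ImM (a b : R[i]) :
  complex.Im (a * b) = complex.Re a * complex.Im b + complex.Im a * complex.Re b.
Proof. by case: a => ? ?; case: b. Qed.

Lemma ReD (a b : R[i]) : complex.Re (a + b) = complex.Re a + complex.Re b.
Proof. by case: a => ? ?; case: b. Qed.

Lemma ImD (a b : R[i]) : complex.Im (a + b) = complex.Im a + complex.Im b.
Proof. by case: a => ? ?; case: b. Qed.

Lemma ReN (a : R[i]) : complex.Re (- a) = - complex.Re a.
Proof. by case: a. Qed.

Lemma ImN (a : R[i]) : complex.Im (- a) = - complex.Im a.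
Proof. by case: a. Qed.

Lemma complex_eqP (a b : R[i]) : complex.Re a = complex.Re b ->
  complex.Im a = complex.Im b -> a = b.
Proof. by case: a => ? ?; case: b => ? ? /= -> ->. Qed.

Lemma ae_Rintegral (F G : R -> R) : measurable_fun [set: R] F ->
  measurable_fun [set: R] G -> {ae leb, forall x, F x = G x} ->
  \int[leb]_x F x = \int[leb]_x G x.
Proof.
move=> mF mG FG; rewrite /Rintegral; congr fine.
apply: ae_eq_integral => //; [exact/measurable_EFinP..|].
by apply: ae_impl FG => x e _; rewrite /= e.
Qed.

Lemma cintegral_null (nu : borel_measure R) f :
  (forall B : set (measurableTypeR R), measurable B -> nu B = 0%E) ->
  cintegral nu setT f = 0.
Proof.
move=> nu0; have i0 (F : R -> R) : \int[nu]_x F x = 0.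
  rewrite /Rintegral (@eq_measure_integral _ _ _ _ mzero); last first.
    by move=> A mA _; exact: nu0.
  by rewrite integral_measure_zero.
by rewrite /cintegral !i0.
Qed.

Local Notation hatC k p r q := (fun x => (hat k p r q x)%:C).

Lemma cH1c_hat k p r q : p < r -> r < q -> cH1c (hatC k p r q).
Proof.
move=> pr rq; split.
  by split; [exists (hat' k p r q); exact: wd_hat|exists (fun=> 0); exact: wd_cst].
exists (`|p| + `|q|) => x hx; rewrite hat_outside//.
have [xp|px] := leP x p; [by left|right].
have x0 : - `|p| < x by have := ler_norm (- p); rewrite normrN; lra.
have := ler_norm q; have := normr_ge0 p; have := normr_ge0 q.
by move: hx; have [?|?] := ger0P x; lra.
Qed.

Lemma H1loc_wd (F : R -> R) : H1loc F -> is_wderiv F (wderiv F).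
Proof. by move=> [g w]; exact: wd_wderiv w. Qed.

Lemma cH1loc_mul_real f (h : R -> R) : cH1loc f -> H1loc h ->
  cH1loc (fun x => f x * (h x)%:C).
Proof.
move=> [/H1loc_wd fr /H1loc_wd fi] /H1loc_wd w; split.
  rewrite (_ : (fun x => _) = (fun x => complex.Re (f x) * h x)).
    by eexists; exact: wd_mul fr w.
  by apply/funext => x; rewrite ReM/= mulr0 subr0.
rewrite (_ : (fun x => _) = (fun x => complex.Im (f x) * h x)).
  by eexists; exact: wd_mul fi w.
by apply/funext => x; rewrite ImM/= mulr0 add0r.
Qed.

(** This is [hat_identity] for real and imaginary parts. The representative chosen by [wderiv]
    agrees with [hat'] only almost everywhere, hence the comparison of integrals through
    [ae_Rintegral]. *)
Lemma cintegral_hat k p r q f : cH1loc f -> p < r -> r < q ->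
  cintegral leb setT (fun x => cwderiv f x * cwderiv (hatC k p r q) x)
  + (k ^+ 2)%:C * cintegral leb setT (fun x => f x * (hat k p r q x)%:C)
  = (2 * k)%:C * (f r * (dsinh k (q - p))%:C - f p * (dsinh k (q - r))%:C
                  - f q * (dsinh k (r - p))%:C).
Proof.
move=> [/H1loc_wd fr /H1loc_wd fi] pr rq.
have wh := wd_hat k pr rq.
have e0 := wderivE (wd_cst (0 : R)).
have eh := wderivE wh.
have whw := wd_wderiv wh.
have w0w := wd_wderiv (wd_cst (0 : R)).
have [mh _ _] := whw; have [m0 _ _] := w0w; have [mh' _ _] := wh.
have [mr _ _] := fr; have [mi _ _] := fi.
have hr := hat_identity k fr pr rq.
have hi := hat_identity k fi pr rq.
have eR : \int[leb]_x complex.Re (cwderiv f x * cwderiv (hatC k p r q) x) =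
    \int[leb]_x (wderiv (fun y => complex.Re (f y)) x * hat' k p r q x).
  under eq_Rintegral do rewrite ReM/=.
  apply: ae_Rintegral.
  - by apply: measurable_funB; exact: measurable_funM.
  - exact: measurable_funM.
  - apply: (ae_impl2 _ e0 eh) => x /= h1 h2.
    rewrite (_ : wderiv (fun y => 0) x = 0)// h2 mulr0 subr0.
    by [].
have eI : \int[leb]_x complex.Im (cwderiv f x * cwderiv (hatC k p r q) x) =
    \int[leb]_x (wderiv (fun y => complex.Im (f y)) x * hat' k p r q x).
  under eq_Rintegral do rewrite ImM/=.
  apply: ae_Rintegral.
  - by apply: measurable_funD; exact: measurable_funM.
  - exact: measurable_funM.
  - apply: (ae_impl2 _ e0 eh) => x /= h1 h2.
    rewrite (_ : wderiv (fun y => 0) x = 0)// h2 mulr0 add0r.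
    by [].
have eR2 : \int[leb]_x complex.Re (f x * (hat k p r q x)%:C) =
    \int[leb]_x (complex.Re (f x) * hat k p r q x).
  by apply: eq_Rintegral => x _; rewrite ReM/= mulr0 subr0.
have eI2 : \int[leb]_x complex.Im (f x * (hat k p r q x)%:C) =
    \int[leb]_x (complex.Im (f x) * hat k p r q x).
  by apply: eq_Rintegral => x _; rewrite ImM/= mulr0 add0r.
rewrite /cintegral eR eI eR2 eI2.
apply: complex_eqP.
  by rewrite !(ReM, ImM, ReD, ImD, ReN, ImN)/= !(mulr0, mul0r, subr0, addr0, add0r) hr.
by rewrite !(ReM, ImM, ReD, ImD, ReN, ImN)/= !(mulr0, mul0r, subr0, addr0, add0r) hi.
Qed.

End ThreePoint.

(** * Behaviour to the left of all peaks *)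

Section LeftOfPeaks.
Context {R : realType}.
Local Notation leb := (@lebesgue_measure R).
Implicit Types (F G : R -> R) (k p q r X A B : R).

(** With X - 1 and X as fixed nodes, the relation expresses every F(x) through F(X - 1) and F(X); no
    differential equation has to be solved. *)
Lemma three_point_left k F X : 0 < k ->
  (forall p r q, p < r -> r < q -> q <= X ->
     F r * dsinh k (q - p) = F p * dsinh k (q - r) + F q * dsinh k (r - p)) ->
  exists A B, forall x, x <= X -> F x = A * expR (k * x) + B * expR (- (k * x)).
Proof.
move=> k0 F3.
have S1 : 0 < dsinh k 1.
  by rewrite /dsinh mulr1 subr_gt0 ltr_expR; lra.
have FE x : x <= X ->
    F x * dsinh k 1 = F (X - 1) * dsinh k (X - x) + F X * dsinh k (x - (X - 1)).
  move=> xX; have [xX1|X1x|->] := ltgtP x (X - 1).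
  - have := F3 x (X - 1) X xX1; rewrite lexx ltrBlDr ltrDl ltr01 => /(_ isT isT).
    rewrite (_ : X - (X - 1) = 1); last by ring.
    by rewrite -[x - (X - 1)]opprB dsinhN => ->; ring.
  - have [xltX|Xx|e] := ltgtP x X; [|by lra|].
      have := F3 (X - 1) x X X1x xltX (lexx X).
      by rewrite (_ : X - (X - 1) = 1)//; ring.
    by rewrite e subrr dsinh0 mulr0 add0r (_ : X - (X - 1) = 1)//; ring.
  - by rewrite subrr dsinh0 mulr0 addr0 (_ : X - (X - 1) = 1)//; ring.
move: FE; rewrite (_ : dsinh k 1 = dsinh k (X - (X - 1))) in S1 *; last first.
  by congr dsinh; ring.
move: (X - 1) S1 => Y S1 FE.
exists ((F X * expR (- (k * Y)) - F Y * expR (- (k * X))) / dsinh k (X - Y)).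
exists ((F Y * expR (k * X) - F X * expR (k * Y)) / dsinh k (X - Y)).
move=> x /FE e; apply: (mulIf (lt0r_neq0 S1)); rewrite {}e.
rewrite mulrDl !(mulrAC _ _ (expR _)) !mulfVK ?lt0r_neq0//.
by rewrite /dsinh !mulrBr !opprB !expRD; ring.
Qed.

Lemma wderiv_left k F X A B : H1loc F ->
  (forall x, x <= X -> F x = A * expR (k * x) + B * expR (- (k * x))) ->
  {ae leb, forall x, x < X ->
     wderiv F x = k * (A * expR (k * x) - B * expR (- (k * x)))}.
Proof.
move=> /H1loc_wd w FE.
pose E x := A * expR (k * x) + B * expR (- (k * x)).
pose E' x := k * (A * expR (k * x) - B * expR (- (k * x))).
pose E'' x := k * (k * (A * expR (k * x) + B * expR (- (k * x)))).
have dE x : is_derive x (1 : R) E (E' x).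
  by rewrite /E /E'; apply: is_derive_eq; rewrite /GRing.scale/=; ring.
have dE' x : is_derive x (1 : R) E' (E'' x).
  by rewrite /E' /E''; apply: is_derive_eq; rewrite /GRing.scale/=; ring.
have wE : is_wderiv E E' by apply: wd_C1 => //; exact: (is_derive_continuous dE').
have := wd_glue wE w (esym (FE X (lexx X))).
rewrite (_ : (fun x => _) = F); last first.
  by apply/funext => x; case: ltP => // xX; rewrite /E FE// ltW.
move=> /(wd_unique w); apply: ae_impl => x + xX.
by rewrite xX.
Qed.

Lemma expR_cvgNy : expR x @[x --> -oo] --> (0 : R).
Proof.
by apply/cvgNy_compNP; exact: cvgr_expR.
Qed.

(** After multiplication by exp x, which tends to 0, the expression tends both to 0 and to B. *)
Lemma left_limit A B l : (A + B * expR (- x)) @[x --> -oo] --> l -> B = 0 /\ A = l.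
Proof.
move=> h.
have h1 : (expR x * (A + B * expR (- x))) @[x --> -oo] --> 0 * l.
  by apply: cvgM => //; exact: expR_cvgNy.
have h2 : (expR x * (A + B * expR (- x))) @[x --> -oo] --> 0 * A + B.
  rewrite (_ : (fun x => _) = (fun x => expR x * A + B)); last first.
    by apply/funext => x; rewrite mulrDr mulrCA -expRD subrr expR0 mulr1.
  apply: cvgD; last exact: cvg_cst.
  by apply: cvgM; [exact: expR_cvgNy|exact: cvg_cst].
have B0 : B = 0.
  by have := cvg_unique _ h1 h2; rewrite !mul0r add0r => /(_ (@Rhausdorff R)) ->.
split=> //; move: h; rewrite B0.
under eq_fun do rewrite mul0r addr0.
by move=> h; have := cvg_unique _ (cvg_cst A) h; apply; exact: Rhausdorff.
Qed.

Lemma ae_exists_lt (P : R -> Prop) M : {ae leb, forall x, P x} -> exists2 x, x < M & P x.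
Proof.
move=> [N [mN N0 PN]]; apply: contrapT => h.
have sub : `]M - 1, M[%classic `<=` N.
  move=> x /=; rewrite in_itv/= => /andP[_ xM]; apply: PN => /= Px.
  by apply: h; exists x.
have : (leb `](M - 1)%R, M[%classic <= leb N)%E by apply: le_measure; rewrite ?inE.
rewrite N0 lebesgue_measure_itv/= lte_fin ltrBlDr ltrDl ltr01 -EFinB lee_fin.
by lra.
Qed.

(** Quasi-derivatives are known only almost everywhere. A set of full measure meets every half-line,
    so limits at minus infinity can still be compared. *)
Lemma ae_eq_cvgNy F G X (a b : R) : {ae leb, forall x, x < X -> F x = G x} ->
  F x @[x --> -oo] --> a -> G x @[x --> -oo] --> b -> a = b.
Proof.
move=> FG Fa Gb; apply/eqP; rewrite -subr_eq0 -normr_le0; apply/ler_addgt0Pl => e e0.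
rewrite addr0.
have e2 : 0 < e / 2 by rewrite divr_gt0.
have /cvgrPdist_lt /(_ _ e2) [M1 [_ h1]] := Fa.
have /cvgrPdist_lt /(_ _ e2) [M2 [_ h2]] := Gb.
have [x xM FGx] := ae_exists_lt (Num.min X (Num.min M1 M2)) FG.
move: xM; rewrite !lt_min => /and3P[xX x1 x2].
have := h1 _ x1; have := h2 _ x2; rewrite /= FGx// => H1 H2.
rewrite (_ : a - b = (a - G x) - (b - G x)); last by ring.
by rewrite (le_trans (ler_normB _ _))//; lra.
Qed.

End LeftOfPeaks.

Section PeakonSolutions.
Context {R : realType}.
Local Notation leb := (@lebesgue_measure R).
Local Open Scope complex_scope.
Variables (u : R -> R) (mu : borel_measure R) (x w : nat -> R).
Hypothesis hp : peakon_data u mu x w.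
Implicit Types (f : R -> R[i]) (p q r t : R) (z c : R[i]).
Local Notation S := (dsinh (2^-1 : R)).

Lemma peak_lt i j : (1 <= i)%N -> (i < j)%N -> x i < x j.
Proof.
have [xS _ _ _ _] := hp; move=> i1; elim: j => // j IH; rewrite ltnS leq_eqVlt.
move=> /predU1P[<-|ij]; first exact: xS.
by rewrite (lt_trans (IH ij))// xS// (leq_trans i1)// ltnW.
Qed.

(** The equation is tested with the hat for k = 1/2: [cintegral_hat] evaluates its left-hand side,
    the term in z^2 vanishes with [upsilon], and [omega] becomes a finite sum over the peaks under
    the hat. *)
Lemma sol_sum z f p r q c : is_solution u mu z f -> p < r -> r < q ->
  (\forall N \near \oo, \sum_(1 <= n < N) (w n)%:C * (f (x n) * (hat 2^-1 p r q (x n))%:C) = c) ->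
  f r * (S (q - p))%:C - f p * (S (q - r))%:C - f q * (S (r - p))%:C = z * c.
Proof.
have [_ _ _ hom hu] := hp => -[fH fE] pr rq hc.
have := fE _ (cH1c_hat 2^-1 pr rq).
rewrite (cintegral_null _ hu) mulr0 addr0.
have := cintegral_hat 2^-1 fH pr rq.
rewrite divff// mul1r (_ : (_ ^+ 2)%:C = 4^-1) => [->->|]; last first.
  by rewrite exprVn rmorphV ?unitfE ?expf_neq0//= -natrX rmorph_nat.
congr (z * _).
have hf : cH1c (fun y => f y * (hat 2^-1 p r q y)%:C).
  have [h1 [M hM]] := cH1c_hat 2^-1 pr rq.
  split; last by exists M => y /hM ->; rewrite mulr0.
  by apply: cH1loc_mul_real => //; exists (hat' 2^-1 p r q); exact: wd_hat.
by have [N [-> ->]] := filter_ex (filterI (hom _ hf) hc).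
Qed.

Lemma sol_free z f p r q : is_solution u mu z f -> p < r -> r < q ->
  (forall j, (1 <= j)%N -> x j <= p \/ q <= x j) ->
  f r * (S (q - p))%:C = f p * (S (q - r))%:C + f q * (S (r - p))%:C.
Proof.
move=> sf pr rq out; have := sol_sum (c := 0) sf pr rq.
rewrite mulr0 => h; apply/eqP; rewrite -subr_eq0 opprD addrA; apply/eqP; apply: h.
apply: nearW => N; rewrite big_nat_cond big1// => j /andP[/andP[j1 _] _].
by rewrite hat_outside ?mulr0//; exact: out.
Qed.

Lemma sol_peak z f p r q k : is_solution u mu z f -> p < r -> r < q ->
  (1 <= k)%N -> x k = r ->
  (forall j, (1 <= j)%N -> j != k -> x j <= p \/ q <= x j) ->
  f r * (S (q - p))%:C - f p * (S (q - r))%:C - f q * (S (r - p))%:C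
  = z * ((w k)%:C * (f r * (S (r - p) * S (q - r))%:C)).
Proof.
move=> sf pr rq k1 xk out; apply: (sol_sum sf pr rq).
exists k.+1 => // N /= kN; rewrite (bigD1_seq k)/= ?mem_index_iota ?k1 ?iota_uniq//.
rewrite xk hat_peak// big_nat_cond big1 ?addr0// => j /andP[/andP[j1 _] jk].
by rewrite hat_outside ?mulr0//; exact: out.
Qed.

Lemma left_out q : q <= x 1 -> forall p j, (1 <= j)%N -> x j <= p \/ q <= x j.
Proof.
move=> q1 p j; rewrite leq_eqVlt => /predU1P[<-|j1]; right => //.
by rewrite (le_trans q1)// ltW// peak_lt.
Qed.

Lemma sol_left z f : is_solution u mu z f -> exists A B : R[i], forall t, t <= x 1 ->
  f t = A * (expR (2^-1 * t))%:C + B * (expR (- (2^-1 * t)))%:C.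
Proof.
move=> sf.
have h0 : 0 < 2^-1 :> R by rewrite invr_gt0.
have [A1 [B1 h1]] : exists A B, forall t, t <= x 1 ->
    complex.Re (f t) = A * expR (2^-1 * t) + B * expR (- (2^-1 * t)).
  apply: three_point_left h0 _ => p r q pr rq q1.
  have := congr1 (@complex.Re R) (sol_free sf pr rq (@left_out q q1 p)).
  by rewrite !(ReD, ReM)/= !mulr0 !subr0.
have [A2 [B2 h2]] : exists A B, forall t, t <= x 1 ->
    complex.Im (f t) = A * expR (2^-1 * t) + B * expR (- (2^-1 * t)).
  apply: three_point_left h0 _ => p r q pr rq q1.
  have := congr1 (@complex.Im R) (sol_free sf pr rq (@left_out q q1 p)).
  by rewrite !(ImD, ImM)/= !mulr0 !add0r.
exists (A1 +i* A2), (B1 +i* B2) => t t1; apply: complex_eqP.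
  by rewrite !(ReD, ReM)/= !mulr0 !subr0 h1.
by rewrite !(ImD, ImM)/= !mulr0 !add0r h2.
Qed.

(** To the left of the peaks [omega] vanishes, and testing it with hats for k = 1 shows that u is a
    combination of exp t and exp (- t). The second is excluded by the weighted energy condition at
    minus infinity. *)
Lemma u_left : phase_space u mu -> exists C, forall t, t <= x 1 -> u t = C * expR t.
Proof.
move=> [uH _ _ ufin _].
have w1 := H1loc_wd uH.
have [C [D hCD]] : exists A B, forall t, t <= x 1 ->
    u t = A * expR (1 * t) + B * expR (- (1 * t)).
  apply: (three_point_left ltr01) => p r q pr rq q1.
  have [_ _ _ hom _] := hp.
  have hh := cH1c_hat 1 pr rq.
  have [N] := filter_ex (hom _ hh).
  rewrite big_nat_cond big1 => [|j /andP[/andP[j1 _] _]]; last first.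
    by rewrite hat_outside ?mulr0//; exact: left_out.
  move=> /(congr1 (@complex.Re R)); rewrite /omega ReD.
  rewrite [X in X + _](_ : _ = \int[leb]_s (u s * hat 1 p r q s)); last first.
    by apply: eq_Rintegral => s _; rewrite ReM/= mul0r subr0.
  rewrite [X in _ + X](_ : _ = \int[leb]_s (wderiv u s * hat' 1 p r q s)); last first.
    transitivity (\int[leb]_s (wderiv u s * wderiv (hat 1 p r q) s)).
      by apply: eq_Rintegral => s _; rewrite ReM/= mul0r subr0.
    have wh := wd_hat 1 pr rq.
    have [m1 _ _] := w1; have [m2 _ _] := wh; have [m3 _ _] := wd_wderiv wh.
    apply: ae_Rintegral; [exact: measurable_funM..|].
    by apply: ae_impl (wderivE wh) => s ->.
  have := hat_identity 1 w1 pr rq; rewrite expr1n mul1r addrC => -> /=; lra.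
exists C => t t1; rewrite hCD// mul1r.
suff -> : D = 0 by rewrite mul0r addr0.
apply/eqP/negPn/negP => D0.
have D1 : 0 < `|D| by rewrite normr_gt0.
have [m1 _ _] := w1.
have me : measurable_fun [set: R] (fun s => expR (- s) * energy u s).
  apply: measurable_funM; first by apply: continuous_measurable_fun; exact: continuous_expRN.
  apply: measurable_funD; apply: measurable_funX => //; exact: wd_measurable w1.
(* For s < - K one has s < 0, s < x 1 and |C| <= |D| (- s) / 2, so that the term D exp (- s)
   prevails and |u s| >= |D| / 2. The weighted energy density would then stay above a positive
   constant on a half-line. *)
pose K := Num.max 0 (Num.max (- x 1) (2 * `|C| / `|D|)).
have lb s : s < - K -> (`|D| / 2) ^+ 2 <= expR (- s) * energy u s.
  move=> sK; have : K < - s by lra.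
  rewrite !gt_max => /and3P[s0 s1 sCD].
  have us : u s = C * expR s + D * expR (- s) by rewrite hCD ?mul1r//; lra.
  have e1 : 1 - s <= expR (- s) by exact: expR_ge1Dx.
  have e2 : expR s <= 1 by rewrite -[leRHS]expR0 ler_expR; lra.
  have hu : `|D| / 2 <= `|u s|.
    have h1 : `|D| * expR (- s) <= `|u s| + `|C| * expR s.
      rewrite -{1}(ger0_norm (expR_ge0 (- s))) -normrM.
      rewrite -[X in _ <= _ + _ * X]ger0_norm ?expR_ge0// -normrM.
      rewrite (_ : D * expR (- s) = u s - C * expR s) ?ler_normB//.
      by rewrite us; ring.
    have h2 : `|C| * expR s <= `|C| by rewrite ler_piMr.
    have h3 : 2 * `|C| <= `|D| * (- s).
      by move: sCD; rewrite ltr_pdivrMr//; lra.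
    nra.
  have u2 : (`|D| / 2) ^+ 2 <= u s ^+ 2.
    by rewrite -[leRHS]real_normK ?num_real// ler_sqr ?nnegrE// divr_ge0.
  rewrite /energy; have := sqr_ge0 (wderiv u s); have := sqr_ge0 (`|D| / 2).
  by move: (u s ^+ 2) (wderiv u s ^+ 2) ((`|D| / 2) ^+ 2) u2 => U V W; nra.
have : (\int[leb]_(s in `]-oo, (- K)%R[) ((`|D| / 2) ^+ 2)%:E < +oo)%E.
  apply: (@le_lt_trans _ _ (\int[leb]_(s in `]-oo, 0%R[) (expR (- s) * energy u s)%:E)%E).
    apply: (@le_trans _ _ (\int[leb]_(s in `]-oo, (- K)%R[) (expR (- s) * energy u s)%:E)%E).
      apply: ge0_le_integral => //.
      - by apply/measurable_EFinP; apply: measurable_funTS; exact: me.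
    apply: ge0_subset_integral => //.
    - by apply/measurable_EFinP; apply: measurable_funTS; exact: me.
    - by move=> s _; rewrite lee_fin mulr_ge0 ?expR_ge0// addr_ge0 ?sqr_ge0.
    - move=> s /=; rewrite !in_itv/= => sK; rewrite (lt_le_trans sK)//.
      by rewrite oppr_le0 le_max lexx.
  apply: le_lt_trans ufin; rewrite leeDl// integral_ge0//.
rewrite integral_cst//= lebesgue_measure_itv/= ltNyr/=.
rewrite (_ : ((- K)%:E - -oo)%E = +oo%E)// gt0_muley ?ltxx// lte_fin.
by rewrite exprn_gt0// divr_gt0.
Qed.

End PeakonSolutions.

Section ComplexLimits.
Context {R : realType}.
Local Open Scope complex_scope.

Lemma le_Re_normc (z : R[i]) (e : R) : `|z| < e%:C -> `|complex.Re z| < e.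
Proof. by move=> h; rewrite -ltcR (le_lt_trans (normc_ge_Re z)). Qed.

Lemma le_Im_normc (z : R[i]) (e : R) : `|z| < e%:C -> `|complex.Im z| < e.
Proof.
move=> h; have := @le_Re_normc (z * 'i%C) e; rewrite normrM ReiNIm normrN.
rewrite (_ : `|'i%C| = 1) ?mulr1; first exact.
by rewrite normc_def /= expr0n expr1n add0r sqrtr1.
Qed.

Lemma cvg_Re T (F : set_system T) (FF : Filter F) (f : T -> R[i]) (l : R[i]) :
  (f t : R[i]^o) @[t --> F] --> (l : R[i]^o) ->
  complex.Re (f t) @[t --> F] --> complex.Re l.
Proof.
move=> /(@cvgrPdist_lt _ R[i]^o) h; apply/cvgrPdist_lt => e e0.
have e0' : 0 < e%:C by rewrite ltcR.
apply: filterS (h _ e0') => t; rewrite -[_ - _ in X in _ -> X]/(complex.Re l + - complex.Re (f t)).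
by move=> /le_Re_normc; rewrite ReD ReN.
Qed.

Lemma cvg_Im T (F : set_system T) (FF : Filter F) (f : T -> R[i]) (l : R[i]) :
  (f t : R[i]^o) @[t --> F] --> (l : R[i]^o) ->
  complex.Im (f t) @[t --> F] --> complex.Im l.
Proof.
move=> /(@cvgrPdist_lt _ R[i]^o) h; apply/cvgrPdist_lt => e e0.
have e0' : 0 < e%:C by rewrite ltcR.
apply: filterS (h _ e0') => t.
by move=> /le_Im_normc; rewrite ImD ImN.
Qed.

Lemma ReV (a : R[i]) (r : R) : complex.Re (a / r%:C) = complex.Re a / r.
Proof. by rewrite -fmorphV ReM/= mulr0 subr0. Qed.

Lemma ImV (a : R[i]) (r : R) : complex.Im (a / r%:C) = complex.Im a / r.
Proof. by rewrite -fmorphV ImM/= mulr0 add0r. Qed.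

Lemma cvg_near_trans T (F : set_system T) (FF : Filter F) (f g : T -> R) (l l' : R) :
  l = l' -> (\forall t \near F, f t = g t) -> f t @[t --> F] --> l ->
  g t @[t --> F] --> l'.
Proof.
move=> <- fg; apply: cvg_trans; apply: near_eq_cvg.
by apply: filterS fg => t ->.
Qed.

Lemma expR_affine_cvgNy (a b : R) : (a * expR t + b) @[t --> -oo] --> b.
Proof.
rewrite -[X in _ --> X]add0r -[X in _ --> X + _](mulr0 a).
apply: cvgD; last exact: cvg_cst.
by apply: cvgM; [exact: cvg_cst|exact: expR_cvgNy].
Qed.

Lemma Rcvg_unique T (F : set_system T) (PF : ProperFilter F) (f : T -> R) (a b : R) :
  f t @[t --> F] --> a -> f t @[t --> F] --> b -> a = b.
Proof.
by move=> h1 h2; have := cvg_unique _ h1 h2; apply; exact: Rhausdorff.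
Qed.

End ComplexLimits.

Section LeftSolutions.
Context {R : realType}.
Local Notation leb := (@lebesgue_measure R).
Local Open Scope complex_scope.
Variables (u : R -> R) (mu : borel_measure R) (x w : nat -> R).
Hypothesis hp : peakon_data u mu x w.
Implicit Types (f : R -> R[i]) (p q r t : R) (z c : R[i]).

Lemma phi_left z phi : is_phi u mu z phi ->
  forall t, t <= x 1 -> phi t = (expR (2^-1 * t))%:C.
Proof.
move=> [sf [phi1 [_ l _]]].
have [A [B hAB]] := sol_left hp sf.
have near1 : \forall t \near -oo, t <= x 1 by apply: nbhs_ninfty_le; rewrite num_real.
have hR : (complex.Re A + complex.Re B * expR (- t)) @[t --> -oo] --> (1 : R).
  apply: cvg_near_trans _ _ (cvg_Re _ l) => //.
  apply: filterS near1 => t t1; rewrite hAB// ReV !(ReD, ReM)/= !mulr0 !subr0.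
  rewrite (mulrC t) (_ : - t = - (2^-1 * t) - 2^-1 * t); last by field.
  by rewrite mulrDl -mulrA divff ?gt_eqF ?expR_gt0// mulr1 expRD (expRN (2^-1 * t)) mulrA.
have hI : (complex.Im A + complex.Im B * expR (- t)) @[t --> -oo] --> (0 : R).
  apply: cvg_near_trans _ _ (cvg_Im _ l) => //.
  apply: filterS near1 => t t1; rewrite hAB// ImV !(ImD, ImM)/= !mulr0 !add0r.
  rewrite (mulrC t) (_ : - t = - (2^-1 * t) - 2^-1 * t); last by field.
  by rewrite mulrDl -mulrA divff ?gt_eqF ?expR_gt0// mulr1 expRD (expRN (2^-1 * t)) mulrA.
have [B1 A1] := left_limit hR; have [B2 A2] := left_limit hI.
move=> t t1; rewrite hAB//; apply: complex_eqP.
  by rewrite !(ReD, ReM)/= B1 A1; ring.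
by rewrite !(ImD, ImM)/= B2 A2; ring.
Qed.

(** On this half-line u + u' = 2 C exp t. If A denotes the coefficient of exp (t / 2) in theta, the
    quasi-derivative divided by exp (t / 2) is therefore A - 2 C z plus a multiple of exp t. It
    tends to 0, which forces A = 2 C z. *)
Lemma theta_left z theta C : is_theta u mu z theta -> phase_space u mu ->
  (forall t, t <= x 1 -> u t = C * expR t) ->
  forall t, t <= x 1 ->
  theta t = 2 * C%:C * z * (expR (2^-1 * t))%:C + (expR (- (2^-1 * t)))%:C.
Proof.
move=> [sf [theta1 [[_ qd] l l1]]] [uH _ _ _ _] uC.
have [A [B hAB]] := sol_left hp sf.
have near1 : \forall t \near -oo, t <= x 1 by apply: nbhs_ninfty_le; rewrite num_real.
have expE t : expR (2^-1 * t) / expR (- t / 2) = expR t.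
  by rewrite -expRN -expRD; congr expR; field.
have expE2 (s : R) : expR (- (2^-1 * s)) / expR (- s / 2) = 1.
  by rewrite -expRN -expRD (_ : _ + _ = 0) ?expR0//; field.
have B1 : B = 1.
  apply: complex_eqP.
    have : (complex.Re A * expR t + complex.Re B) @[t --> -oo] --> (1 : R).
      apply: cvg_near_trans _ _ (cvg_Re _ l) => //.
      apply: filterS near1 => t t1; rewrite hAB// ReV !(ReD, ReM)/= !mulr0 !subr0.
      by rewrite mulrDl -!mulrA expE expE2 mulr1.
    by move=> h; rewrite (Rcvg_unique _ (@expR_affine_cvgNy _ (complex.Re A) (complex.Re B)) h).
  have : (complex.Im A * expR t + complex.Im B) @[t --> -oo] --> (0 : R).
    apply: cvg_near_trans _ _ (cvg_Im _ l) => //.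
    apply: filterS near1 => t t1; rewrite hAB// ImV !(ImD, ImM)/= !mulr0 !add0r.
    by rewrite mulrDl -!mulrA expE expE2 mulr1.
  by move=> h; rewrite (Rcvg_unique _ (@expR_affine_cvgNy _ (complex.Im A) (complex.Im B)) h).
have [[tr ti] _] := sf.
rewrite B1 in hAB.
have hr t : t <= x 1 -> complex.Re (theta t) =
    complex.Re A * expR (2^-1 * t) + 1 * expR (- (2^-1 * t)).
  by move=> /hAB ->; rewrite !(ReD, ReM)/= !mulr0 !subr0.
have hi t : t <= x 1 -> complex.Im (theta t) =
    complex.Im A * expR (2^-1 * t) + 0 * expR (- (2^-1 * t)).
  by move=> /hAB ->; rewrite !(ImD, ImM)/= !mulr0 !add0r.
have hu t : t <= x 1 -> u t = C * expR (1 * t) + 0 * expR (- (1 * t)).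
  by move=> /uC ->; rewrite mul1r mul0r addr0.
have dri := ae_impl2 (fun _ => @conj _ _) (wderiv_left tr hr) (wderiv_left ti hi).
have duq := ae_impl2 (fun _ => @conj _ _) (wderiv_left uH hu) qd.
pose a := A - 2 * C%:C * z.
pose b := - (2 * C%:C * z * A).
have key : {ae leb, forall t, t < x 1 ->
    theta1 t / (expR (t / 2))%:C = b * (expR t)%:C + a}.
  apply: (ae_impl2 _ dri duq) => t [d1 d2] [d3 d4] t1.
  have tt := ltW t1.
  rewrite d4 uC// (d3 t1) /cwderiv d1// d2// hAB//.
  have E0 : (expR (2^-1 * t))%:C != 0.
    by rewrite -(rmorph0 (real_complex R)) (inj_eq (@complexI R)) gt_eqF ?expR_gt0.
  have E2 : (expR t)%:C = (expR (2^-1 * t))%:C ^+ 2.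
    by rewrite -rmorphXn/= -expRM_natl; congr (expR _)%:C; field.
  rewrite (_ : _ +i* _ = 2^-1 * (A * (expR (2^-1 * t))%:C - (expR (- (2^-1 * t)))%:C)); last first.
    have -> : 2^-1 = (2^-1)%:C :> R[i] by rewrite fmorphV rmorph_nat.
    by apply: complex_eqP; rewrite !(ReM, ImM, ReD, ImD, ReN, ImN)/=; ring.
  rewrite (_ : (C * expR t + 1 * (C * expR (1 * t) - 0 * expR (- (1 * t))))%:C
    = 2 * C%:C * (expR t)%:C); last first.
    have -> : 2 = 2%:C :> R[i] by rewrite rmorph_nat.
    rewrite -!rmorphM/= !mul1r.
    by congr (_%:C); ring.
  rewrite expRN (fmorphV (real_complex R)) [t / 2]mulrC E2 /a /b.
  by field.
have a0 : a = 0.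
  apply: complex_eqP; apply/esym.
    apply: (ae_eq_cvgNy (X := x 1) _ (cvg_Re _ l1) (@expR_affine_cvgNy _ (complex.Re b) _)).
    by apply: ae_impl key => t h /h ->; rewrite ReD ReM/= mulr0 subr0.
  apply: (ae_eq_cvgNy (X := x 1) _ (cvg_Im _ l1) (@expR_affine_cvgNy _ (complex.Im b) _)).
  by apply: ae_impl key => t h /h ->; rewrite ImD ImM/= mulr0 add0r.
move=> t t1; rewrite hAB// mul1r; congr (_ * _ + _).
by apply/eqP; rewrite -subr_eq0; apply/eqP.
Qed.

End LeftSolutions.

(** * The string recursion and the Weyl-Titchmarsh function *)

Section StringRecursion.

(* The state [(g, e)] holds the value of a solution at the mass [m k], in the
   coordinate [y = exp (- x)] and divided by [exp (x / 2)], and its slope on the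
   side from which the mass is reached (that of larger [y]). *)
Fixpoint strg (K : comNzRingType) (y m : nat -> K) (z : K) (s : K * K) (k : nat) :
    K * K :=
  if k is k'.+1 then
    let: s' := strg y m z s k' in
    let e := s'.2 + z * m k' * s'.1 in
    (s'.1 - (y k' - y k'.+1) * e, e)
  else s.

(** Applied to the embedding of the reals into the complex numbers: at z = - X the complex recursion
    takes the real values that enter the estimates. *)
Lemma strg_morph (K K' : comNzRingType) (h : {rmorphism K -> K'}) y m z s k :
  strg (h \o y) (h \o m) (h z) (h s.1, h s.2) k =
  (h (strg y m z s k).1, h (strg y m z s k).2).
Proof.
elim: k => //= k ->; rewrite /=.
by rewrite !(rmorphB, rmorphD, rmorphM).
Qed.

(** Serves to split off from theta the multiple 2 C z of phi that it contains. *)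
Lemma strg_linear (K : comNzRingType) (y m : nat -> K) z (c : K) s s' k :
  strg y m z (s.1 + c * s'.1, s.2 + c * s'.2) k =
  ((strg y m z s k).1 + c * (strg y m z s' k).1,
   (strg y m z s k).2 + c * (strg y m z s' k).2).
Proof. by elim: k => //= k ->; congr (_, _) => /=; ring. Qed.

Lemma strg_wronskian (K : comNzRingType) (y m : nat -> K) z k :
  (strg y m z (y 0%N, 1) k).2 * (strg y m z (1, 0) k).1
  - (strg y m z (y 0%N, 1) k).1 * (strg y m z (1, 0) k).2 = 1.
Proof.
elim: k => [|k IH] /=; first by ring.
by rewrite -[RHS]IH; ring.
Qed.

(** Divided by the two values of the solution started at (1, 0), this is the difference of
    consecutive quotients T / G, so that their limit can be estimated by a telescoping sum. *)
Lemma strg_wronskianS (K : comNzRingType) (y m : nat -> K) z k :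
  (strg y m z (y 0%N, 1) k.+1).1 * (strg y m z (1, 0) k).1
  - (strg y m z (y 0%N, 1) k).1 * (strg y m z (1, 0) k.+1).1 = - (y k - y k.+1).
Proof.
have W := strg_wronskian y m z k.
transitivity (- (y k - y k.+1) * ((strg y m z (y 0%N, 1) k).2 * (strg y m z (1, 0) k).1
  - (strg y m z (y 0%N, 1) k).1 * (strg y m z (1, 0) k).2)); first by rewrite /=; ring.
by rewrite W mulr1.
Qed.

End StringRecursion.

(** * Growth of the denominators in the left half-plane *)

Section StringBounds.
Context {R : realType}.
Local Open Scope complex_scope.
Local Notation normc := (@Normc.normc R).
Variables (y m : nat -> R).
Hypothesis yS : forall k, y k.+1 < y k.
Hypothesis y0 : forall k, 0 < y k.
Hypothesis m0 : forall k, 0 < m k.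

(** The lower bound for |G_k| at Re z = - x that results from keeping, at each step, only the
    contribution of the mass just passed. *)
Definition strg_growth (x : R) (k : nat) : R :=
  \prod_(j < k) (1 + (y j - y j.+1) * m j * x).

Lemma strg_growthS x k :
  strg_growth x k.+1 = strg_growth x k * (1 + (y k - y k.+1) * m k * x).
Proof. by rewrite /strg_growth big_ord_recr. Qed.

Lemma strg_growth_factor x k : 0 < x -> 1 <= 1 + (y k - y k.+1) * m k * x.
Proof. by move=> x0; rewrite lerDl !mulr_ge0 ?(ltW x0) ?(ltW (m0 k))// subr_ge0 ltW. Qed.

Lemma strg_growth_gt0 x k : 0 < x -> 0 < strg_growth x k.
Proof.
move=> x0; apply: prodr_gt0 => j _; exact: lt_le_trans (strg_growth_factor j x0).
Qed.

Lemma strg_growth_le x i j : 0 < x -> (i <= j)%N -> strg_growth x i <= strg_growth x j.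
Proof.
move=> x0; elim: j => [|j IH]; first by rewrite leqn0 => /eqP ->.
rewrite leq_eqVlt => /predU1P[->//|]; rewrite ltnS => /IH h.
rewrite strg_growthS (le_trans h)// ler_peMr ?strg_growth_factor//.
exact/ltW/strg_growth_gt0.
Qed.

Lemma normc_Re (a : R[i]) : complex.Re a <= normc a.
Proof. by rewrite -lecR; apply: le_trans (normc_ge_Re a); rewrite lecR ler_norm. Qed.

Lemma abs_Re_normc (a : R[i]) : `|complex.Re a| <= normc a.
Proof. by rewrite -lecR; exact: normc_ge_Re. Qed.

Lemma normc_ge0 (a : R[i]) : 0 <= normc a.
Proof. exact: le_trans (abs_Re_normc a). Qed.

(** Crossing a massless interval of length [l] transforms the ratio r = - E / G by this Moebius map,
    which preserves the right half-plane. *)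
Lemma Re_mobius_ge0 (l : R) (r : R[i]) : 0 < l -> 0 <= complex.Re r ->
  0 <= complex.Re (r / (1 + l%:C * r)).
Proof.
case: r => a b l0 /= a0.
rewrite !mul0r !subr0 !add0r !addr0.
set c := 1 + l * a; set d := l * b.
rewrite mulrN opprK !mulrA -mulrDl mulr_ge0 ?invr_ge0 ?addr_ge0 ?sqr_ge0//.
  by rewrite mulr_ge0// /c addr_ge0// mulr_ge0// ltW.
by rewrite /d ?mulrA (mulrC b) -mulrA mulr_ge0 ?(ltW l0)// -expr2 sqr_ge0.
Qed.

Local Notation G z := (fun k => (strg (fun j => (y j)%:C) (fun j => (m j)%:C) z (1, 0) k).1).
Local Notation E z := (fun k => (strg (fun j => (y j)%:C) (fun j => (m j)%:C) z (1, 0) k).2).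
Local Notation T z := (fun k => (strg (fun j => (y j)%:C) (fun j => (m j)%:C) z ((y 0%N)%:C, 1) k).1).

(** Induction on the ratio - E / G: a mass m adds - z m, of positive real part, and an interval of
    length l applies the map of [Re_mobius_ge0]. The value G is multiplied by 1 + l r, whose real
    part is at least 1 + l m (- Re z). *)
Lemma strg_growth_step (z : R[i]) k : complex.Re z < 0 ->
  [/\ G z k != 0, 0 <= complex.Re (- (E z k / G z k)) &
  normc (G z k) * (1 + (y k - y k.+1) * m k * (- complex.Re z)) <= normc (G z k.+1)].
Proof.
move=> z0.
have step i (g e : R[i]) : g != 0 -> 0 <= complex.Re (- (e / g)) ->
    let r := - ((e + z * (m i)%:C * g) / g) in
    let g' := g - ((y i)%:C - (y i.+1)%:C) * (e + z * (m i)%:C * g) in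
    [/\ 0 <= complex.Re r, g' = g * (1 + (y i - y i.+1)%:C * r) &
     normc g * (1 + (y i - y i.+1) * m i * (- complex.Re z)) <= normc g'].
  move=> g0 a0 r g'.
  have rE : r = - (e / g) - z * (m i)%:C by rewrite /r; field.
  have Rr : m i * - complex.Re z <= complex.Re r.
    by rewrite rE ReD [X in _ + X]ReN ReM/= mulr0 subr0; lra.
  have g'E : g' = g * (1 + (y i - y i.+1)%:C * r).
    by rewrite /g' /r rmorphB/=; field.
  have l0 : 0 < y i - y i.+1 by rewrite subr_gt0.
  have mz : 0 < m i * - complex.Re z by rewrite mulr_gt0// oppr_gt0.
  split=> //; first exact: le_trans (ltW mz) Rr.
  rewrite g'E Normc.normcM ler_wpM2l ?normc_ge0//.
  apply: le_trans (normc_Re _).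
  by rewrite ReD ReM/= mul0r subr0 lerD2l -mulrA ler_wpM2l// ltW.
have H : G z k != 0 /\ 0 <= complex.Re (- (E z k / G z k)).
  elim: k => [|k [g0 a0]]; first (split; first exact: oner_neq0).
    by change (0 <= complex.Re (- (0 / 1 : R[i]))); rewrite mul0r oppr0.
  have [r0 gE nS] := step k _ _ g0 a0.
  have S0 : G z k.+1 != 0.
    have {}nS : normc (G z k) * (1 + (y k - y k.+1) * m k * - complex.Re z)
        <= normc (G z k.+1) := nS.
    apply: contraTneq nS => ->; rewrite -ltNge Normc.normc0 mulr_gt0//.
      by rewrite lt_neqAle normc_ge0 andbT eq_sym; apply: contra g0 => /eqP/Normc.eq0_normc ->.
    by apply: lt_le_trans (strg_growth_factor k _); rewrite ?oppr_gt0.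
  split=> //.
  have := Re_mobius_ge0 (l := y k - y k.+1) _ r0; rewrite subr_gt0 => /(_ (yS k)).
  congr (0 <= complex.Re _).
  rewrite [G z k.+1]gE [E z k.+1]/=.
  by rewrite invfM mulrA mulNr.
have [g0 a0] := H.
by have [_ _ h] := step k _ _ g0 a0.
Qed.

Lemma strg_growth_norm (z : R[i]) k : complex.Re z < 0 ->
  strg_growth (- complex.Re z) k <= normc (G z k).
Proof.
move=> z0; elim: k => [|k IH].
  by rewrite /strg_growth big_ord0 Normc.normc1.
have [_ _ h] := strg_growth_step k z0.
rewrite strg_growthS (le_trans _ h)// ler_wpM2r//.
by apply: le_trans (strg_growth_factor k _); rewrite ?oppr_gt0.
Qed.

(** Telescoping with [strg_wronskianS]: the growth bounds increase with the index, so every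
    denominator G_k G_(k+1) is at least as large as the bounds at n and n + 1, and the numerators
    add up to y_n - y_N. *)
Lemma strg_ratio (z : R[i]) n N : complex.Re z < 0 -> (n <= N)%N ->
  normc (T z N / G z N - T z n / G z n) <=
  (y n - y N) / (strg_growth (- complex.Re z) n * strg_growth (- complex.Re z) n.+1).
Proof.
move=> z0; have x0 : 0 < - complex.Re z by rewrite oppr_gt0.
elim: N => [|N IH]; first by rewrite leqn0 => /eqP ->; rewrite !subrr mul0r Normc.normc0.
rewrite leq_eqVlt => /predU1P[->|]; first by rewrite !subrr mul0r Normc.normc0.
rewrite ltnS => nN.
have [g0 _ _] := strg_growth_step N z0.
have [g1 _ _] := strg_growth_step N.+1 z0.
have -> : T z N.+1 / G z N.+1 - T z n / G z n =
    - ((y N - y N.+1)%:C / (G z N * G z N.+1)) + (T z N / G z N - T z n / G z n).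
  rewrite addrA; congr (_ - _).
  have W := strg_wronskianS (fun j => (y j)%:C) (fun j => (m j)%:C) z N.
  apply: (mulIf g0); apply: (mulIf g1).
  rewrite rmorphB -mulNr -W.
  move: g0 g1; move: (G z N) (G z N.+1) (T z N) (T z N.+1) => a b c d a0 b0.
  by field; rewrite a0 b0.
apply: le_trans (le_normcD _ _) _.
rewrite (_ : y n - y N.+1 = (y N - y N.+1) + (y n - y N)); last by ring.
rewrite mulrDl lerD ?IH// normcN Normc.normcM Normc.normcV Normc.normcM.
have l0 : 0 <= y N - y N.+1 by rewrite subr_ge0 ltW.
have -> : normc (y N - y N.+1)%:C = y N - y N.+1.
  by rewrite /Normc.normc/= expr0n/= addr0 sqrtr_sqr ger0_norm.
rewrite ler_wpM2l// lef_pV2 ?posrE ?mulr_gt0 ?strg_growth_gt0//; last 2 first.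
- by apply: lt_le_trans (strg_growth_norm N z0); exact: strg_growth_gt0.
- by apply: lt_le_trans (strg_growth_norm N.+1 z0); exact: strg_growth_gt0.
apply: ler_pM; rewrite ?(ltW (strg_growth_gt0 _ _))//.
  by apply: le_trans (strg_growth_norm N z0); exact: strg_growth_le.
by apply: le_trans (strg_growth_norm N.+1 z0); exact: strg_growth_le.
Qed.

End StringBounds.

(** * From three-point relations to the string recursion *)

Section PeakonString.
Context {R : realType}.
Local Open Scope complex_scope.
Variables (u : R -> R) (mu : borel_measure R) (x w : nat -> R).
Hypothesis hp : peakon_data u mu x w.

Definition string_pos (k : nat) : R := expR (- x k.+1).
Definition string_mass (k : nat) : R := w k.+1 * expR (x k.+1).
Local Notation y := string_pos.
Local Notation m := string_mass.

Lemma string_posS k : y k.+1 < y k.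
Proof. by rewrite ltr_expR ltrN2; have [xS _ _ _ _] := hp; exact: xS. Qed.

Lemma string_pos_gt0 k : 0 < y k. Proof. exact: expR_gt0. Qed.

Lemma string_mass_gt0 k : 0 < m k.
Proof. by rewrite mulr_gt0 ?expR_gt0//; have [_ _ w0 _ _] := hp; exact: w0. Qed.

(** In the variable y = exp (- x) the hyperbolic sine is a plain difference, up to the exponential
    factors that are divided out of the solutions. *)
Lemma dsinh_half (p q : R) : dsinh 2^-1 (q - p) =
  expR (2^-1 * p) * expR (2^-1 * q) * (expR (- p) - expR (- q)).
Proof.
rewrite /dsinh mulrBr -!expRD -[RHS]/(_) opprB mulrBr -!expRD.
by congr (expR _ - expR _); field.
Qed.

Lemma sol_string_step z f (g e : R[i]) p r q k :
  is_solution u mu z f -> p < r -> r < q -> (1 <= k)%N -> x k = r ->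
  (forall j, (1 <= j)%N -> j != k -> x j <= p \/ q <= x j) ->
  f p = (expR (2^-1 * p))%:C * (g + e * (expR (- p) - expR (- r))%:C) ->
  f r = (expR (2^-1 * r))%:C * g ->
  f q = (expR (2^-1 * q))%:C *
    (g - (expR (- r) - expR (- q))%:C * (e + z * (w k * expR r)%:C * g)).
Proof.
move=> sf pr rq k1 xk out fp fr.
have := sol_peak hp sf pr rq k1 xk out.
rewrite !dsinh_half fp fr.
have Er : expR r = expR (2^-1 * r) * expR (2^-1 * r) by rewrite -expRD; congr expR; field.
rewrite Er.
have a0 : (expR (- p) - expR (- r))%:C != 0.
  by rewrite fmorph_eq0 gt_eqF// subr_gt0 ltr_expR ltrN2.
have P0 (s : R) : (expR (2^-1 * s))%:C != 0.
  by rewrite fmorph_eq0 gt_eqF// expR_gt0.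
move: (P0 p) (P0 q) (P0 r) a0; rewrite !(rmorphM, rmorphB)/=.
move: (expR (2^-1 * p))%:C (expR (2^-1 * q))%:C (expR (2^-1 * r))%:C => P Q T.
move: (expR (- p))%:C (expR (- q))%:C (expR (- r))%:C => yp yq yr.
move: (f q) (w k)%:C => F W p0 q0 t0 a0 h.
apply: (mulIf a0); apply: (mulIf p0); apply: (mulIf t0).
have -> : F * (yp - yr) * P * T = T * g * (P * Q * (yp - yq))
    - P * (g + e * (yp - yr)) * (T * Q * (yr - yq))
    - z * (W * (T * g * (P * T * (yp - yr) * (T * Q * (yr - yq))))).
  by rewrite -h; ring.
by ring.
Qed.

Lemma sol_strg z f (g e : R[i]) : is_solution u mu z f ->
  (forall t, t <= x 1 ->
     f t = (expR (2^-1 * t))%:C * (g + e * (expR (- t) - y 0)%:C)) ->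
  forall k, f (x k.+1) = (expR (2^-1 * x k.+1))%:C *
    (strg (fun j => (y j)%:C) (fun j => (m j)%:C) z (g, e) k).1.
Proof.
move=> sf fl k.
set s := strg _ _ _ _.
(* The slope is read off from a second point [p], with no peak strictly between [p] and the peak in
   question: x 1 - 1 at the start, afterwards the preceding peak. The hat on [p], that peak and the
   next one then sees exactly one mass. *)
suff [p [px _ _ ->//]] : exists p, [/\ p < x k.+1,
    forall j, (1 <= j)%N -> j != k.+1 -> x j <= p \/ x k.+2 <= x j,
    f p = (expR (2^-1 * p))%:C * ((s k).1 + (s k).2 * (expR (- p) - y k)%:C) &
    f (x k.+1) = (expR (2^-1 * x k.+1))%:C * (s k).1].
have far k' j : (k'.+1 < j)%N -> x k'.+2 <= x j.
  rewrite leq_eqVlt => /predU1P[<-//|kj]; apply: ltW.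
  exact: (peak_lt hp).
elim: k => [|k [p [px out fp fx]]].
  exists (x 1 - 1); split.
  - by rewrite ltrBlDr ltrDl.
  - move=> [//|[//|j]] _ _; right; exact: far.
  - by rewrite fl// lerBlDr lerDl.
  - by rewrite fl// /y subrr mulr0 addr0.
have xk : x k.+1 < x k.+2 by exact: (peak_lt hp).
exists (x k.+1); split=> //.
- move=> j j1 jk; have [jk1|jk1|/eqP] := ltngtP j k.+2; last by rewrite (negbTE jk).
    left; move: jk1; rewrite ltnS leq_eqVlt => /predU1P[->//|jk1].
    exact/ltW/(peak_lt hp).
  by right; exact: far.
- by rewrite fx /s /= /y rmorphB/=; congr (_ * _); ring.
- rewrite (sol_string_step sf px xk _ (erefl _) out fp fx)//.
  by rewrite /s /= /y /m rmorphB/= /string_mass.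
Qed.

End PeakonString.

Section CarriedIntegrals.
Context {R : realType} (rho : borel_measure R) (D : set R).
Hypothesis mD : measurable (D : set (measurableTypeR R)).
Hypothesis carried : rho (~` D) = 0%E.
Hypothesis fin : (rho setT < +oo)%E.

Lemma measurable_inv : measurable_fun [set: R] (fun l : R => l^-1).
Proof.
have -> : [set: R] = [set 0] `|` ~` [set 0] by rewrite setUv.
have m0 : measurable ([set 0] : set R) by exact: measurable_set1.
apply/(measurable_funU _ m0 (measurableC m0)).
split; first exact: measurable_fun_set1.
apply: open_continuous_measurable_fun.
  apply: closed_openC; apply: accessible_closed_set1.
  exact/hausdorff_accessible/norm_hausdorff.
by move=> x /set_mem /= x0; apply: inv_continuous; exact/eqP.
Qed.

Lemma integral_carried (f : R -> \bar R) : measurable_fun [set: R] f ->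
  (\int[rho]_l f l = \int[rho]_(l in D) f l)%E.
Proof.
move=> mf; rewrite [RHS]integral_mkcond; apply: ae_eq_integral => //.
  by apply/(measurable_restrictT f mD); exact: measurable_funTS.
exists (~` D); split; [exact: measurableC|exact: carried|].
move=> l /= h lD; apply: h => _; by rewrite patchE mem_set.
Qed.

Lemma Rintegral_carried (f : R -> R) : measurable_fun [set: R] f ->
  \int[rho]_l f l = \int[rho]_(l in D) f l.
Proof. by move=> mf; rewrite /Rintegral integral_carried//; exact/measurable_EFinP. Qed.

Lemma carried_finite : (rho D < +oo)%E.
Proof. by apply: le_lt_trans fin; apply: le_measure; rewrite ?inE. Qed.

Lemma rint_bounded (M : R) (f : R -> R) : measurable_fun [set: R] f ->
  (forall l, D l -> `|f l| <= M) -> rint rho D f.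
Proof.
move=> mf fM; have := @le_rint _ _ _ rho D f (fun=> M); apply => //.
- exact: measurable_funTS.
- by move=> l Dl; rewrite (le_trans (fM _ Dl))// ler_norm.
apply/integrableP; split; first exact: measurable_cst.
by rewrite integral_cst//= lte_mul_pinfty// carried_finite.
Qed.

Lemma Rintegral_le_bound (M : R) (f : R -> R) : measurable_fun [set: R] f ->
  (forall l, D l -> `|f l| <= M) ->
  `|\int[rho]_(l in D) f l| <= M * fine (rho D).
Proof.
move=> mf fM; have fi := rint_bounded mf fM.
apply: le_trans (le_normr_Rintegral mD fi) _.
rewrite -Rintegral_cst//; apply: le_Rintegral => //; first exact: rint_norm.
apply/integrableP; split; first exact: measurable_cst.
by rewrite integral_cst//= lte_mul_pinfty// carried_finite.
Qed.

End CarriedIntegrals.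

Section WeylKernel.
Context {R : realType}.
Local Open Scope complex_scope.
Implicit Types (X eta l : R).

Lemma weyl_kernel_Re X eta l :
  complex.Re (((- X) +i* eta) / (l%:C * (l%:C - ((- X) +i* eta)))) =
  (- X * (l + X) - eta ^+ 2) * l^-1 * ((l + X) ^+ 2 + eta ^+ 2)^-1.
Proof.
rewrite invfM -fmorphV !(ReM, ImM) /= ?mul0r ?mulr0 ?subr0 ?addr0 ?add0r ?opprK.
by rewrite sqrrN; ring.
Qed.

(** The factor l * l^-1 is kept because it is 0 at l = 0, as is the left-hand side by the convention
    for inverses; the identity thus holds for every l. *)
Lemma weyl_kernel_Im X eta l :
  complex.Im (((- X) +i* eta) / (l%:C * (l%:C - ((- X) +i* eta)))) =
  eta * l * l^-1 * ((l + X) ^+ 2 + eta ^+ 2)^-1.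
Proof.
rewrite invfM -fmorphV !(ReM, ImM) /= ?mul0r ?mulr0 ?subr0 ?addr0 ?add0r ?opprK.
by rewrite sqrrN; ring.
Qed.

End WeylKernel.

Section StringContinuity.
Context {R : realType}.
Local Open Scope complex_scope.
Implicit Types (X eta : R).

Lemma cvg_approach X :
  (((- X) +i* eta : R[i]) : R[i]^o) @[eta --> 0^'+] --> ((- X)%:C : R[i]^o).
Proof.
apply/(@cvgrPdist_lt _ R[i]^o) => e e0.
have eE : e = (complex.Re e)%:C.
  by move: e0; rewrite ltcE => /andP[/eqP h _]; apply: complex_eqP => //=; rewrite -h.
have r0 : 0 < complex.Re e by move: e0; rewrite ltcE => /andP[_].
near=> eta; rewrite eE.
have -> : ((- X)%:C - ((- X) +i* eta) : R[i]) = (0 +i* (- eta)).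
  by apply: complex_eqP; rewrite /=; ring.
rewrite normc_def/= expr0n/= add0r sqrtr_sqr ltcR normrN gtr0_norm//.
Unshelve. all: by end_near. Qed.

Lemma strg_cvg (y m : nat -> R[i]) (s : R[i] * R[i]) T (F : set_system T)
    (FF : Filter F) (z : T -> R[i]) (z0 : R[i]) k :
  (z t : R[i]^o) @[t --> F] --> (z0 : R[i]^o) ->
  ((strg y m (z t) s k).1 : R[i]^o) @[t --> F] --> ((strg y m z0 s k).1 : R[i]^o) /\
  ((strg y m (z t) s k).2 : R[i]^o) @[t --> F] --> ((strg y m z0 s k).2 : R[i]^o).
Proof.
move=> zz; elim: k => [|k [h1 h2]]; first by split; exact: cvg_cst.
pose S1 t := (strg y m (z t) s k).1 : R[i]^o.
pose S2 t := (strg y m (z t) s k).2 : R[i]^o.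
have c1 : ((z t : R[i]^o) * (m k : R[i]^o)) @[t --> F] --> (z0 : R[i]^o) * (m k : R[i]^o).
  by apply: cvgM; [exact: zz|exact: cvg_cst].
have c2 : ((z t : R[i]^o) * (m k : R[i]^o) * S1 t) @[t --> F]
    --> (z0 : R[i]^o) * (m k : R[i]^o) * (strg y m z0 s k).1.
  by apply: cvgM; [exact: c1|exact: h1].
have c3 : (S2 t + (z t : R[i]^o) * (m k : R[i]^o) * S1 t) @[t --> F]
    --> ((strg y m z0 s k).2 : R[i]^o) + (z0 : R[i]^o) * (m k : R[i]^o) * (strg y m z0 s k).1.
  by apply: cvgD; [exact: h2|exact: c2].
have c4 : ((y k - y k.+1 : R[i]^o) * (S2 t + (z t : R[i]^o) * (m k : R[i]^o) * S1 t))
    @[t --> F] --> (y k - y k.+1 : R[i]^o) *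
    (((strg y m z0 s k).2 : R[i]^o) + (z0 : R[i]^o) * (m k : R[i]^o) * (strg y m z0 s k).1).
  by apply: cvgM; [exact: cvg_cst|exact: c3].
split; last exact: c3.
have c5 : ((S1 t : R[i]^o) - (y k - y k.+1 : R[i]^o) *
      (S2 t + (z t : R[i]^o) * (m k : R[i]^o) * S1 t)) @[t --> F]
    --> ((strg y m z0 s k).1 : R[i]^o) - (y k - y k.+1 : R[i]^o) *
    (((strg y m z0 s k).2 : R[i]^o) + (z0 : R[i]^o) * (m k : R[i]^o) * (strg y m z0 s k).1).
  by apply: cvgB; [exact: h1|exact: c4].
exact: c5.
Qed.

End StringContinuity.

(** * Error of the rational approximants on the negative half-line *)

Section PadeBound.
Context {R : realType}.
Local Notation leb := (@lebesgue_measure R).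
Local Open Scope complex_scope.
Variables (u : R -> R) (mu rho : borel_measure R) (x w : nat -> R).
Hypothesis hp : peakon_data u mu x w.
Hypothesis hu : phase_space u mu.
Hypothesis hrho : is_spectral_measure u mu rho.
Variables (D : set R) (alpha : R).
Hypothesis mD : measurable (D : set (measurableTypeR R)).
Hypothesis carried : rho (~` D) = 0%E.
Hypothesis fin : (rho setT < +oo)%E.
Hypothesis alpha0 : 0 < alpha.
Hypothesis D_alpha : forall l, D l -> alpha <= l.
Local Notation y := (string_pos x).
Local Notation m := (string_mass x w).
Local Notation P := (strg_growth y m).

(** The combination X Re m + eta Im m is - Re (z m(z)), the limit of Re (theta / phi) along the
    peaks, where theta / phi = T_k / G_k + 2 C z. The estimate of [strg_ratio] is uniform in k >= n
    and passes to the limit. *)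
Lemma weyl_limit_bound (C : R) (mz : R[i] -> R[i]) (X eta : R) n :
  is_Weyl_Titchmarsh u mu mz ->
  (forall t, t <= x 1 -> u t = C * expR t) -> 0 < X -> 0 < eta ->
  let z := (- X) +i* eta in
  let s i := strg (fun j => (y j)%:C) (fun j => (m j)%:C) z i n in
  is_true (`| X * complex.Re (mz z) + eta * complex.Im (mz z) + 2 * C * X
     - complex.Re ((s ((y 0%N)%:C, 1)).1 / (s (1, 0)).1)| <= y n / (P X n * P X n.+1)).
Proof.
move=> hW uC X0 eta0 z s.
have hz : complex.Im z != 0 by rewrite /= gt_eqF.
have [phi [theta [hphi htheta lim]]] := hW z hz.
have [sphi _] := hphi; have [stheta _] := htheta.
pose y' j := (y j)%:C; pose m' j := (m j)%:C.
pose G k := (strg y' m' z (1, 0) k).1.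
pose T k := (strg y' m' z (y' 0%N, 1) k).1.
have z0 : complex.Re z < 0 by rewrite /= oppr_lt0.
have Xz : - complex.Re z = X by rewrite /= opprK.
have G0 k : G k != 0.
  by have [] := strg_growth_step (string_posS hp) (string_mass_gt0 hp) k z0.
have E0 k : (expR (2^-1 * x k.+1))%:C != 0 by rewrite fmorph_eq0 gt_eqF// expR_gt0.
have phiE k : phi (x k.+1) = (expR (2^-1 * x k.+1))%:C * G k.
  rewrite (sol_strg hp (g := 1) (e := 0) sphi)// => t t1.
  by rewrite (phi_left hp hphi)// mul0r addr0 mulr1.
have thetaE k : theta (x k.+1) = (expR (2^-1 * x k.+1))%:C * (T k + 2 * C%:C * z * G k).
  rewrite (sol_strg hp (g := y' 0%N + 2 * C%:C * z * 1) (e := 1 + 2 * C%:C * z * 0) stheta).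
    congr (_ * _).
    by rewrite (strg_linear y' m' z (2 * C%:C * z) (y' 0%N, 1) (1, 0)).
  move=> t t1; rewrite (theta_left hp htheta hu uC)//.
  have -> : - (2^-1 * t) = 2^-1 * t + - t by field.
  rewrite expRD rmorphB rmorphM/= /y'; ring.
have z1 : z != 0 by apply: contraTneq z0 => ->; rewrite ltxx.
have {}lim : (- ((T k / G k + 2 * C%:C * z) / z) : R[i]^o) @[k --> \oo] --> (mz z : R[i]^o).
  have xoo : x k.+1 @[k --> \oo] --> +oo.
    have [_ xoo _ _ _] := hp.
    by move: xoo; rewrite -cvg_shiftS.
  have h := @cvg_comp _ _ _ (fun k => x k.+1)
    (fun t => - (theta t / (z * phi t)) : R[i]^o) _ _ _ xoo lim.
  rewrite (_ : (fun k => _) = (fun k => - (theta (x k.+1) / (z * phi (x k.+1)))))//.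
  apply/funext => k; rewrite phiE thetaE; congr (- _).
  by field; rewrite z1 G0 E0.
have lR := cvg_Re _ lim; have lI := cvg_Im _ lim.
have key k : (n <= k)%N ->
   `| X * complex.Re (- ((T k / G k + 2 * C%:C * z) / z))
      + eta * complex.Im (- ((T k / G k + 2 * C%:C * z) / z)) + 2 * C * X
     - complex.Re (T n / G n)| <= y n / (P X n * P X n.+1).
  move=> nk; set f := - _.
  have -> : X * complex.Re f + eta * complex.Im f + 2 * C * X - complex.Re (T n / G n)
      = complex.Re (T k / G k - T n / G n).
    have -> : T k / G k = - (z * f) - 2 * C%:C * z by rewrite /f; field; rewrite z1 G0.
    have -> : 2 = 2%:C :> R[i] by rewrite rmorph_nat.
    by rewrite !(ReD, ReN, ReM, ImM)/=; ring.
  apply: le_trans (abs_Re_normc _) _.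
  apply: le_trans (strg_ratio (string_posS hp) (string_mass_gt0 hp) z0 nk) _.
  rewrite Xz ler_wpM2r ?invr_ge0 ?mulr_ge0//.
  - exact/ltW/(strg_growth_gt0 (string_posS hp) (string_mass_gt0 hp)).
  - exact/ltW/(strg_growth_gt0 (string_posS hp) (string_mass_gt0 hp)).
  - by rewrite gerBl ltW// expR_gt0.
pose f k := - ((T k / G k + 2 * C%:C * z) / z).
have lXR : (X * complex.Re (f k)) @[k --> \oo] --> X * complex.Re (mz z).
  by apply: cvgM; [exact: cvg_cst|exact: lR].
have lXI : (eta * complex.Im (f k)) @[k --> \oo] --> eta * complex.Im (mz z).
  by apply: cvgM; [exact: cvg_cst|exact: lI].
have lS : (X * complex.Re (f k) + eta * complex.Im (f k)) @[k --> \oo]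
    --> X * complex.Re (mz z) + eta * complex.Im (mz z).
  by apply: cvgD; [exact: lXR|exact: lXI].
have h : `| X * complex.Re (f k) + eta * complex.Im (f k) + 2 * C * X
      - complex.Re (T n / G n)| @[k --> \oo] -->
    `| X * complex.Re (mz z) + eta * complex.Im (mz z) + 2 * C * X - complex.Re (T n / G n)|.
  apply: cvg_norm; apply: cvgB; last exact: cvg_cst.
  by apply: cvgD; [exact: lS|exact: cvg_cst].
apply: (cvgr_to_le h); apply: filterS (nbhs_infty_ge n) => k nk.
exact: key.
Qed.

Let m_carried (f : R -> R) : measurable_fun [set: R] f ->
  \int[rho]_l f l = \int[rho]_(l in D) f l.
Proof. exact: Rintegral_carried. Qed.

Let mshift X : measurable_fun [set: R] (fun l : R => (l + X)^-1).
Proof. by apply: (measurableT_comp measurable_inv); exact: measurable_funD. Qed.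

Let msq X eta : measurable_fun [set: R] (fun l : R => ((l + X) ^+ 2 + eta ^+ 2)^-1).
Proof.
apply: (measurableT_comp measurable_inv); apply: measurable_funD => //.
by apply: measurable_funX; exact: measurable_funD.
Qed.

(** For the kernel z / (l (l - z)) the same combination differs from its value X / (l + X) - X / l
    at z = - X by at most eta^2 / X^2, for all l in [D]. This explicit error replaces a passage to
    the limit under the integral. *)
Lemma weyl_kernel_approx (X eta : R) : 0 < X ->
  let mz (z : R[i]) := cintegral rho setT (fun l : R => z / (l%:C * (l%:C - z))) in
  let z := (- X) +i* eta in
  is_true (`| X * complex.Re (mz z) + eta * complex.Im (mz z)
     - (\int[rho]_(l in D) (X / (l + X)) - X * \int[rho]_(l in D) l^-1) |
  <= eta ^+ 2 * (fine (rho D) / X ^+ 2)).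
Proof.
move=> X0 mz z.
have D0 l : D l -> 0 < l by move=> /D_alpha; exact: lt_le_trans.
pose kR l := (- X * (l + X) - eta ^+ 2) * l^-1 * ((l + X) ^+ 2 + eta ^+ 2)^-1.
pose kI l := eta * l * l^-1 * ((l + X) ^+ 2 + eta ^+ 2)^-1.
have mkR : measurable_fun [set: R] kR.
  apply: measurable_funM => //; apply: measurable_funM; last exact: measurable_inv.
  by apply: measurable_funB => //; apply: measurable_funM => //; exact: measurable_funD.
have mkI : measurable_fun [set: R] kI.
  apply: measurable_funM => //; apply: measurable_funM; last exact: measurable_inv.
  exact: measurable_funM.
have -> : complex.Re (mz z) = \int[rho]_(l in D) kR l.
  by rewrite -m_carried//=; apply: eq_Rintegral => l _; exact: weyl_kernel_Re.
have -> : complex.Im (mz z) = \int[rho]_(l in D) kI l.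
  by rewrite -m_carried//=; apply: eq_Rintegral => l _; exact: weyl_kernel_Im.
have s0 l : D l -> 0 < l + X by move=> /D0 l0; rewrite addr_gt0.
have q0 l : D l -> X ^+ 2 <= (l + X) ^+ 2 + eta ^+ 2.
  move=> Dl; have := D0 _ Dl => l0; have := sqr_ge0 eta.
  by move: (eta ^+ 2) => e; nra.
have q1 l : D l -> 0 < (l + X) ^+ 2 + eta ^+ 2.
  by move=> Dl; apply: lt_le_trans (q0 _ Dl); rewrite exprn_gt0.
have il : rint rho D (fun l => l^-1).
  apply: (rint_bounded mD fin (M := alpha^-1)); first exact: measurable_inv.
  move=> l Dl; rewrite ger0_norm ?invr_ge0 ?(ltW (D0 _ Dl))//.
  by rewrite lef_pV2 ?posrE ?(D0 _ Dl) ?D_alpha.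
have iX : rint rho D (fun l => X / (l + X)).
  apply: (rint_bounded mD fin (M := 1)); first exact: measurable_funM.
  move=> l Dl; rewrite ger0_norm ?divr_ge0 ?(ltW X0) ?(ltW (s0 _ Dl))//.
  by rewrite ler_pdivrMr ?s0// mul1r lerDr ltW// D0.
have kIE l : D l -> eta * kI l = eta ^+ 2 / ((l + X) ^+ 2 + eta ^+ 2).
  move=> Dl; rewrite /kI -(mulrA eta) divff ?gt_eqF ?D0// mulr1 mulrA.
  by rewrite expr2.
have iI : rint rho D (fun l => eta * kI l).
  apply: (rint_bounded mD fin (M := eta ^+ 2 / X ^+ 2)); first exact: measurable_funM.
  move=> l Dl; rewrite kIE// ger0_norm ?divr_ge0 ?sqr_ge0 ?(ltW (q1 _ Dl))//.
  by rewrite ler_wpM2l ?sqr_ge0// lef_pV2 ?posrE ?q1 ?q0// exprn_gt0.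
have kE l : D l -> X * kR l + eta * kI l - (X / (l + X) - X * l^-1)
    = eta ^+ 2 * l / ((l + X) * ((l + X) ^+ 2 + eta ^+ 2)).
  move=> Dl; rewrite /kR /kI; field.
  by rewrite !gt_eqF ?q1 ?s0 ?D0.
have kB l : D l -> `|X * kR l + eta * kI l - (X / (l + X) - X * l^-1)| <= eta ^+ 2 / X ^+ 2.
  move=> Dl; have l0 := D0 _ Dl; have sl := s0 _ Dl.
  rewrite kE// ger0_norm; last first.
    apply: divr_ge0; apply: mulr_ge0; first exact: sqr_ge0.
    - exact: ltW.
    - exact: ltW.
    - exact/ltW/q1.
  rewrite -mulrA ler_wpM2l ?sqr_ge0// invfM mulrA.
  rewrite -[leRHS]mul1r; apply: ler_pM.
  - by rewrite divr_ge0// ltW.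
  - by rewrite invr_ge0 ltW// q1.
  - by rewrite ler_pdivrMr// mul1r lerDl ltW.
  - by rewrite lef_pV2 ?posrE ?q1 ?q0// exprn_gt0.
have mk : measurable_fun [set: R]
    (fun l => X * kR l + eta * kI l - (X / (l + X) - X * l^-1)).
  apply: measurable_funB; first by apply: measurable_funD; exact: measurable_funM.
  apply: measurable_funB; first exact: measurable_funM.
  by apply: measurable_funM => //; exact: measurable_inv.
have iB := rint_bounded mD fin mk kB.
have iJ : rint rho D (fun l => X / (l + X) - X * l^-1) by apply: rintB => //; exact: rintZ.
have iRI : rint rho D (fun l => X * kR l + eta * kI l).
  have := rintD mD iB iJ; congr (rint rho D _).
  by apply/funext => l; rewrite subrK.
have iR : rint rho D (fun l => X * kR l).
  have := rintB mD iRI iI; congr (rint rho D _).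
  by apply/funext => l; rewrite addrK.
have iR' : rint rho D kR.
  have := rintZ X^-1 mD iR; congr (rint rho D _).
  by apply/funext => l; rewrite mulrA mulVf ?gt_eqF// mul1r.
have iI' : rint rho D kI.
  apply: (rint_bounded mD fin (M := `|eta| / X ^+ 2)) => // l Dl.
  rewrite /kI -(mulrA eta) divff ?gt_eqF ?D0// mulr1 normrM ler_wpM2l//.
  rewrite ger0_norm ?invr_ge0 ?(ltW (q1 _ Dl))//.
  by rewrite lef_pV2 ?posrE ?q1 ?q0// exprn_gt0.
rewrite -!RintegralZl// -RintegralB//; last exact: rintZ.
rewrite -RintegralD// -RintegralB//.
have -> : eta ^+ 2 * (fine (rho D) / X ^+ 2) = eta ^+ 2 / X ^+ 2 * fine (rho D) by ring.
exact: (Rintegral_le_bound mD fin mk kB).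
Qed.

(** The Weyl-Titchmarsh function is prescribed off the real axis only, so - X is approached
    vertically. The terms linear in X, from theta and from the kernel, are collected in K; what
    matters is that K depends neither on X nor on n, as comparing growth rates will show K = 0. *)
Lemma pade_bound : exists K : R, forall (X : R) n, 0 < X ->
  `| \int[rho]_(l in D) (X / (l + X)) - K * X
     - (strg y m (- X) (y 0%N, 1) n).1 / (strg y m (- X) (1, 0) n).1 |
  <= y n / (P X n * P X n.+1).
Proof.
have [C uC] := u_left hp hu.
exists (\int[rho]_(l in D) l^-1 - 2 * C) => X n X0.
have [_ _ hW] := hrho.
pose z eta : R[i] := (- X) +i* eta.
pose y' j := (y j)%:C; pose m' j := (m j)%:C.
pose G k := (strg y m (- X) (1, 0) k).1.
pose T k := (strg y m (- X) (y 0%N, 1) k).1.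
have GE k s : (strg y' m' (- X)%:C (s.1%:C, s.2%:C) k).1 = ((strg y m (- X) s k).1)%:C.
  by have := strg_morph (real_complex R) y m (- X) s k => ->.
have GE1 : (strg y' m' (- X)%:C (1, 0) n).1 = (G n)%:C by exact: (GE n (1, 0)).
have TE1 : (strg y' m' (- X)%:C ((y 0%N)%:C, 1) n).1 = (T n)%:C by exact: (GE n (y 0%N, 1)).
have z0 : complex.Re ((- X)%:C) < 0 by rewrite /= oppr_lt0.
have Gn0 : (G n)%:C != 0.
  by rewrite -GE1; have [] := strg_growth_step (string_posS hp) (string_mass_gt0 hp) n z0.
have [G1 _] := strg_cvg y' m' (1, 0) _ n (@cvg_approach R X).
have [T1 _] := strg_cvg y' m' ((y 0%N)%:C, 1) _ n (@cvg_approach R X).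
rewrite GE1 in G1; rewrite TE1 in T1.
pose Tz eta := (strg y' m' (z eta) ((y 0%N)%:C, 1) n).1 : R[i]^o.
pose Gz eta := (strg y' m' (z eta) (1, 0) n).1 : R[i]^o.
have GV : (Gz eta)^-1 @[eta --> 0^'+] --> ((G n)%:C : R[i]^o)^-1.
  by apply: cvgV; [exact: Gn0|exact: G1].
have TG : (Tz eta * (Gz eta)^-1) @[eta --> 0^'+] --> ((T n)%:C : R[i]^o) * ((G n)%:C : R[i]^o)^-1.
  by apply: cvgM; [exact: T1|exact: GV].
rewrite -fmorphV -rmorphM/= in TG.
have {}TG := cvg_Re _ TG.
set J := _ - _ * X.
pose M := fine (rho D) / X ^+ 2.
pose B := y n / (P X n * P X n.+1).
suff : `|J - T n / G n| <= B + 0 ^+ 2 * M by rewrite expr0n mul0r addr0.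
have h1 : (`|J - complex.Re ((strg y' m' (z eta) ((y 0%N)%:C, 1) n).1 / (strg y' m' (z eta) (1, 0) n).1)|)
    @[eta --> 0^'+] --> `|J - T n / G n|.
  by apply: cvg_norm; apply: cvgB; [exact: cvg_cst|exact: TG].
have h2 : (B + eta ^+ 2 * M) @[eta --> 0^'+] --> B + 0 ^+ 2 * M.
  apply: cvgD; first exact: cvg_cst.
  apply: cvgM; last exact: cvg_cst.
  rewrite expr2; apply: cvgM; apply: cvg_at_right_filter; exact: cvg_id.
apply: (ler_cvg_to h1 h2).
near=> eta.
have e0 : 0 < eta by near: eta; exact: nbhs_right_gt.
pose mz (v : R[i]) := cintegral rho setT (fun l : R => v / (l%:C * (l%:C - v))).
pose a := X * complex.Re (mz (z eta)) + eta * complex.Im (mz (z eta)).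
pose d := \int[rho]_(l in D) (X / (l + X)) - X * \int[rho]_(l in D) l^-1.
set c := complex.Re _.
have b1 : `|a + 2 * C * X - c| <= B := weyl_limit_bound n hW uC X0 e0.
have b2 : `|a - d| <= eta ^+ 2 * M := weyl_kernel_approx eta X0.
have -> : J - c = (a + 2 * C * X - c) - (a - d) by rewrite /J /d; ring.
by apply: le_trans (ler_normB _ _) _; exact: lerD.
Unshelve. all: by end_near. Qed.

End PadeBound.

(** * Orthogonality and the extremal problem *)

Section MomentFunctional.
Context {R : comNzRingType}.
Implicit Types (s : nat -> R) (p q : {poly R}).

(** The functional is attached to a sequence of moments rather than to a measure, so that it also
    covers the rescaled moments and their limits, for which no integral has to be exhibited. *)
Definition momfun s p : R := \sum_(i < size p) p`_i * s i.

Lemma momfunE s n p : (size p <= n)%N -> momfun s p = \sum_(i < n) p`_i * s i.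
Proof.
move=> pn; rewrite /momfun (big_ord_widen n (fun i => p`_i * s i))//.
rewrite big_mkcond/=; apply: eq_bigr => i _; case: ltnP => // h.
by rewrite nth_default// mul0r.
Qed.

Lemma momfun_is_linear s : scalar (momfun s).
Proof.
move=> a p q; set n := maxn (size p) (size q).
have hpq : (size (a *: p + q)%R <= n)%N.
  by rewrite (leq_trans (size_polyD _ _))// geq_max !leq_max (leq_trans (size_scale_leq _ _)) ?leqnn ?orbT.
rewrite (momfunE s hpq) (momfunE s (leq_maxl _ _ : (size p <= n)%N))
  (momfunE s (leq_maxr _ _ : (size q <= n)%N)) mulr_sumr -big_split/=.
by apply: eq_bigr => i _; rewrite coefD coefZ mulrDl mulrA.
Qed.

HB.instance Definition _ s := GRing.isLinear.Build R {poly R} R _ (momfun s) (momfun_is_linear s).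

Lemma momfunXM s p : momfun s ('X * p) = momfun (fun i => s i.+1) p.
Proof.
have h : (size ('X * p)%R <= (size p).+1)%N.
  by rewrite (leq_trans (size_polyMleq _ _))// size_polyX.
rewrite (momfunE s h) big_ord_recl coefXM/= mul0r add0r /momfun.
by apply: eq_bigr => i _; rewrite coefXM/=.
Qed.

Lemma momfunXnM s k p : momfun s ('X^k * p) = momfun (fun i => s (k + i)%N) p.
Proof.
elim: k s => [|k IH] s; first by rewrite expr0 mul1r.
by rewrite exprS -mulrA momfunXM IH.
Qed.

Lemma momfun1 s : momfun s 1 = s 0%N.
Proof. by rewrite /momfun size_poly1 big_ord1 coef1 mul1r. Qed.

Lemma momfunXn s k : momfun s 'X^k = s k.
Proof. by rewrite -['X^k]mulr1 momfunXnM momfun1 addn0. Qed.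

End MomentFunctional.

Section StringPolynomials.
Context {R : realType}.
Variables (y m : nat -> R).
Implicit Types (k n : nat) (p q : {poly R}).

Let yp k := (y k)%:P.
Let mp k := (m k)%:P.
Definition spoly k : {poly R} := (strg yp mp 'X (1, 0) k).1.
Definition spolyE k : {poly R} := (strg yp mp 'X (1, 0) k).2.
Definition spolyT k : {poly R} := (strg yp mp 'X ((y 0%N)%:P, 1) k).1.

Let horner_strg (s : {poly R} * {poly R}) z k :
  (strg y m z (s.1.[z], s.2.[z]) k) = ((strg yp mp 'X s k).1.[z], (strg yp mp 'X s k).2.[z]).
Proof.
elim: k => [|k]; first by [].
move=> /= ->; congr (_, _);
by rewrite /= !(hornerD, hornerN, hornerM, hornerX, hornerC).
Qed.

Lemma spoly_horner z k : (spoly k).[z] = (strg y m z (1, 0) k).1.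
Proof. by have := horner_strg (1, 0) z k; rewrite /= hornerC horner0 => ->. Qed.

Lemma spolyT_horner z k : (spolyT k).[z] = (strg y m z (y 0%N, 1) k).1.
Proof. by have := horner_strg ((y 0%N)%:P, 1) z k; rewrite /= !hornerC => ->. Qed.

Lemma spolyES k : spolyE k.+1 = spolyE k + m k *: ('X * spoly k).
Proof. by rewrite /spolyE /spoly /= /mp -mul_polyC; ring. Qed.

Lemma spolyS k : spoly k.+1 = spoly k - (y k - y k.+1) *: spolyE k.+1.
Proof. by rewrite /spolyE /spoly /= /yp -mul_polyC polyCB. Qed.

Lemma size_spoly_spolyE k : (size (spoly k) <= k.+1)%N /\ (size (spolyE k) <= k.+1)%N.
Proof.
elim: k => [|k [h1 h2]]; first by rewrite /spoly /spolyE/= size_poly1 size_poly0.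
have hE : (size (spolyE k.+1) <= k.+2)%N.
  rewrite spolyES (leq_trans (size_polyD _ _))// geq_max (leq_trans h2)//=.
  rewrite (leq_trans (size_scale_leq _ _))// (leq_trans (size_polyMleq _ _))//.
  by rewrite size_polyX.
split=> //; rewrite spolyS (leq_trans (size_polyD _ _))// geq_max (leq_trans h1)//=.
by rewrite size_polyN (leq_trans (size_scale_leq _ _)).
Qed.

Lemma spoly_at0 k : (spoly k).[0] = 1 /\ (spolyE k).[0] = 0.
Proof.
elim: k => [|k [h1 h2]]; first by rewrite /spoly /spolyE/= hornerC horner0.
have hE : (spolyE k.+1).[0] = 0.
  by rewrite spolyES hornerD hornerZ hornerM hornerX h2 mul0r mulr0 addr0.
by split=> //; rewrite spolyS hornerD hornerN hornerZ hE mulr0 subr0.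
Qed.

Lemma spolyT_at0 k : (spolyT k).[0] = y k.
Proof.
rewrite spolyT_horner.
suff -> : strg y m 0 (y 0%N, 1) k = (y k, 1) by [].
by elim: k => //= k ->; congr (_, _) => /=; ring.
Qed.

End StringPolynomials.

Section Growth.
Context {R : realType}.

Lemma horner_bound (p : {poly R}) n X : (size p <= n.+1)%N -> 1 <= X ->
  `|p.[- X]| <= (\sum_(i < size p) `|p`_i|) * X ^+ n.
Proof.
move=> pn X1; have X0 : 0 <= X by exact: le_trans X1.
rewrite horner_coef mulr_suml; apply: le_trans (ler_norm_sum _ _ _) _.
apply: ler_sum => i _; rewrite normrM ler_wpM2l// normrX normrN ger0_norm//.
by apply: ler_weXn2l => //; rewrite -ltnS (leq_trans (ltn_ord i)).
Qed.

(** If the degree were d >= e, the leading term would make X |Q(- X)| of order X^(d + 1), beyond the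
    bound. *)
Lemma small_poly (Q : {poly R}) (C : R) e :
  (forall X, 1 <= X -> X * `|Q.[- X]| <= C * X ^+ e) -> (size Q <= e)%N.
Proof.
move=> h; rewrite leqNgt; apply/negP => eQ.
have Q0 : Q != 0 by apply: contraTneq eQ => ->; rewrite size_poly0.
set d := (size Q).-1.
have dS : size Q = d.+1 by rewrite /d prednK// size_poly_gt0.
have ed : (e <= d)%N by rewrite -ltnS -dS.
pose l := Q`_d.
have l0 : l != 0 by rewrite /l /d -/(lead_coef Q) lead_coef_eq0.
pose Q1 := Q - l *: 'X^d.
have Q1s : (size Q1 <= d)%N.
  apply/leq_sizeP => j; rewrite leq_eqVlt => /predU1P[<-|dj].
    by rewrite /Q1 coefB coefZ coefXn eqxx mulr1 subrr.
  rewrite /Q1 coefB coefZ coefXn gtn_eqF// mulr0 subr0 nth_default//.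
  by rewrite dS.
pose A := \sum_(i < size Q1) `|Q1`_i|.
have A0 : 0 <= A by apply: sumr_ge0.
have key X : 1 <= X -> `|l| * X <= `|C| + A.
  move=> X1; have X0 : 0 < X by exact: lt_le_trans X1.
  have Xd : 0 < X ^+ d by rewrite exprn_gt0.
  have h1 : X * `|Q1.[- X]| <= A * X ^+ d.
    case: (posnP d) Q1s => [->|d0 Q1s].
      by rewrite leqn0 size_poly_eq0 => /eqP Q10; rewrite Q10 horner0 normr0 mulr0 mulr_ge0.
    rewrite -(prednK d0) in Q1s.
    apply: le_trans (ler_wpM2l (ltW X0) (horner_bound Q1s X1)) _.
    by rewrite mulrCA -exprS prednK.
  have h2 : `|l| * X ^+ d <= `|Q.[- X]| + `|Q1.[- X]|.
    have -> : `|l| * X ^+ d = `|Q.[- X] - Q1.[- X]|.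
      rewrite -hornerN -hornerD /Q1 opprB addrCA subrr addr0 hornerZ hornerXn.
      by rewrite normrM normrX normrN (ger0_norm (ltW X0)).
    exact: ler_normB.
  have h3 : X * `|Q.[- X]| <= `|C| * X ^+ d.
    apply: le_trans (h _ X1) _; apply: le_trans (_ : `|C| * X ^+ e <= _).
      by rewrite ler_wpM2r ?exprn_ge0 ?ler_norm// ltW.
    by rewrite ler_wpM2l// ler_weXn2l.
  rewrite -(ler_pM2r Xd) mulrAC.
  apply: le_trans (ler_wpM2r (ltW X0) h2) _; lra.
have := key (1 + (`|C| + A) / `|l|); rewrite lerDl divr_ge0 ?addr_ge0// => /(_ isT).
rewrite mulrDr mulr1 mulrCA divff ?normr_eq0// mulr1 gerDr normr_le0.
by rewrite (negbTE l0).
Qed.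

End Growth.

Section Orthogonality.
Context {R : realType} (rho : borel_measure R) (D : set R).
Hypothesis mD : measurable (D : set (measurableTypeR R)).
Hypothesis fin : (rho setT < +oo)%E.
Variables (alpha beta : R).
Hypothesis alpha0 : 0 < alpha.
Hypothesis D_alpha : forall l, D l -> alpha <= l.
Hypothesis D_beta : forall l, D l -> l <= beta.
Implicit Types (p q : {poly R}) (k n M : nat) (X l z : R).

Definition moment k : R := \int[rho]_(l in D) l ^+ k.

Let D0 l : D l -> 0 < l. Proof. by move=> /D_alpha; exact: lt_le_trans. Qed.

Lemma rint_expr k : rint rho D (fun l => l ^+ k).
Proof.
apply: (rint_bounded mD fin (M := beta ^+ k)); first exact: measurable_funX.
move=> l Dl; rewrite ger0_norm ?exprn_ge0 ?(ltW (D0 Dl))//.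
have lb := D_beta Dl; have l0 := ltW (D0 Dl).
by apply: lerXn2r => //; rewrite nnegrE// (le_trans l0 lb).
Qed.

Lemma rint_sum n (c : nat -> R) (h : nat -> R -> R) :
  (forall i, rint rho D (h i)) ->
  rint rho D (fun l => \sum_(i < n) c i * h i l) /\
  \int[rho]_(l in D) (\sum_(i < n) c i * h i l) = \sum_(i < n) c i * \int[rho]_(l in D) h i l.
Proof.
move=> hi; elim: n => [|n [in_ In]].
  split.
    apply: (rint_bounded mD fin (M := 0)) => [|l _].
      by under eq_fun do rewrite big_ord0; exact: measurable_cst.
    by rewrite big_ord0 normr0.
  rewrite big_ord0; under eq_Rintegral do rewrite big_ord0.
  by rewrite Rintegral_cst// mul0r.
have e : (fun l => \sum_(i < n.+1) c i * h i l) =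
    (fun l => (\sum_(i < n) c i * h i l) + c n * h n l).
  by apply/funext => l; rewrite big_ord_recr.
have iz := rintZ (c n) mD (hi n).
split; first by rewrite e; exact: rintD.
by rewrite [in RHS]big_ord_recr/= -In e RintegralD// (RintegralZl _ mD (hi n)).
Qed.

Lemma integral_horner p : \int[rho]_(l in D) p.[l] = momfun moment p.
Proof.
under eq_Rintegral do rewrite horner_coef.
by have [_ ->] := rint_sum (size p) (fun i => p`_i) rint_expr.
Qed.

Lemma momfun_sqr_ge0 p : 0 <= momfun moment (p ^+ 2).
Proof.
rewrite -integral_horner; apply: Rintegral_ge0 => l _.
by rewrite horner_exp sqr_ge0.
Qed.

Lemma moment_ge0 k : 0 <= moment k.
Proof. by apply: Rintegral_ge0 => l /D0 l0; rewrite exprn_ge0 ?ltW. Qed.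

(** With z = - X one has X / (l + X) = z / (z - l). Expanding in powers of l / z, integrating and
    multiplying by z^M, this is the polynomial part. *)
Definition expansion M : {poly R} := \poly_(j < M.+1) moment (M - j).

Lemma cauchy_expansion M X : 0 < X ->
  `| (- X) ^+ M * \int[rho]_(l in D) (X / (l + X)) - (expansion M).[- X] |
  <= moment M.+1 / X.
Proof.
move=> X0; set z := - X.
have s0 l : D l -> 0 < l + X by move=> /D0 l0; rewrite addr_gt0.
have iX : rint rho D (fun l => X / (l + X)).
  apply: (rint_bounded mD fin (M := 1)).
    apply: measurable_funM => //; apply: (measurableT_comp measurable_inv).
    exact: measurable_funD.
  move=> l Dl; rewrite ger0_norm ?divr_ge0 ?(ltW X0) ?(ltW (s0 _ Dl))//.
  by rewrite ler_pdivrMr ?s0// mul1r lerDr (ltW (D0 Dl)).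
pose c i := z ^+ (M - i).
have [iS IS] := rint_sum M.+1 c rint_expr.
have -> : (expansion M).[z] = \int[rho]_(l in D) (\sum_(i < M.+1) c i * l ^+ i).
  rewrite IS horner_poly (reindex_inj rev_ord_inj)/=; apply: eq_bigr => i _.
  rewrite /c subSS subKn; first exact: mulrC.
  by rewrite -ltnS.
have i1 := rintZ (z ^+ M) mD iX.
have -> : z ^+ M * \int[rho]_(l in D) (X / (l + X)) -
    \int[rho]_(l in D) (\sum_(i < M.+1) c i * l ^+ i) =
    \int[rho]_(l in D) (z ^+ M * (X / (l + X)) - \sum_(i < M.+1) c i * l ^+ i).
  by rewrite (RintegralB mD i1 iS) (RintegralZl (z ^+ M) mD iX).
have e l : D l -> z ^+ M * (X / (l + X)) - \sum_(i < M.+1) c i * l ^+ i = - (l ^+ M.+1 / (l + X)).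
  move=> Dl; have s1 : l + X != 0 by rewrite gt_eqF ?s0.
  apply: (mulIf s1); rewrite mulrBl -mulrA divfK// mulNr divfK//.
  have := subrXX z l M.+1; rewrite /= => h.
  have -> : (\sum_(i < M.+1) c i * l ^+ i) * (l + X) = - (z ^+ M.+1 - l ^+ M.+1).
    by rewrite h /z mulrC -mulNr opprB opprK.
  by rewrite exprS /z; ring.
have iB : rint rho D (fun l => l ^+ M.+1 / (l + X)).
  have := rintM_bounded (M := X^-1) mD _ _ (rint_expr M.+1); move=> /(_ (fun l => (l + X)^-1)).
  rewrite (_ : (fun l => (l + X)^-1 * l ^+ M.+1) = (fun l => l ^+ M.+1 / (l + X))); last first.
    by apply/funext => l; rewrite mulrC.
  apply.
    by apply: measurable_funTS; apply: (measurableT_comp measurable_inv); exact: measurable_funD.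
  move=> l Dl; rewrite ger0_norm ?invr_ge0 ?(ltW (s0 _ Dl))//.
  by rewrite lef_pV2 ?posrE ?(s0 _ Dl)// lerDr (ltW (D0 Dl)).
rewrite (@eq_Rintegral _ _ _ rho D (fun l => - 1 * (l ^+ M.+1 / (l + X)))); last first.
  by move=> l /set_mem Dl; rewrite e// mulN1r.
rewrite (RintegralZl _ mD iB) mulN1r normrN ger0_norm; last first.
  apply: Rintegral_ge0 => l Dl.
  by rewrite divr_ge0 ?exprn_ge0 ?(ltW (D0 Dl)) ?(ltW (s0 _ Dl)).
rewrite /moment -(RintegralZr _ mD (rint_expr M.+1)).
apply: le_Rintegral => //.
  have := rintZ X^-1 mD (rint_expr M.+1); congr (rint rho D _).
  by apply/funext => l; rewrite mulrC.
move=> l Dl; rewrite ler_wpM2l ?exprn_ge0 ?(ltW (D0 Dl))//.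
by rewrite lef_pV2 ?posrE ?(s0 _ Dl)// lerDr (ltW (D0 Dl)).
Qed.

End Orthogonality.

Section StringOrthogonality.
Context {R : realType}.
Variables (y m : nat -> R).
Hypothesis yS : forall k, y k.+1 < y k.
Hypothesis y0 : forall k, 0 < y k.
Hypothesis m0 : forall k, 0 < m k.
Variables (F : R -> R) (s : nat -> R).
Hypothesis s0 : forall k, 0 <= s k.
Hypothesis F_expansion : forall M X, 0 < X ->
  `| (- X) ^+ M * F X - (\poly_(j < M.+1) s (M - j)).[- X] | <= s M.+1 / X.
Hypothesis pade : exists K : R, forall X n, 0 < X ->
  `| F X - K * X - (strg y m (- X) (y 0%N, 1) n).1 / (strg y m (- X) (1, 0) n).1 |
  <= y n / (strg_growth y m X n * strg_growth y m X n.+1).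
Local Notation L := (momfun s).
Local Notation G := (spoly y m).
Local Notation T := (spolyT y m).
Local Notation E := (spolyE y m).

(** At z = - X the slopes are nonpositive, so that each step multiplies the value by at least the
    corresponding factor of the product. *)
Lemma strg_growth_real X k : 0 < X -> strg_growth y m X k <= (strg y m (- X) (1, 0) k).1 /\
  (strg y m (- X) (1, 0) k).2 <= 0.
Proof.
move=> X0; elim: k => [|k [h1 h2]] /=; first by rewrite /strg_growth big_ord0.
move: (strg_growth_gt0 yS m0 k X0) h1 h2; rewrite strg_growthS.
move: (strg _ _ _ _ _) (strg_growth _ _ _ _) => [g e] P /= P0 Pg e0.
have l0 : 0 < y k - y k.+1 by rewrite subr_gt0.
have mg : 0 < m k * X by rewrite mulr_gt0.
have g0 : 0 < g by exact: lt_le_trans Pg.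
split; last by nra.
have h1 : P * (1 + (y k - y k.+1) * m k * X) <= g * (1 + (y k - y k.+1) * m k * X).
  by rewrite ler_wpM2r// addr_ge0// -mulrA mulr_ge0// ltW.
apply: le_trans h1 _.
rewrite -subr_ge0 (_ : _ - _ = (y k - y k.+1) * (- e)); last by ring.
by rewrite mulr_ge0// ?oppr_ge0// ltW.
Qed.

Lemma strg_growth_lower n : {c : R | 0 < c & forall X, 0 < X -> c * X ^+ n <= strg_growth y m X n}.
Proof.
exists (\prod_(j < n) ((y j - y j.+1) * m j)).
  by apply: prodr_gt0 => j _; rewrite mulr_gt0// subr_gt0.
move=> X X0; rewrite -[X in _ * _ ^+ X]card_ord -prodr_const -big_split/=.
apply: ler_prod => j _; rewrite lerDr ler01 andbT.
by rewrite mulr_ge0 ?(ltW X0)// mulr_ge0 ?(ltW (m0 _))// subr_ge0 ltW.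
Qed.

(** The error in [pade] is of order X^(- 2 n - 1) and G_n(- X) of order at most X^n, so their
    product is of order X^(- n - 1). *)
Lemma pade_poly : exists K : R, forall n, exists C : R, forall X, 1 <= X ->
  X ^+ n.+1 * `| (F X - K * X) * (G n).[- X] - (T n).[- X] | <= C.
Proof.
have [K hK] := pade; exists K => n.
have [c c0 hc] := strg_growth_lower n; have [c' c'0 hc'] := strg_growth_lower n.+1.
set A := \sum_(i < size (G n)) `|(G n)`_i|.
exists (A * y n / (c * c')) => X X1.
have X0 : 0 < X by exact: lt_le_trans X1.
have A0 : 0 <= A by apply: sumr_ge0.
have [g1 _] := strg_growth_real n X0.
have P0 := strg_growth_gt0 yS m0 n X0; have P0' := strg_growth_gt0 yS m0 n.+1 X0.
have g0 : (G n).[- X] != 0 by rewrite spoly_horner gt_eqF// (lt_le_trans P0 g1).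
have := hK X n X0; rewrite -spoly_horner -spolyT_horner => h.
have -> : (F X - K * X) * (G n).[- X] - (T n).[- X] =
    (F X - K * X - (T n).[- X] / (G n).[- X]) * (G n).[- X] by field.
have hG := horner_bound (size_spoly_spolyE y m n).1 X1.
rewrite normrM.
apply: (@le_trans _ _ (X ^+ n.+1 * (y n / (c * X ^+ n * (c' * X ^+ n.+1)) * (A * X ^+ n)))).
  rewrite ler_wpM2l ?exprn_ge0 ?(ltW X0)//; apply: ler_pM => //.
  apply: le_trans h _; rewrite ler_wpM2l ?(ltW (y0 n))//.
  rewrite lef_pV2 ?posrE ?mulr_gt0 ?exprn_gt0//.
  by apply: ler_pM; rewrite ?hc ?hc'// mulr_ge0 ?exprn_ge0 ?ltW.
rewrite le_eqVlt; apply/orP; left; apply/eqP; field.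
by rewrite !gt_eqF ?exprn_gt0.
Qed.

(** Multiplied by X^(2 n), [pade_poly] says that F may be replaced by its expansion and that the
    resulting polynomial [Q] has degree below n. Its coefficients of index n to 2 n vanish, and
    these compare the numbers L (X^k G_n) with the coefficients of X^(2 n) T_n. *)
Lemma string_orthogonality n : L (G n) = y n /\
  forall k, (1 <= k <= n)%N -> L ('X^k * G n) = 0.
Proof.
have [K hK] := pade_poly.
have Fb X : 0 < X -> `|F X| <= s 0 + s 1 / X.
  move=> X0; have := F_expansion 0 X0; rewrite expr0 mul1r horner_poly big_ord1 expr0 mulr1 subnn => h.
  have -> : F X = (F X - s 0) + s 0 by rewrite subrK.
  by rewrite (le_trans (ler_normD _ _))// addrC lerD// ger0_norm.
(* The case n = 0 suffices: both F and F - K X - y 0 are bounded for X >= 1, hence so is K X. *)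
have K0 : K = 0.
  have [C hC] := hK 0%N.
  have hb X : 1 <= X -> `|K| * X <= s 0 + s 1 + `|y 0| + `|C|.
    move=> X1; have X0 : 0 < X by exact: lt_le_trans X1.
    have := hC X X1; rewrite expr1 spoly_horner spolyT_horner/= mulr1 => h.
    have {}h : `|F X - K * X - y 0| <= `|C|.
      apply: le_trans (_ : X * `|F X - K * X - y 0| <= _).
        by rewrite ler_peMl.
      by apply: le_trans h (ler_norm _).
    have -> : `|K| * X = `|F X - y 0 - (F X - K * X - y 0)|.
      by rewrite (_ : F X - y 0 - _ = K * X) ?normrM ?(gtr0_norm X0)//; ring.
    rewrite (le_trans (ler_normB _ _))// lerD// (le_trans (ler_normB _ _))// lerD//.
    apply: le_trans (Fb _ X0) _; rewrite lerD2l ler_pdivrMr// ler_peMr//.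
  apply/eqP; rewrite -normr_le0 leNgt; apply/negP => Kp.
  set B := s 0 + s 1 + `|y 0| + `|C|.
  have B0 : 0 <= B by rewrite !addr_ge0.
  have := hb (1 + B / `|K|); rewrite lerDl divr_ge0 ?(ltW Kp)// => /(_ isT).
  rewrite -/B mulrDr mulr1 mulrCA divff ?gt_eqF// mulr1 gerDr.
  by rewrite leNgt Kp.
have [C hC] := hK n.
(* The smallest M for which M - k >= n for all k <= n, so that every coefficient needed lies beyond
   the degree of [Q]. *)
pose M := (n + n)%N.
pose SM := \poly_(j < M.+1) s (M - j).
pose Q := SM * G n - 'X^M * T n.
set A := \sum_(i < size (G n)) `|(G n)`_i|.
have A0 : 0 <= A by apply: sumr_ge0.
have szQ : (size Q <= n)%N.
  apply: (@small_poly _ _ (s M.+1 * A + C)) => X X1.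
  have X0 : 0 < X by exact: lt_le_trans X1.
  have Xn : 0 < X ^+ n by rewrite exprn_gt0.
  have -> : Q.[- X] = (- X) ^+ M * (F X * (G n).[- X] - (T n).[- X])
       - ((- X) ^+ M * F X - SM.[- X]) * (G n).[- X].
    by rewrite /Q hornerD hornerN !hornerM hornerXn; ring.
  have h1 : X * `|(- X) ^+ M * (F X * (G n).[- X] - (T n).[- X])| <= C * X ^+ n.
    rewrite normrM normrX normrN (gtr0_norm X0) mulrA -exprS -addnS exprD.
    have := hC X X1; rewrite K0 mul0r subr0 => h.
    by rewrite -mulrA [leLHS]mulrC ler_pM2r.
  have h2 : X * `|((- X) ^+ M * F X - SM.[- X]) * (G n).[- X]| <= s M.+1 * A * X ^+ n.
    rewrite normrM mulrA -(mulrA (s M.+1)).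
    have hG := horner_bound (size_spoly_spolyE y m n).1 X1.
    apply: ler_pM => //; first by rewrite mulr_ge0// ltW.
    have := F_expansion M X0; rewrite ler_pdivlMr//.
    by rewrite mulrC.
  rewrite [leRHS]mulrDl [leRHS]addrC.
  apply: le_trans (ler_wpM2l (ltW X0) (ler_normB _ _)) _.
  by rewrite mulrDr lerD.
have coefQ k : (k <= n)%N -> L ('X^k * G n) = ('X^M * T n)`_(M - k).
  move=> kn; have kM : (n <= M - k)%N by rewrite /M -addnBA// leq_addr.
  have : Q`_(M - k) = 0 by apply/leq_sizeP: kM.
  rewrite /Q coefB => /eqP; rewrite subr_eq0 => /eqP <-.
  rewrite momfunXnM (@momfunE _ _ (M - k).+1); last first.
    by apply: leq_trans (size_spoly_spolyE y m n).1 _; rewrite ltnS.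
  rewrite coefMr; apply: eq_bigr => i _.
  rewrite /SM coef_poly mulrC; have iMk : (i <= M - k)%N by rewrite -ltnS.
  rewrite ltnS (leq_trans (leq_subr _ _) (leq_subr _ _)).
  congr (s _ * _); rewrite subnA ?leq_subr//; last first.
  by rewrite subKn// (leq_trans kn)// leq_addr.
split=> [|k /andP[k1 kn]].
  have := coefQ 0%N (leq0n _); rewrite expr0 mul1r subn0 => ->.
  by rewrite coefXnM ltnn subnn -horner_coef0 spolyT_at0.
rewrite coefQ// coefXnM ifT// ltn_subrL k1/=.
by rewrite (leq_trans k1)// (leq_trans kn)// leq_addr.
Qed.

End StringOrthogonality.

Section StringExtremal.
Context {R : realType}.
Variables (y m : nat -> R).
Hypothesis yS : forall k, y k.+1 < y k.
Variables (s : nat -> R).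
Local Notation L := (momfun s).
Local Notation G := (spoly y m).
Local Notation E := (spolyE y m).
Hypothesis L_sqr_ge0 : forall p : {poly R}, 0 <= L (p ^+ 2).
Hypothesis L_G : forall n, L (G n) = y n.
Hypothesis L_orth : forall n k, (1 <= k <= n)%N -> L ('X^k * G n) = 0.
Implicit Types (p q r : {poly R}) (n : nat).

Lemma spoly_orth n r : (size r <= n)%N -> L (G n * ('X * r)) = 0.
Proof.
move=> rn; rewrite -[r]coefK poly_def mulr_sumr mulr_sumr raddf_sum big1//= => i _.
rewrite -scalerAr -scalerAr linearZ/= [G n * _]mulrC -exprS L_orth ?mulr0//.
by rewrite (leq_trans (ltn_ord i)).
Qed.

Lemma poly_at0 p n : (size p <= n.+1)%N ->
  exists2 r : {poly R}, (size r <= n)%N & p = (p.[0])%:P + 'X * r.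
Proof.
move=> pn; exists (\poly_(i < n) p`_i.+1); first exact: size_poly.
apply/polyP => -[|i]; rewrite coefD coefC coefXM/= ?addr0 ?add0r ?horner_coef0//.
rewrite coef_poly; case: ltnP => // h; rewrite nth_default//.
exact: leq_trans pn _.
Qed.

(** A reproducing property at 0: in p = p(0) + X r the polynomial r has degree below n, so the
    second term is orthogonal to G_n. *)
Lemma spoly_pair n p : (size p <= n.+1)%N -> L (G n * p) = p.[0] * y n.
Proof.
move=> /poly_at0[r rn {1}->]; rewrite mulrDr linearD/= spoly_orth// addr0.
by rewrite mulrC mul_polyC linearZ/= L_G.
Qed.

Lemma spoly_sqr n : L (G n ^+ 2) = y n.
Proof.
rewrite expr2 spoly_pair; first by rewrite (spoly_at0 y m n).1 mul1r.
exact: (size_spoly_spolyE y m n).1.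
Qed.

(** Expand L ((p - G_n)^2) >= 0, in which both L (p G_n) and L (G_n^2) are equal to y_n. *)
Lemma spoly_min n p : (size p <= n.+1)%N -> p.[0] = 1 -> y n <= L (p ^+ 2).
Proof.
move=> pn p1; have h := spoly_pair pn; rewrite p1 mul1r in h.
have := L_sqr_ge0 (p - G n); rewrite sqrrB [p * G n]mulrC mulr2n opprD.
rewrite !(linearD, linearN)/= h spoly_sqr; lra.
Qed.

(** L (G_n E_(n+1)) is computed twice. Through G_(n+1), whose pairing with G_n is y_(n+1), it equals
    1; through E_(n+1) = E_n + m_n X G_n, where E_n(0) = 0, it equals m_n L (X G_n^2). *)
Lemma spoly_mass n : m n * L ('X * G n ^+ 2) = 1.
Proof.
have l0 : y n - y n.+1 != 0 by rewrite subr_eq0 gt_eqF.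
have [s1 s2] := size_spoly_spolyE y m n; have [a1 a2] := spoly_at0 y m n.
have e1 : L (G n * E n.+1) = m n * L ('X * G n ^+ 2).
  rewrite spolyES mulrDr linearD/= spoly_pair// a2 mul0r add0r -scalerAr linearZ/=.
  by congr (_ * L _); ring.
have e2 : (y n - y n.+1) * L (G n * E n.+1) = y n - y n.+1.
  have : L (G n * G n.+1) = L (G n ^+ 2) - (y n - y n.+1) * L (G n * E n.+1).
    by rewrite spolyS mulrBr -scalerAr linearB linearZ expr2.
  rewrite spoly_sqr [G n * G n.+1]mulrC (spoly_pair (n := n.+1)) ?(leq_trans s1)// a1 mul1r => e.
  by lra.
by rewrite -e1; apply: (mulfI l0); rewrite e2 mulr1.
Qed.

End StringExtremal.

(** * Laguerre polynomials from the recursion of the Gamma function *)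

Section Laguerre.
Context {R : realType}.
Implicit Types (a c : R) (p q : {poly R}) (n : nat).

(** Moments of the weight s^a exp (- s) on the half-line. Orthogonality is derived from the
    recursion of [Gamma], without returning to this weight. *)
Definition gamma_moment a (k : nat) : R := Gamma (a + 1 + k%:R).

(* [laguerre_op c p] is the derivative of [x ^ c e^(-x) p] divided by
   [x ^ (c - 1) e^(-x)], so that [laguerre] is Rodrigues' formula. *)
Definition laguerre_op c p : {poly R} := 'X * p^`() + (c%:P - 'X) * p.

Fixpoint laguerre a n : {poly R} :=
  if n is n'.+1 then - laguerre_op (a + 1) (laguerre (a + 1) n') else 1.

Lemma gamma_moment_shift a p : momfun (gamma_moment (a + 1)) p = momfun (gamma_moment a) ('X * p).
Proof.
have -> : gamma_moment (a + 1) = (fun i => gamma_moment a i.+1).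
  apply/funext => i; rewrite /gamma_moment -natr1.
  by have -> : a + 1 + 1 + i%:R = a + 1 + (i%:R + 1) by ring.
exact/esym/momfunXM.
Qed.

(** The integral of the derivative of x^(a + 1) exp (- x) p is zero; on monomials this is the
    recursion of [Gamma]. *)
Lemma momfun_parts a p : -1 < a ->
  momfun (gamma_moment a) (laguerre_op (a + 1) p) = 0.
Proof.
move=> ha.
suff mon k : momfun (gamma_moment a) (laguerre_op (a + 1) 'X^k) = 0.
  rewrite -[p]coefK poly_def /laguerre_op.
  rewrite (_ : _ + _ = \sum_(i < size p) p`_i *: laguerre_op (a + 1) 'X^i).
    by rewrite raddf_sum big1// => i _; rewrite /= linearZ/= mon mulr0.
  rewrite raddf_sum/= !mulr_sumr -big_split; apply: eq_bigr => i _ /=.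
  by rewrite /laguerre_op linearZ/= -!scalerAr scalerDr.
rewrite /laguerre_op mulrBl mul_polyC derivXn linearD linearB/= linearZ/= -exprS.
rewrite mulrnAr !momfunXn.
have -> : momfun (gamma_moment a) ('X * 'X^(k.-1) *+ k) = k%:R * gamma_moment a k.
  case: k => [|k]; first by rewrite mulr0n linear0 mul0r.
  by rewrite -exprS linearMn/= momfunXn mulr_natl.
have e : gamma_moment a k.+1 = (a + 1 + k%:R) * gamma_moment a k.
  rewrite /gamma_moment -natr1 addrA GammaS//.
  by rewrite ltr_wpDr//; lra.
by rewrite e; ring.
Qed.

Lemma laguerre_opM c p q : laguerre_op c (p * q) = q * laguerre_op c p + 'X * q^`() * p.
Proof. by rewrite /laguerre_op derivM; ring. Qed.

(** Repeated integration by parts. Each one moves a derivative onto [q] and leaves a factor X, which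
    raises [a] by 1. *)
Lemma laguerre_rodrigues a n q : -1 < a ->
  momfun (gamma_moment a) (laguerre a n * q) =
  momfun (gamma_moment (a + n%:R)) (q^`(n)).
Proof.
elim: n a q => [|n IH] a q ha; first by rewrite mul1r addr0 derivn0.
have ha1 : -1 < a + 1 by lra.
rewrite /= mulNr linearN/=.
have := momfun_parts (laguerre (a + 1) n * q) ha; rewrite laguerre_opM linearD/=.
move=> /eqP; rewrite addr_eq0 mulrC => /eqP ->; rewrite opprK -mulrA -gamma_moment_shift.
rewrite mulrC IH// -derivSn; congr (momfun (gamma_moment _) _).
by rewrite -natr1; ring.
Qed.

Lemma size_laguerre_op c p n : p \is monic -> size p = n.+1 ->
  size (laguerre_op c p) = n.+2 /\ - laguerre_op c p \is monic.
Proof.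
move=> pm sp.
have e : laguerre_op c p = - ('X * p) + ('X * p^`() + c *: p).
  by rewrite /laguerre_op -mul_polyC; ring.
have s1 : size (- ('X * p)) = n.+2.
  by rewrite size_polyN size_monicM ?monicX ?monic_neq0// size_polyX sp.
have s2 : (size ('X * p^`() + c *: p)%R < n.+2)%N.
  rewrite ltnS (leq_trans (size_polyD _ _))// geq_max.
  rewrite (leq_trans (size_scale_leq _ _)) ?sp ?andbT//.
  rewrite (leq_trans (size_polyMleq _ _))// size_polyX/=.
  have := lt_size_deriv (monic_neq0 pm); by rewrite sp.
split; first by rewrite e size_polyDl s1.
rewrite monicE lead_coefN e lead_coefDl ?s1// lead_coefN opprK.
by rewrite lead_coefM lead_coefX mul1r -monicE.
Qed.

Lemma laguerre_monic a n : laguerre a n \is monic /\ size (laguerre a n) = n.+1.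
Proof.
elim: n a => [|n IH] a; first by rewrite /= monic1 size_poly1.
have [h1 h2] := IH (a + 1).
by have [h3 h4] := size_laguerre_op (a + 1) h1 h2; rewrite /= size_polyN.
Qed.

Lemma derivn_small q n : (size q <= n)%N -> q^`(n) = 0.
Proof.
elim: n q => [|n IH] q; first by rewrite leqn0 size_poly_eq0 => /eqP ->; rewrite derivn0.
move=> qn; rewrite derivSn IH//.
have [->|q0] := eqVneq q 0; first by rewrite deriv0 size_poly0.
by rewrite -ltnS (leq_trans (lt_size_deriv q0)).
Qed.

Definition laguerre_norm a n : R := n`!%:R * Gamma (a + 1 + n%:R).

Lemma laguerre_norm_gt0 a n : -1 < a -> 0 < laguerre_norm a n.
Proof.
move=> ha; rewrite mulr_gt0 ?ltr0n ?fact_gt0// Gamma_gt0//.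
by rewrite ltr_wpDr//; lra.
Qed.

(** For j <= i, the i-th derivative of a monic polynomial of degree j is 0 or the constant i!. *)
Lemma laguerre_orth a i j : -1 < a ->
  momfun (gamma_moment a) (laguerre a i * laguerre a j) =
  if i == j then laguerre_norm a i else 0.
Proof.
move=> ha; wlog ij : i j / (j <= i)%N.
  move=> H; have [|/ltnW] := leqP j i; first exact: H.
  by move=> ij; rewrite [X in momfun _ X]mulrC (H _ _ ij) [j == i]eq_sym; case: eqP => // ->.
rewrite laguerre_rodrigues//; have [m1 s1] := laguerre_monic a j.
case: eqP => [e|/eqP ne]; last first.
  rewrite derivn_small ?linear0// s1 ltn_neqAle ij andbT eq_sym//.
rewrite e in ij *.
have -> : (laguerre a j)^`(j) = (j`!%:R)%:P.
  apply/polyP => k; rewrite coef_derivn coefC; case: k => [|k] /=.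
    rewrite addn0 ffactnn.
    have := m1; rewrite monicE /lead_coef s1/= => /eqP ->.
    by rewrite -mulr_natr mul1r.
  by rewrite nth_default ?mul0rn// s1 addnS ltnS leq_addr.
rewrite -[_%:P]mulr1 mul_polyC linearZ/= momfun1 /gamma_moment /laguerre_norm addr0.
by congr (_ * Gamma _); ring.
Qed.

End Laguerre.

(** * Laguerre asymptotics of the extremal problem *)

Section LaguerreExpansion.
Context {R : realType}.
Implicit Types (a : R) (p : {poly R}) (n : nat).

Lemma laguerre_expansion a n p : (size p <= n)%N ->
  exists c : nat -> R, p = \sum_(j < n) c j *: laguerre a j.
Proof.
elim: n p => [|n IH] p.
  by rewrite leqn0 size_poly_eq0 => /eqP ->; exists (fun=> 0); rewrite big_ord0.
move=> pn; have [mn sn] := laguerre_monic a n.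
have [|c cE] := IH (p - p`_n *: laguerre a n).
  apply/leq_sizeP => j; rewrite leq_eqVlt coefB coefZ => /predU1P[<-|nj].
    by move: mn; rewrite monicE /lead_coef sn/= => /eqP ->; rewrite mulr1 subrr.
  have -> : p`_j = 0 by rewrite nth_default// (leq_trans pn).
  by rewrite [(laguerre a n)`_j]nth_default ?mulr0 ?subr0// sn.
exists (fun j => if j == n then p`_n else c j).
rewrite big_ord_recr/= eqxx -[LHS](subrK (p`_n *: laguerre a n)) cE; congr (_ + _).
by apply: eq_bigr => i _; rewrite ltn_eqF.
Qed.

(* Cauchy-Schwarz; the left-hand side is [0^-1 = 0] when all [v j] vanish. *)
Lemma sum_sqr_ge_inv (n : nat) (c h v : nat -> R) :
  (forall j, 0 < h j) -> \sum_(j < n) c j * v j = 1 ->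
  (\sum_(j < n) v j ^+ 2 / h j)^-1 <= \sum_(j < n) c j ^+ 2 * h j.
Proof.
move=> h0 B; set W := \sum_(j < n) v j ^+ 2 / h j; set Q := \sum_(j < n) _.
have e V : \sum_(j < n) h j * (c j - V * (v j / h j)) ^+ 2 = Q - 2 * V + V ^+ 2 * W.
  rewrite -[2 * V]mulr1 -[X in _ - _ * X]B !mulr_sumr -sumrN -!big_split/=.
  by apply: eq_bigr => j _; field; rewrite gt_eqF.
have : 0 <= \sum_(j < n) h j * (c j - W^-1 * (v j / h j)) ^+ 2.
  by apply: sumr_ge0 => j _; rewrite mulr_ge0 ?sqr_ge0 ?(ltW (h0 _)).
rewrite e.
have [->|W0] := eqVneq W 0; first by rewrite invr0 expr2 !mulr0 subr0 addr0.
by rewrite expr2 -mulrA mulVf//; lra.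
Qed.

Lemma momfun_sum2 (s : nat -> R) n (c : nat -> R) (P : nat -> {poly R}) (r : {poly R}) :
  momfun s (r * (\sum_(j < n) c j *: P j) ^+ 2) =
  \sum_(i < n) \sum_(j < n) c i * c j * momfun s (r * (P i * P j)).
Proof.
rewrite expr2 mulr_suml mulr_sumr raddf_sum; apply: eq_bigr => i _ /=.
rewrite mulr_sumr mulr_sumr raddf_sum; apply: eq_bigr => j _ /=.
by rewrite -!scalerAl -!scalerAr scalerA linearZ/=; exact/esym/mulrA.
Qed.

Lemma ler_sum_sqr n (c : nat -> R) (i j : 'I_n) :
  `|c i * c j| <= \sum_(k < n) c k ^+ 2.
Proof.
have d (k : 'I_n) : c k ^+ 2 <= \sum_(k < n) c k ^+ 2.
  by rewrite (bigD1 k)//= lerDl sumr_ge0// => l _; exact: sqr_ge0.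
apply: (@le_trans _ _ ((c i ^+ 2 + c j ^+ 2) / 2)); last first.
  by have := d i; have := d j; lra.
rewrite normrM -[c i ^+ 2]real_normK ?num_real// -[c j ^+ 2]real_normK ?num_real//.
by have := sqr_ge0 (`|c i| - `|c j|); rewrite sqrrB; lra.
Qed.

Lemma sum2_bound n (c : nat -> R) (g : 'I_n -> 'I_n -> R) :
  `|\sum_(i < n) \sum_(j < n) c i * c j * g i j| <=
  (\sum_(i < n) \sum_(j < n) `|g i j|) * \sum_(k < n) c k ^+ 2.
Proof.
apply: le_trans (ler_norm_sum _ _ _) _; rewrite mulr_suml; apply: ler_sum => i _.
apply: le_trans (ler_norm_sum _ _ _) _; rewrite mulr_suml; apply: ler_sum => j _.
by rewrite normrM mulrC ler_wpM2l// ler_sum_sqr.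
Qed.

End LaguerreExpansion.

(** * Minimum under a constraint at a point that escapes to infinity *)

Section ExtremalAsymptotics.
Context {R : realType} {T : Type} (F : set_system T) {FF : ProperFilter F}.
(** The rescaled extremal problem: the moments [sg t] tend to those of the Laguerre weight, while
    the point [S t] at which the competitors equal 1 escapes to infinity. Hence there is no limiting
    problem to which the minimisers could simply converge. *)
Variables (a : R) (n : nat) (sg : T -> nat -> R) (S : T -> R) (q : T -> {poly R}).
Hypothesis a1 : -1 < a.
Hypothesis sg_cvg : forall k, sg t k @[t --> F] --> gamma_moment a k.
Hypothesis S_cvg : (S t)^-1 @[t --> F] --> 0.
Hypothesis S_neq0 : \forall t \near F, S t != 0.
Hypothesis size_q : \forall t \near F, (size (q t) <= n.+1)%N.
Hypothesis q_S : \forall t \near F, (q t).[S t] = 1.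
Hypothesis q_min : \forall t \near F, forall p : {poly R}, (size p <= n.+1)%N ->
  p.[S t] = 1 -> momfun (sg t) (q t ^+ 2) <= momfun (sg t) (p ^+ 2).

Local Notation L t := (momfun (sg t)).
Local Notation P := (laguerre a).
Local Notation h := (laguerre_norm a).

Let cvg_sumr N (f : 'I_N -> T -> R) (l : 'I_N -> R) :
  (forall i, f i t @[t --> F] --> l i) ->
  \sum_(i < N) f i t @[t --> F] --> \sum_(i < N) l i.
Proof. by move=> fl; apply: cvg_big => // x; exact: add_continuous. Qed.

Let cvg_exprn k (f : T -> R) (l : R) : f t @[t --> F] --> l -> f t ^+ k @[t --> F] --> l ^+ k.
Proof.
move=> fl; elim: k => [|k IH]; first by rewrite expr0; exact: cvg_cst.
by under eq_fun do rewrite exprS; rewrite exprS; exact: cvgM fl IH.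
Qed.

Let cvg_momfun p : L t p @[t --> F] --> momfun (gamma_moment a) p.
Proof. by apply: cvg_sumr => i; apply: cvgM; [exact: cvg_cst|exact: sg_cvg]. Qed.

Let cvg_horner (p : {poly R}) : (size p <= n.+1)%N ->
  p.[S t] * (S t)^-1 ^+ n @[t --> F] --> p`_n.
Proof.
move=> pn; have : \sum_(i < n.+1) p`_i * (S t)^-1 ^+ (n - i) @[t --> F] -->
    \sum_(i < n.+1) p`_i * 0 ^+ (n - i).
  apply: cvg_sumr => i; apply: cvgM; first exact: cvg_cst.
  exact: cvg_exprn S_cvg.
have -> : \sum_(i < n.+1) p`_i * 0 ^+ (n - i) = p`_n.
  rewrite big_ord_recr/= subnn expr0 mulr1 big1 ?add0r// => i _.
  by rewrite expr0n subn_eq0 leqNgt ltn_ord mulr0.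
apply: (cvg_near_trans FF (erefl _)); near=> t.
have S0 : S t != 0 by near: t.
rewrite (horner_coef_wide _ pn) mulr_suml; apply: eq_bigr => i _.
have -> : (S t)^-1 ^+ n = (S t)^-1 ^+ i * (S t)^-1 ^+ (n - i).
  by rewrite -exprD subnKC// -ltnS.
by rewrite -mulrA; congr (_ * _); rewrite mulrA -exprMn divff// expr1n mul1r.
Unshelve. all: by end_near. Qed.

(** [e t] measures the failure of the Laguerre polynomials to be orthogonal for [sg t], and [A t]
    bounds the form of X p^2. The reciprocal of [W t] is the minimum for the limiting weight, a
    Christoffel function at [S t]. *)
Let e t : R := \sum_(i < n.+1) \sum_(j < n.+1) `|L t (P i * P j) - (if (i : nat) == j then h i else 0)|.
Let A t : R := \sum_(i < n.+1) \sum_(j < n.+1) `|L t ('X * (P i * P j))|.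
Let K := \sum_(j < n.+1) (h j)^-1.
Let W t := \sum_(j < n.+1) (P j).[S t] ^+ 2 / h j.

Let h0 j : 0 < h j. Proof. exact: laguerre_norm_gt0. Qed.

Let e_cvg : e t @[t --> F] --> 0.
Proof.
have -> : 0 = \sum_(i < n.+1) \sum_(j < n.+1) `|(0 : R)|.
  by rewrite big1// => i _; rewrite big1// => j _; rewrite normr0.
apply: cvg_sumr => i; apply: cvg_sumr => j; apply: cvg_norm.
have : L t (P i * P j) - (if (i : nat) == j then h i else 0) @[t --> F] -->
    momfun (gamma_moment a) (P i * P j) - (if (i : nat) == j then h i else 0).
  by apply: cvgB; [exact: cvg_momfun|exact: cvg_cst].
by rewrite (laguerre_orth _ _ a1) subrr.
Qed.

Let A_bounded : exists M : R, \forall t \near F, A t <= M.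
Proof.
have : A t @[t --> F] --> \sum_(i < n.+1) \sum_(j < n.+1)
    `|momfun (gamma_moment a) ('X * (P i * P j))|.
  by apply: cvg_sumr => i; apply: cvg_sumr => j; apply: cvg_norm; exact: cvg_momfun.
set M := \sum_(i < _) _ => AM; exists (M + 1).
have M1 : M < M + 1 by rewrite ltrDl.
by apply: filterS (cvgr_lt _ AM _ M1) => t /ltW.
Qed.

Let sqr_le (c : nat -> R) :
  \sum_(j < n.+1) c j ^+ 2 <= K * \sum_(j < n.+1) c j ^+ 2 * h j.
Proof.
rewrite [leRHS]mulrC mulr_sumr; apply: ler_sum => j _.
rewrite ler_pdivlMr// (bigD1 j)//= lerDl; apply: sumr_ge0 => k _.
by rewrite mulr_ge0 ?sqr_ge0// ltW.
Qed.

(** In the Laguerre basis the form of [sg t] is a perturbation of a diagonal one. The error is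
    relative to the form itself, as it must be since the minimum may tend to 0. *)
Let quadratic t (c : nat -> R) : let Q := \sum_(j < n.+1) c j ^+ 2 * h j in
  is_true (`|L t ((\sum_(j < n.+1) c j *: P j) ^+ 2) - Q| <= e t * K * Q).
Proof.
move=> Q; rewrite -[(\sum_(j < n.+1) _) ^+ 2]mul1r momfun_sum2.
have Qe : Q = \sum_(i < n.+1) \sum_(j < n.+1) c i * c j * (if (i : nat) == j then h i else 0).
  apply: eq_bigr => i _; rewrite (bigD1 i)//= eqxx big1 ?addr0// => j ji.
  by rewrite (inj_eq val_inj) eq_sym (negbTE ji) mulr0.
rewrite {1}Qe -sumrB.
under eq_bigr => i _ do (rewrite -sumrB; under eq_bigr => j _ do rewrite mul1r -mulrBr).
apply: le_trans (sum2_bound _ _) _; rewrite -mulrA ler_wpM2l ?sqr_le//.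
by apply: sumr_ge0 => i _; apply: sumr_ge0.
Qed.

Let Q_lower t (c : nat -> R) : (\sum_(j < n.+1) c j *: P j).[S t] = 1 ->
  (W t)^-1 <= \sum_(j < n.+1) c j ^+ 2 * h j.
Proof.
move=> c1; apply: (sum_sqr_ge_inv (v := fun j => (P j).[S t])) => //.
by rewrite -c1 horner_sum; apply: eq_bigr => j _; rewrite hornerZ.
Qed.

Let eK_lt : \forall t \near F, e t * K <= 2^-1.
Proof.
have eK : e t * K @[t --> F] --> 0.
  by rewrite -[0](mul0r K); apply: cvgM; [exact: e_cvg|exact: cvg_cst].
have h2 : (0 : R) < 2^-1 by rewrite invr_gt0.
by apply: filterS (cvgr_lt _ eK _ h2) => t /ltW.
Qed.

(** Once [e t * K <= 1/2], the diagonal form is at most twice L (q^2). It also controls the form of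
    X q^2, because the dimension is finite and [A t] bounded. *)
Lemma extremal_moment_bound : exists B, \forall t \near F,
  `|L t ('X * q t ^+ 2)| <= B * L t (q t ^+ 2).
Proof.
have [M AM] := A_bounded; exists (2 * M * K); near=> t.
have sq : (size (q t) <= n.+1)%N by near: t.
have [c cE] := laguerre_expansion a sq.
have AMt : A t <= M by near: t.
have eKt : e t * K <= 2^-1 by near: t.
have := quadratic t c; rewrite /= -cE; set Q := \sum_(j < _) _ => Qt.
have Q0 : 0 <= Q by apply: sumr_ge0 => j _; rewrite mulr_ge0 ?sqr_ge0// ltW.
have A0 : 0 <= A t by apply: sumr_ge0 => i _; apply: sumr_ge0.
have K0 : 0 <= K by apply: sumr_ge0 => i _; rewrite invr_ge0 ltW.
have Q2 : Q <= 2 * L t (q t ^+ 2).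
  have := ler_wpM2r Q0 eKt; move: Qt; rewrite ler_norml => /andP[]; lra.
rewrite [in leLHS]cE momfun_sum2; apply: le_trans (sum2_bound _ _) _.
apply: (@le_trans _ _ (M * (K * Q))).
  by apply: ler_pM => //; apply: sumr_ge0 => j _; exact: sqr_ge0.
rewrite [2 * M]mulrC -!mulrA ler_wpM2l ?(le_trans A0)//.
by rewrite mulrCA ler_wpM2l.
Unshelve. all: by end_near. Qed.

(** A squeeze between (1 - e K) / W, from Cauchy-Schwarz, and the value at the competitor P_n /
    P_n(S). As P_j(S) S^(- n) tends to the coefficient of X^n in P_j, only j = n survives in W, and
    both bounds behave like h_n S^(- 2 n). *)
Lemma extremal_moment_cvg : L t (q t ^+ 2) * S t ^+ n ^+ 2 @[t --> F] --> h n.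
Proof.
have [mn sn] := laguerre_monic a n.
have Pn j : (j <= n)%N -> (size (P j) <= n.+1)%N by rewrite (laguerre_monic a j).2.
have Pcoef j : (j <= n)%N -> (P j)`_n = (j == n)%:R.
  rewrite leq_eqVlt => /predU1P[->|jn]; rewrite ?eqxx.
    by move: mn; rewrite monicE /lead_coef sn/= => /eqP.
  by rewrite ltn_eqF// nth_default// (laguerre_monic a j).2.
pose Wn t := \sum_(j < n.+1) ((P j).[S t] * (S t)^-1 ^+ n) ^+ 2 / h j.
have Wn_cvg : Wn t @[t --> F] --> (h n)^-1.
  have -> : (h n)^-1 = \sum_(j < n.+1) ((j : nat) == n)%:R ^+ 2 / h j.
    rewrite big_ord_recr/= eqxx expr1n mul1r big1 ?add0r// => i _.
    by rewrite ltn_eqF// expr0n mul0r.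
  apply: cvg_sumr => j; apply: cvgM; last exact: cvg_cst.
  have jn : (j <= n)%N by rewrite -ltnS.
  rewrite -Pcoef//; apply: cvg_exprn; exact: cvg_horner (Pn _ jn).
have low : (1 - e t * K) * (Wn t)^-1 @[t --> F] --> h n.
  suff : (1 - e t * K) * (Wn t)^-1 @[t --> F] --> (1 - 0 * K) * (h n)^-1^-1.
    by rewrite mul0r subr0 invrK mul1r.
  apply: cvgM; first by apply: cvgB; [exact: cvg_cst|apply: cvgM; [exact: e_cvg|exact: cvg_cst]].
  by apply: cvgV; [rewrite invr_eq0 gt_eqF|exact: Wn_cvg].
pose v t := (P n).[S t] * (S t)^-1 ^+ n.
have v_cvg : v t @[t --> F] --> (1 : R).
  by have := cvg_horner (Pn _ (leqnn n)); rewrite Pcoef// eqxx.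
have up : L t (P n ^+ 2) * (v t)^-1 ^+ 2 @[t --> F] --> h n.
  suff : L t (P n ^+ 2) * (v t)^-1 ^+ 2 @[t --> F] --> (h n * (1 : R)^-1 ^+ 2 : R).
    by rewrite invr1 expr1n mulr1.
  apply: cvgM; first by have := laguerre_orth n n a1; rewrite eqxx => <-; exact: cvg_momfun.
  by apply: cvg_exprn; apply: cvgV; [exact: oner_neq0|exact: v_cvg].
apply: squeeze_cvgr low up; near=> t.
have S0 : S t != 0 by near: t.
have Sn : S t ^+ n != 0 by rewrite expf_neq0.
have v0 : 0 < v t.
  near: t; apply: filterS (cvgr_gt _ v_cvg _ ltr01) => ? //.
have Pn0 : (P n).[S t] != 0.
  by apply: contraTneq v0 => z; rewrite /v z mul0r ltxx.
have sq : (size (q t) <= n.+1)%N by near: t.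
have eKt : e t * K <= 2^-1 by near: t.
apply/andP; split.
  have [c cE] := laguerre_expansion a sq.
  have q1 : (q t).[S t] = 1 by near: t.
  have := quadratic t c; rewrite /= -cE; set Q := \sum_(j < _) _ => Qt.
  have QW : (W t)^-1 <= Q by apply: Q_lower; rewrite -cE.
  have -> : (Wn t)^-1 = (W t)^-1 * S t ^+ n ^+ 2.
    rewrite -[S t ^+ n ^+ 2]invrK -invfM; congr (_^-1).
    rewrite /Wn /W mulr_suml; apply: eq_bigr => j _.
    by rewrite exprMn mulrAC exprVn [in LHS]exprVn.
  rewrite mulrA ler_wpM2r ?sqr_ge0//.
  have eK1 : 0 <= 1 - e t * K by lra.
  have := ler_wpM2l eK1 QW; move: Qt; rewrite ler_norml => /andP[]; lra.
have -> : L t (P n ^+ 2) * (v t)^-1 ^+ 2 =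
    L t (((P n).[S t]^-1 *: P n) ^+ 2) * S t ^+ n ^+ 2.
  rewrite exprZn linearZ/= /v [(S t)^-1 ^+ n]exprVn invfM invrK exprMn mulrA.
  by rewrite [L t _ * _]mulrC.
rewrite ler_wpM2r ?sqr_ge0//.
suff : forall p : {poly R}, (size p <= n.+1)%N ->
    p.[S t] = 1 -> L t (q t ^+ 2) <= L t (p ^+ 2).
  apply; first by rewrite (leq_trans (size_scale_leq _ _)) ?sn.
  by rewrite hornerZ mulVf.
by near: t.
Unshelve. all: by end_near. Qed.

End ExtremalAsymptotics.

(** * Watson's lemma and the moments of the Jacobi measures *)

Section Watson.
Context {R : realType}.
Local Notation leb := (@lebesgue_measure R).
Variables (s q kappa : R) (g : R -> R).
Hypothesis s0 : 0 < s.
Hypothesis kappa0 : 0 < kappa.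
Hypothesis mg : measurable_fun [set: R] g.
Hypothesis g_ge : forall x, 0 < x < 1 -> kappa <= g x.
Hypothesis g_cvg : g x @[x --> (0 : R)] --> (1 : R).

Let base (x : R) : R := x `^ (s - 1) * (1 - x) `^ q.
Hypothesis fin : (\int[leb]_x (\1_`]0%R, 1%R[ x * base x)%:E < +oo)%E.

Let wt X (x : R) : R := base x * expR (- (X * g x * x)).

Let measurable_ind (a b : R) (c d : bool) :
  measurable_fun [set: R] (\1_[set` Interval (BSide c a) (BSide d b)] : R -> R).
Proof. exact: measurable_indic. Qed.

Let measurable_base : measurable_fun [set: R] base.
Proof.
apply: measurable_funM; first exact: measurable_powR.
by apply: (measurableT_comp (measurable_powR q)); exact: measurable_funB.
Qed.

Let measurable_wt X : measurable_fun [set: R] (wt X).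
Proof.
apply: measurable_funM => //; apply: (measurableT_comp (@measurable_expR R)).
by apply/measurable_funN; apply: measurable_funM => //; exact: measurable_funM.
Qed.

Let base_ge0 x : 0 <= base x.
Proof. by rewrite mulr_ge0 ?powR_ge0. Qed.

Let wt_ge0 X x : 0 <= wt X x.
Proof. by rewrite mulr_ge0 ?expR_ge0. Qed.

Let ind_ge0 (A : set R) x : 0 <= \1_A x :> R.
Proof. by rewrite indicE. Qed.

Lemma scaled_gamma_lty : (\int[leb]_x
  (\1_`]0%R, +oo[ x * (x `^ (s - 1) * expR (- (kappa * x))))%:E < +oo)%E.
Proof.
have mI : measurable_fun [set: R] (\1_`]0%R, +oo[ : R -> R) by exact: measurable_indic.
pose f x := (\1_`]0%R, +oo[ x * (x `^ (s - 1) * expR (- x)))%:E.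
have mf : measurable_fun [set: R] f.
  by apply/measurable_EFinP/measurable_funM => //; exact: measurable_gamma_integrandN.
have f0 x : (0 <= f x)%E by rewrite lee_fin mulr_ge0// mulr_ge0 ?powR_ge0 ?expR_ge0.
have := ge0_integral_affine 0 (lt0r_neq0 kappa0) mf f0.
have -> : (\int[leb]_x f x = gammaE s)%E.
  rewrite /gammaE [RHS]integral_mkcond; apply: eq_integral => x _.
  by rewrite patchE /f indicE; case: ifP => _; rewrite ?mul1r ?mul0r.
have -> : (\int[leb]_x f (0 + kappa * x)%R =
    (kappa `^ (s - 1))%:E * \int[leb]_x
  (\1_`]0%R, +oo[ x * (x `^ (s - 1) * expR (- (kappa * x))))%:E)%E.
  rewrite -ge0_integralZl_EFin//; last 3 first.
  - by move=> x _; rewrite lee_fin mulr_ge0// mulr_ge0 ?powR_ge0 ?expR_ge0.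
  - apply/measurable_EFinP/measurable_funM => //.
    by under eq_fun do rewrite -mulNr; exact: measurable_gamma_integrand.
  - exact: powR_ge0.
  apply: eq_integral => x _; rewrite /f add0r -EFinM !indicE !mem_setE !in_itv/= !andbT.
  rewrite pmulr_rgt0//; case: ltP => x0; rewrite ?mul0r ?mulr0// !mul1r.
  by rewrite powRM ?(ltW x0) ?(ltW kappa0)// mulrA.
rewrite gtr0_norm// muleA => h; rewrite ltey; apply: contraTneq (gammaE_lty s0) => hy.
by rewrite h hy gt0_muley ?ltxx// mule_gt0// lte_fin// powR_gt0.
Qed.

(** The integral is cut at 1/2. [W] contains the endpoint 0 and produces the limit, [V] contains the
    endpoint 1 and is exponentially small. [H] is [W] after the substitution of x / X for x,
    normalised by X^s. *)
Let W X x : R := \1_`]0%R, 2^-1[ x * wt X x.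
Let V X x : R := \1_`[2^-1, 1%R[ x * wt X x.
Let H X x : R := X `^ s * (X^-1 * W X (X^-1 * x)).

Let measurable_W X : measurable_fun [set: R] (W X).
Proof. exact: measurable_funM. Qed.

Let measurable_H X : measurable_fun [set: R] (H X).
Proof.
apply: measurable_funM => //; apply: measurable_funM => //.
by apply: (measurableT_comp (measurable_W X)); exact: measurable_funM.
Qed.

Let W_ge0 X x : 0 <= W X x. Proof. exact: mulr_ge0. Qed.

Let H_ge0 X x : 0 < X -> 0 <= H X x.
Proof. by move=> X0; rewrite mulr_ge0 ?powR_ge0// mulr_ge0// invr_ge0 ltW. Qed.

Let HE X x : 0 < X -> 0 < x -> H X x = \1_`]0%R, 2^-1[ (X^-1 * x) *
  (x `^ (s - 1) * (1 - X^-1 * x) `^ q * expR (- (g (X^-1 * x) * x))).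
Proof.
move=> X0 x0; rewrite /H /W /wt /base powRM ?invr_ge0 ?(ltW X0) ?(ltW x0)//.
have e : X `^ s * X^-1 * X^-1 `^ (s - 1) = 1.
  have -> : X `^ s = X * X `^ (s - 1).
    by rewrite -{2}(powRr1 (ltW X0)) -powRD ?(gt_eqF X0) ?implybT// addrC subrK.
  rewrite [X * _]mulrC mulfK ?(gt_eqF X0)// -powRM ?invr_ge0 ?(ltW X0)//.
  by rewrite divff ?(gt_eqF X0)// powR1.
have -> : X * g (X^-1 * x) * (X^-1 * x) = g (X^-1 * x) * x.
  by field; rewrite gt_eqF.
by rewrite -[RHS]mul1r -[X in _ = X * _]e; ring.
Qed.

Let HE0 X x : 0 < X -> x <= 0 -> H X x = 0.
Proof.
move=> X0 x0; rewrite /H /W indicE mem_setE in_itv/= pmulr_rgt0 ?invr_gt0//.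
by rewrite ltNge x0/= mul0r !mulr0.
Qed.

(** For q < 0 the bound comes from 1 - x >= 1/2, hence the exponent |q|. *)
Let pow_bound (x : R) : 0 < x < 2^-1 -> (1 - x) `^ q <= 2 `^ `|q|.
Proof.
move=> /andP[x0 x1]; have [q0|q0] := leP 0 q.
  rewrite ger0_norm//; apply: ge0_ler_powR => //; rewrite ?nnegrE; lra.
rewrite ltr0_norm// -[q in leLHS]opprK powRN -[leLHS]invrK invrK -powR_inv1 ?powR_ge0//.
rewrite -powRrM mulrC powRrM powR_inv1; last by lra.
apply: ge0_ler_powR; rewrite ?nnegrE ?invr_ge0; [lra|lra|lra|].
by rewrite invf_ple ?posrE; lra.
Qed.

Let dom x : R := 2 `^ `|q| * (\1_`]0%R, +oo[ x * (x `^ (s - 1) * expR (- (kappa * x)))).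

Let H_dom X x : 0 < X -> `|H X x| <= dom x.
Proof.
move=> X0; rewrite ger0_norm ?H_ge0//; have [x0|x0] := leP x 0.
  by rewrite HE0// /dom mulr_ge0 ?powR_ge0// mulr_ge0// mulr_ge0 ?powR_ge0 ?expR_ge0.
rewrite HE// /dom [in leRHS]indicE mem_setE in_itv/= x0/= mul1r.
have r0 : 0 <= 2 `^ `|q| * (x `^ (s - 1) * expR (- (kappa * x))).
  by rewrite mulr_ge0 ?powR_ge0// mulr_ge0 ?powR_ge0 ?expR_ge0.
rewrite indicE mem_setE in_itv/=; case: (boolP (_ && _)) => h; rewrite ?mul0r// mul1r.
rewrite [x `^ _ * _]mulrC -mulrA; apply: ler_pM; rewrite ?powR_ge0//.
- by rewrite mulr_ge0 ?powR_ge0 ?expR_ge0.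
- exact: pow_bound.
rewrite ler_wpM2l ?powR_ge0// ler_expR lerN2 ler_wpM2r ?(ltW x0)//.
apply: g_ge; case/andP: h => -> h; lra.
Qed.

Let W_cvg (X : R ^nat) : (forall n, 0 < X n) -> X n @[n --> \oo] --> +oo ->
  ((X n `^ s)%:E * \int[leb]_x (W (X n) x)%:E)%E @[n --> \oo] --> gammaE s.
Proof.
move=> X0 Xoo.
have e n : ((X n `^ s)%:E * \int[leb]_x (W (X n) x)%:E = \int[leb]_x (H (X n) x)%:E)%E.
  have mW : measurable_fun [set: R] (EFin \o W (X n)) by exact/measurable_EFinP.
  have Xi : (X n)^-1 != 0 by rewrite invr_eq0 gt_eqF.
  rewrite (ge0_integral_affine 0 Xi mW)/=; last by move=> x; rewrite lee_fin.
  rewrite gtr0_norm ?invr_gt0// muleA -EFinM -ge0_integralZl_EFin//.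
  - by apply: eq_integral => x _; rewrite -EFinM /H add0r -!mulrA.
  - by move=> x _; rewrite lee_fin.
  - apply/measurable_EFinP; apply: (measurableT_comp (measurable_W _)).
    by apply: measurable_funD => //; exact: measurable_funM.
  - by rewrite mulr_ge0 ?powR_ge0// invr_ge0 ltW.
under eq_cvg do rewrite e.
have -> : gammaE s = (\int[leb]_x (\1_`]0%R, +oo[ x * (x `^ (s - 1) * expR (- x)))%:E)%E.
  rewrite /gammaE [LHS]integral_mkcond; apply: eq_integral => x _.
  by rewrite patchE indicE; case: ifP => _; rewrite ?mul1r ?mul0r.
apply: (@dominated_cvg _ _ R leb setT measurableT _ _ (EFin \o dom)) => //.
- by move=> n; apply/measurable_EFinP; exact: measurable_H.
- move=> x _; apply: cvg_EFin; first by apply: nearW.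
  have [x0|x0] := leP x 0.
    under eq_cvg do rewrite /= HE0//.
    rewrite indicE mem_setE in_itv/= andbT ltNge x0/= mul0r; exact: cvg_cst.
  rewrite indicE mem_setE in_itv/= x0/= mul1r.
  have Xi : (X n)^-1 * x @[n --> \oo] --> (0 : R).
    rewrite -(mul0r x); apply: cvgM; last exact: cvg_cst.
    by apply/gtr0_cvgV0 => //; apply: nearW.
  have : x `^ (s - 1) * (1 - (X n)^-1 * x) `^ q * expR (- (g ((X n)^-1 * x) * x))
      @[n --> \oo] --> x `^ (s - 1) * (1 - 0) `^ q * expR (- (1 * x)).
    apply: cvgM.
      apply: cvgM; first exact: cvg_cst.
      apply: (cvg_comp (fun n => 1 - (X n)^-1 * x) (fun z => z `^ q)).
        by apply: cvgB; [exact: cvg_cst|exact: Xi].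
      by rewrite subr0; exact: continuous_powR_pos.
    apply: (cvg_comp (fun n => - (g ((X n)^-1 * x) * x)) expR); last exact: continuous_expR.
    apply: cvgN; apply: cvgM; last exact: cvg_cst.
    exact: (cvg_comp (fun n => (X n)^-1 * x) g Xi g_cvg).
  rewrite subr0 powR1 mulr1 mul1r; apply: cvg_trans; apply: near_eq_cvg.
  near=> n; rewrite /= HE// indicE mem_setE in_itv/= mulr_gt0 ?invr_gt0//=.
  suff -> : (X n)^-1 * x < 2^-1 by rewrite mul1r.
  near: n; apply: (cvgr_lt _ Xi); by rewrite invr_gt0.
- apply/integrableP; split.
    apply/measurable_EFinP; apply: measurable_funM => //; apply: measurable_funM.
      exact: measurable_indic.
    by under eq_fun do rewrite -mulNr; exact: measurable_gamma_integrand.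
  have d0 x : 0 <= dom x.
    by rewrite mulr_ge0 ?powR_ge0// mulr_ge0// mulr_ge0 ?powR_ge0 ?expR_ge0.
  under eq_integral do rewrite /= ger0_norm//.
  under eq_integral do rewrite EFinM.
  rewrite ge0_integralZl_EFin ?powR_ge0//; last 2 first.
  - by move=> x _; rewrite lee_fin mulr_ge0// mulr_ge0 ?powR_ge0 ?expR_ge0.
  - apply/measurable_EFinP/measurable_funM; first exact: measurable_indic.
    by under eq_fun do rewrite -mulNr; exact: measurable_gamma_integrand.
  by rewrite lte_mul_pinfty ?lee_fin ?powR_ge0// scaled_gamma_lty.
- by move=> n x _; rewrite /= lee_fin H_dom.
Unshelve. all: by end_near. Qed.

Let half_split X x : (\1_`]0%R, 1%R[ x * wt X x)%:E = ((W X x)%:E + (V X x)%:E)%E.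
Proof.
rewrite -EFinD /W /V -mulrDl; congr (_ * _)%:E.
rewrite !indicE !mem_setE !in_itv/=.
have [h|h] := ltP x 2^-1; rewrite ?andbF ?andbT ?addr0 ?add0r.
  by rewrite (_ : x < 1) ?andbT//; apply: lt_trans h _; rewrite invf_lt1// ltr1n.
by rewrite (_ : 0 < x)//; apply: lt_le_trans h.
Qed.

Let powR_expR_cvg : X `^ s * expR (- (X * kappa * 2^-1)) @[X --> +oo] --> (0 : R).
Proof.
have [C C0 hC] := powR_le_expR (s + 1).
have k2 : 0 < kappa / 2 by rewrite divr_gt0.
apply: (@squeeze_cvgr _ _ _ _ (cst 0) (fun X => (kappa / 2)^-1 `^ s * (C * (X * (kappa / 2))^-1))).
- near=> X; rewrite mulr_ge0 ?powR_ge0 ?expR_ge0//=.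
  rewrite -mulrA; set Y := X * (kappa / 2).
  have X0 : 0 < X by near: X; exact: nbhs_pinfty_gt.
  have Y1 : 1 <= Y.
    by rewrite -ler_pdivrMr//; near: X; exact: nbhs_pinfty_ge.
  have Y0 : 0 < Y by exact: lt_le_trans Y1.
  have -> : X `^ s = (kappa / 2)^-1 `^ s * Y `^ s.
    rewrite -powRM ?invr_ge0 ?(ltW k2) ?(ltW Y0)// /Y mulrCA mulVf ?mulr1//.
    exact: lt0r_neq0.
  rewrite -mulrA ler_wpM2l ?powR_ge0// expRN ler_pdivrMr ?expR_gt0//.
  rewrite -(ler_pM2r Y0) mulrAC mulfVK ?(lt0r_neq0 Y0)//.
  have -> : Y `^ s * Y = Y `^ (s + 1).
    by rewrite powRD ?(gt_eqF Y0) ?implybT// powRr1// ltW.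
  apply: le_trans (hC _ Y1) _; rewrite ler_pM2l// ler_expR; lra.
- exact: cvg_cst.
have Yoo : (X * (kappa / 2))^-1 @[X --> +oo] --> (0 : R).
  apply/gtr0_cvgV0.
    near=> X; rewrite mulr_gt0//; near: X; exact: nbhs_pinfty_gt.
  by apply: gt0_cvgMly => //; exact: cvg_id.
suff : (kappa / 2)^-1 `^ s * (C * (X * (kappa / 2))^-1) @[X --> +oo] -->
    (kappa / 2)^-1 `^ s * (C * 0 : R) by rewrite !mulr0.
by apply: cvgM; [exact: cvg_cst|apply: cvgM; [exact: cvg_cst|exact: Yoo]].
Unshelve. all: by end_near. Qed.

(** On [1/2, 1[ one has X g(x) x >= X kappa / 2, and the remaining factor is integrable by [fin]. *)
Let V_le X x : 0 < X ->
  V X x <= expR (- (X * kappa * 2^-1)) * (\1_`]0%R, 1%R[ x * base x).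
Proof.
move=> X0; have r0 : 0 <= expR (- (X * kappa * 2^-1)) * (\1_`]0%R, 1%R[ x * base x).
  by rewrite mulr_ge0 ?expR_ge0// mulr_ge0.
move: r0; rewrite /V !indicE !mem_setE !in_itv/=.
have [/andP[h h1]|_] := boolP (2^-1 <= x < 1) => r0; last by rewrite mul0r.
have x0 : 0 < x by apply: lt_le_trans h; rewrite invr_gt0.
rewrite x0 h1 !mul1r /wt mulrC ler_wpM2r// ler_expR lerN2 -!mulrA ler_pM2l//.
apply: ler_pM => //; first exact: ltW.
by apply: g_ge; rewrite x0.
Qed.

Let measurable_V X : measurable_fun [set: R] (V X).
Proof. exact: measurable_funM. Qed.

Let V_ge0 X x : 0 <= V X x. Proof. exact: mulr_ge0. Qed.

Let C := (\int[leb]_x (\1_`]0%R, 1%R[ x * base x)%:E)%E.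

Let C_fin : C \is a fin_num.
Proof. by rewrite ge0_fin_numE ?fin//; apply: integral_ge0 => x _; rewrite lee_fin mulr_ge0. Qed.

Let V_cvg (X : R ^nat) : (forall n, 0 < X n) -> X n @[n --> \oo] --> +oo ->
  ((X n `^ s)%:E * \int[leb]_x (V (X n) x)%:E)%E @[n --> \oo] --> 0%E.
Proof.
move=> X0 Xoo.
have h : ((X n `^ s * expR (- (X n * kappa * 2^-1)))%:E * C)%E @[n --> \oo] --> 0%E.
  rewrite -(mul0e C); apply: cvgeZr => //; apply: cvg_EFin; first exact: nearW.
  exact: (cvg_comp X (fun X => X `^ s * expR (- (X * kappa * 2^-1))) Xoo powR_expR_cvg).
apply: squeeze_cvge (cvg_cst _) h; apply: nearW => n; apply/andP; split.
  by rewrite mule_ge0 ?lee_fin ?powR_ge0// integral_ge0// => x _; rewrite lee_fin.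
rewrite EFinM -muleA lee_pmul ?lee_fin ?powR_ge0 ?lexx//.
  by rewrite integral_ge0// => x _; rewrite lee_fin.
rewrite /C -ge0_integralZl_EFin//.
- apply: ge0_le_integral => //.
  + by move=> x _; rewrite lee_fin.
  + by apply/measurable_EFinP; exact: measurable_V.
  + apply/measurable_EFinP; apply: measurable_funM => //; exact: measurable_funM.
  + by move=> x _; rewrite -EFinM lee_fin V_le.
- by move=> x _; rewrite lee_fin mulr_ge0.
- by apply/measurable_EFinP; exact: measurable_funM.
Qed.

Let integral_wt X : (\int[leb]_x (\1_`]0%R, 1%R[ x * wt X x)%:E =
  \int[leb]_x (W X x)%:E + \int[leb]_x (V X x)%:E)%E.
Proof.
under eq_integral do rewrite half_split.
rewrite ge0_integralD//.
- by move=> x _; rewrite lee_fin.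
- by apply/measurable_EFinP; exact: measurable_W.
- by move=> x _; rewrite lee_fin.
- by apply/measurable_EFinP; exact: measurable_V.
Qed.

Lemma watson : X `^ s * \int[leb]_x (\1_`]0%R, 1%R[ x *
    (x `^ (s - 1) * (1 - x) `^ q * expR (- (X * g x * x)))) @[X --> +oo] --> Gamma s.
Proof.
(* Dominated convergence is applied along sequences. Taking the maximum with 1 makes every term
   positive and changes only finitely many of them. *)
apply/cvg_pinftyP => Y Yoo; pose X n := Num.max (Y n) 1.
have X0 n : 0 < X n by rewrite lt_max ltr01 orbT.
have Xoo : X n @[n --> \oo] --> +oo.
  by apply: ger_cvgy Yoo; apply: nearW => n; rewrite le_max lexx.
have : ((X n `^ s)%:E * \int[leb]_x (\1_`]0%R, 1%R[ x * wt (X n) x)%:E)%E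
    @[n --> \oo] --> (Gamma s)%:E.
  rewrite EFin_Gamma// -[gammaE s]adde0.
  have h n : ((X n `^ s)%:E * \int[leb]_x (\1_`]0%R, 1%R[ x * wt (X n) x)%:E =
    (X n `^ s)%:E * (\int[leb]_x (W (X n) x)%:E) +
    (X n `^ s)%:E * \int[leb]_x (V (X n) x)%:E)%E.
    by rewrite integral_wt ge0_muleDr//; apply: integral_ge0 => x _; rewrite lee_fin.
  under eq_cvg do rewrite h.
  by apply: cvgeD; [rewrite fin_num_adde_defl|exact: W_cvg|exact: V_cvg].
move=> /fine_cvgP[_]; apply: cvg_trans; apply: near_eq_cvg; near=> n.
have <- : X n = Y n.
  by apply/max_idPl; near: n; exact: (cvgryPge _).1.
rewrite /= fineM//.
have I0 : (0 <= \int[leb]_x (\1_`]0%R, 1%R[ x * wt (X n) x)%:E)%E.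
  by apply: integral_ge0 => x _; rewrite lee_fin mulr_ge0.
rewrite ge0_fin_numE//; apply: le_lt_trans fin; apply: ge0_le_integral => //.
- by move=> x _; rewrite lee_fin mulr_ge0.
- by apply/measurable_EFinP; apply: measurable_funM => //; exact: measurable_wt.
- by apply/measurable_EFinP; apply: measurable_funM => //; exact: measurable_base.
move=> x _; rewrite lee_fin indicE mem_setE in_itv/=.
case: (boolP (_ && _)) => [x01|_]; last by rewrite !mul0r.
rewrite !mul1r -[leRHS]mulr1 ler_wpM2l// -[leRHS](expR0 R) ler_expR oppr_le0.
have /andP[x0 _] := x01.
by rewrite !mulr_ge0 ?(ltW x0) ?(ltW (X0 n))// (le_trans (ltW kappa0))// g_ge.
Unshelve. all: by end_near. Qed.

End Watson.

Section CarriedFinite.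
Context {R : realType} (rho : borel_measure R) (D : set R) (beta : R).
Hypothesis mD : measurable (D : set (measurableTypeR R)).
Hypothesis carried : rho (~` D) = 0%E.
Hypothesis D_beta : forall l, D l -> `|l| <= beta.

(** On the bounded set [D] the function (1 + l^2)^-1 has a positive lower bound, so the integral
    required of a spectral measure controls the mass itself. *)
Lemma carried_finite_measure :
  (\int[rho]_l ((1 + l ^+ 2)^-1)%:E < +oo)%E -> (rho setT < +oo)%E.
Proof.
move=> h; have m1 : measurable_fun [set: R] (fun l : R => (1 + l ^+ 2)^-1).
  apply: (measurableT_comp measurable_inv).
  by apply: measurable_funD => //; exact: measurable_funX.
have p1 (l : R) : 0 < 1 + l ^+ 2 by rewrite ltr_pwDl ?sqr_ge0.
have pb : 0 <= 1 + beta ^+ 2 by exact: ltW.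
have -> : (rho setT = \int[rho]_(l in D) 1)%E.
  by rewrite -integral_carried// integral_cst// mul1e.
apply: (@le_lt_trans _ _ (\int[rho]_(l in D) ((1 + beta ^+ 2) * (1 + l ^+ 2)^-1)%:E)%E).
  apply: ge0_le_integral => //.
  - by apply/measurable_EFinP; apply: measurable_funTS; exact: measurable_funM.
  - move=> l Dl; rewrite lee_fin ler_pdivlMr// mul1r lerD2l.
    rewrite -[l ^+ 2]real_normK ?num_real//.
    by rewrite lerXn2r ?nnegrE ?(le_trans _ (D_beta Dl))// D_beta.
under eq_integral do rewrite EFinM.
rewrite ge0_integralZl_EFin//; last 2 first.
- by move=> l _; rewrite lee_fin invr_ge0 ltW.
- by apply/measurable_EFinP; exact: measurable_funTS.
rewrite lte_mul_pinfty ?lee_fin//; apply: le_lt_trans h.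
by apply: ge0_subset_integral => //; [exact/measurable_EFinP|move=> l _; rewrite lee_fin invr_ge0 ltW].
Qed.

End CarriedFinite.

(** * Rescaled moments of the flow measure at either endpoint *)

Section JacobiEndpoint.
Context {R : realType}.
Local Notation leb := (@lebesgue_measure R).
(** An endpoint [c] of the support is described by the distance x from it: l = c - sigma x, with
    sigma = 1 at the right end and sigma = -1 at the left one. The weight has exponent [p] at [c]
    and [q] at the other end. *)
Variables (a b alpha p q c sigma : R).
Hypothesis alpha0 : 0 < alpha.
Hypothesis p1 : -1 < p.
Hypothesis c0 : 0 < c.
Hypothesis sigma2 : sigma * sigma = 1.
Local Notation rho := (jacobi_measure a b alpha).
Local Notation D := (`]alpha, 1 + alpha[%classic : set R).
Hypothesis D_end : forall x, D (c - sigma * x) <-> 0 < x < 1.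
Hypothesis weight_end : forall x, 0 < x < 1 ->
  jacobi_weight a b alpha (c - sigma * x) = x `^ p * (1 - x) `^ q.

Let sigma0 : - sigma != 0.
Proof. by rewrite oppr_eq0; apply: contra_eq_neq sigma2 => ->; rewrite mul0r eq_sym oner_eq0. Qed.

Let sigma1 : `|- sigma| = 1.
Proof.
rewrite normrN; apply/eqP; rewrite -sqrp_eq1//.
by rewrite -normrX expr2 sigma2 normr1.
Qed.

Let mD : measurable (D : set (measurableTypeR R)). Proof. by []. Qed.

Lemma flow_integral t (f : R -> R) : measurable_fun [set: R] f -> (forall l, 0 <= f l) ->
  (\int[flow_measure t rho]_l (f l)%:E =
   \int[leb]_l (f l * (flow_weight t l * jacobi_weight a b alpha l))%:E)%E.
Proof.
move=> mf f0.
have mf1 : measurable_fun [set: R] (EFin \o f) by exact/measurable_EFinP.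
rewrite (ge0_integral_density _ _ _ mf1)/=; last by move=> l; rewrite lee_fin.
under eq_integral do rewrite -EFinM.
have mf2 : measurable_fun [set: R] (EFin \o (fun l => f l * flow_weight t l)).
  by apply/measurable_EFinP/measurable_funM => //; exact: measurable_flow_weight.
rewrite (ge0_integral_density _ _ _ mf2)/=; last first.
  by move=> l; rewrite lee_fin mulr_ge0// flow_weight_ge0.
by apply: eq_integral => l _; rewrite -!EFinM mulrA.
Qed.

Lemma flow_integral_end t (f : R -> R) : measurable_fun [set: R] f -> (forall l, 0 <= f l) ->
  (\int[flow_measure t rho]_l (f l)%:E =
   \int[leb]_x (\1_`]0%R, 1%R[ x * (f (c - sigma * x) *
     (flow_weight t (c - sigma * x) * (x `^ p * (1 - x) `^ q))))%:E)%E.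
Proof.
move=> mf f0; rewrite flow_integral//.
have mf1 : measurable_fun [set: R]
    (EFin \o (fun l => f l * (flow_weight t l * jacobi_weight a b alpha l))).
  apply/measurable_EFinP/measurable_funM => //; apply: measurable_funM.
    exact: measurable_flow_weight.
  exact: measurable_jacobi_weight.
rewrite (ge0_integral_affine c sigma0 mf1)/=; last first.
  by move=> l; rewrite lee_fin mulr_ge0// mulr_ge0// ?flow_weight_ge0// jacobi_weight_ge0.
rewrite sigma1 mul1e; apply: eq_integral => x _; rewrite mulNr indicE mem_setE in_itv/=.
have [x01|x01] := boolP (0 < x < 1); first by rewrite weight_end// mul1r.
rewrite mul0r /jacobi_weight patchE memNset ?mulr0//.
by move=> /D_end; apply/negP.
Qed.

Lemma flow_carried t : flow_measure t rho (~` D) = 0%E.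
Proof.
have mC : measurable (~` D : set (measurableTypeR R)) by exact: measurableC.
have <- : (\int[flow_measure t rho]_l (\1_(~` D) l)%:E = flow_measure t rho (~` D))%E.
  by rewrite integral_indic// setIT.
have mf : measurable_fun [set: R] (\1_(~` D) : R -> R) by exact: measurable_indic.
rewrite (flow_integral _ mf); last by move=> l; rewrite indicE.
rewrite integral0_eq// => l _; rewrite indicE /jacobi_weight patchE.
have [lD|lD] := boolP (l \in D); last by rewrite !mulr0.
by rewrite memNset ?mul0r// => h; apply: h; exact: set_mem.
Qed.

Section Finite.
Hypothesis fin : (\int[rho]_l ((1 + l ^+ 2)^-1)%:E < +oo)%E.

Let D_beta l : D l -> `|l| <= 1 + alpha.
Proof.
rewrite /= in_itv/= => /andP[h1 h2]; rewrite gtr0_norm ?(ltW h2)//.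
exact: lt_trans h1.
Qed.

(** Integrability up to both ends is drawn from [fin], that is from the first clause of
    [is_spectral_measure]; the additional factor x^k is at most 1. *)
Lemma beta_integral_lty k :
  (\int[leb]_x (\1_`]0%R, 1%R[ x * (x `^ (p + 1 + k%:R - 1) * (1 - x) `^ q))%:E < +oo)%E.
Proof.
have rho0 : rho (~` D) = 0%E.
  change (\int[leb]_(l in ~` D) (jacobi_weight a b alpha l)%:E = 0)%E.
  by rewrite integral0_eq// => l lD; rewrite /jacobi_weight patchE memNset.
have := carried_finite_measure mD rho0 D_beta fin.
change (rho setT) with (\int[leb]_l (jacobi_weight a b alpha l)%:E)%E.
have mf1 : measurable_fun [set: R] (EFin \o jacobi_weight a b alpha).
  by apply/measurable_EFinP; exact: measurable_jacobi_weight.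
rewrite (ge0_integral_affine c sigma0 mf1)/=; last by move=> l; rewrite lee_fin jacobi_weight_ge0.
rewrite sigma1 mul1e; apply: le_lt_trans.
have mw r : measurable_fun [set: R] (fun x => x `^ r * (1 - x) `^ q).
  apply: measurable_funM; first exact: measurable_powR.
  by apply: (measurableT_comp (measurable_powR q)); exact: measurable_funB.
apply: ge0_le_integral => //.
- by move=> x _; rewrite lee_fin mulr_ge0 ?mulr_ge0 ?powR_ge0// indicE.
- by apply/measurable_EFinP; apply: measurable_funM => //; exact: mw.
- apply/measurable_EFinP; apply: (measurableT_comp (@measurable_jacobi_weight _ a b alpha)).
  by apply: measurable_funD => //; exact: measurable_funM.
move=> x _; rewrite lee_fin mulNr indicE mem_setE in_itv/=.
have [x01|x01] := boolP (0 < x < 1); last by rewrite mul0r jacobi_weight_ge0.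
rewrite mul1r weight_end// ler_wpM2r ?powR_ge0//; have /andP[x0 x1] := x01.
rewrite (_ : p + 1 + k%:R - 1 = p + k%:R); last by ring.
rewrite powRD ?(gt_eqF x0) ?implybT// powR_mulrn ?(ltW x0)// ler_piMr ?powR_ge0//.
by rewrite exprn_ile1 ?(ltW x0) ?(ltW x1).
Qed.

Let end_pos x : 0 < x < 1 -> alpha < c - sigma * x < 1 + alpha.
Proof. by move=> /D_end; rewrite /= in_itv. Qed.

Let g x := c * (c - sigma * x)^-1.

(** [watson] applies because g >= c / (1 + alpha) on the support and g(0) = 1. *)
Lemma watson_end k : X `^ (p + 1 + k%:R) * \int[leb]_x (\1_`]0%R, 1%R[ x *
    (x `^ (p + 1 + k%:R - 1) * (1 - x) `^ q * expR (- (X * g x * x)))) @[X --> +oo]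
    --> gamma_moment p k.
Proof.
apply: (@watson _ _ _ (c / (1 + alpha))).
- by have := ler0n R k; have := p1; lra.
- by rewrite divr_gt0// addr_gt0.
- apply: measurable_funM => //; apply: (measurableT_comp measurable_inv).
  by apply: measurable_funB => //; exact: measurable_funM.
- move=> x /end_pos/andP[h1 h2]; rewrite ler_pM2l// lef_pV2 ?posrE ?(ltW h2)//.
    by rewrite addr_gt0.
  exact: lt_trans h1.
- have -> : (1 : R) = c * (c - sigma * 0)^-1 by rewrite mulr0 subr0 divff// gt_eqF.
  apply: cvgM; first exact: cvg_cst.
  apply: cvgV; first by rewrite mulr0 subr0 gt_eqF.
  apply: cvgB; first exact: cvg_cst.
  by apply: cvgM; [exact: cvg_cst|exact: cvg_id].
- exact: beta_integral_lty.
Qed.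

(* At the time [t = 2 c^2 sigma X] one has
   [- t / (2 (c - sigma x)) = - c sigma X - X g(x) x]; the first term is the
   exponential factor of [scale_end]. *)
Definition affine_end X : {poly R} := (sigma * X) *: (c%:P - 'X).
Definition scale_end X := expR (- (c * sigma * X)) * X `^ (- (p + 1)).
Local Notation flow_end X := (flow_measure (2 * c ^+ 2 * sigma * X) rho).

Lemma affine_end_horner X l : (affine_end X).[l] = X * (sigma * (c - l)).
Proof. by rewrite hornerZ hornerD hornerN hornerC hornerX; ring. Qed.

Lemma scale_end_gt0 X : 0 < X -> 0 < scale_end X.
Proof. by move=> X0; rewrite mulr_gt0 ?expR_gt0 ?powR_gt0. Qed.

Lemma scaled_moment X k : 0 < X ->
  \int[flow_end X]_(l in D) (affine_end X ^+ k).[l] / scale_end X =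
  X `^ (p + 1 + k%:R) * \int[leb]_x (\1_`]0%R, 1%R[ x *
    (x `^ (p + 1 + k%:R - 1) * (1 - x) `^ q * expR (- (X * g x * x)))).
Proof.
move=> X0; have f0 l : 0 <= \1_D l * (X * (sigma * (c - l))) ^+ k.
  rewrite indicE; have [lD|_] := boolP (l \in D); last by rewrite mul0r.
  rewrite mul1r exprn_ge0// mulr_ge0 ?(ltW X0)//.
  have : D (c - sigma * (sigma * (c - l))).
    by rewrite mulrA sigma2 mul1r subKr; exact: set_mem.
  by move=> /D_end/andP[h _]; exact: ltW.
have mf : measurable_fun [set: R] (fun l => \1_D l * (X * (sigma * (c - l))) ^+ k).
  apply: measurable_funM; first exact: measurable_indic.
  apply: measurable_funX; apply: measurable_funM => //; apply: measurable_funM => //.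
  exact: measurable_funB.
rewrite /Rintegral.
have -> : (\int[flow_end X]_(l in D) ((affine_end X ^+ k).[l])%:E =
    \int[flow_end X]_l (\1_D l * (X * (sigma * (c - l))) ^+ k)%:E)%E.
  rewrite [LHS]integral_mkcond; apply: eq_integral => l _.
  rewrite patchE indicE; case: ifP => _; rewrite ?mul0r// mul1r.
  by rewrite horner_exp affine_end_horner.
rewrite flow_integral_end//.
pose A := scale_end X * X `^ (p + 1 + k%:R).
have A0 : 0 < A by rewrite mulr_gt0 ?scale_end_gt0 ?powR_gt0.
have mI : measurable_fun [set: R] (fun x : R => \1_`]0%R, 1%R[ x *
    (x `^ (p + 1 + k%:R - 1) * (1 - x) `^ q * expR (- (X * g x * x)))).
  apply: measurable_funM; first exact: measurable_indic.
  apply: measurable_funM; first apply: measurable_funM.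
  - exact: measurable_powR.
  - by apply: (measurableT_comp (measurable_powR q)); exact: measurable_funB.
  apply: (measurableT_comp (@measurable_expR R)); apply/measurable_funN.
  apply: measurable_funM => //; apply: measurable_funM => //; apply: measurable_funM => //.
  apply: (measurableT_comp measurable_inv).
  by apply: measurable_funB => //; exact: measurable_funM.
have I0 x : 0 <= \1_`]0%R, 1%R[ x *
    (x `^ (p + 1 + k%:R - 1) * (1 - x) `^ q * expR (- (X * g x * x))).
  by rewrite !mulr_ge0 ?powR_ge0 ?expR_ge0// indicE.
rewrite [X in fine X](_ : _ = A%:E * \int[leb]_x (\1_`]0%R, 1%R[ x *
    (x `^ (p + 1 + k%:R - 1) * (1 - x) `^ q * expR (- (X * g x * x))))%:E)%E; last first.
  rewrite -ge0_integralZl_EFin ?(ltW A0)//; last 2 first.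
  - by move=> x _; rewrite lee_fin.
  - by apply/measurable_EFinP; exact: mI.
  apply: eq_integral.
  move=> x _; rewrite -EFinM; congr EFin; rewrite [\1_`]0%R, _[ _]indicE mem_setE in_itv/=.
  have [x01|_] := boolP (0 < x < 1); last by rewrite !mul0r mulr0.
  have /andP[x0 x1] := x01; rewrite !mul1r indicE mem_set ?mul1r; last exact/D_end.
  have cx : c - sigma * x != 0.
    by have /andP[h _] := end_pos x01; rewrite gt_eqF// (lt_trans alpha0).
  have -> : X * (sigma * (c - (c - sigma * x))) = X * x.
    by rewrite subKr mulrA sigma2 mul1r.
  have -> : flow_weight (2 * c ^+ 2 * sigma * X) (c - sigma * x) =
      expR (- (c * sigma * X)) * expR (- (X * g x * x)).
    rewrite /flow_weight -expRD; congr expR.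
    have -> : X * g x * x = (sigma * sigma) * (X * c * x) / (c - sigma * x).
      by rewrite sigma2 mul1r /g; ring.
    by field.
  have -> : x `^ (p + 1 + k%:R - 1) = x `^ p * x ^+ k.
    rewrite (_ : p + 1 + k%:R - 1 = p + k%:R); last by ring.
    by rewrite powRD ?(gt_eqF x0) ?implybT// powR_mulrn// ltW.
  have e : X `^ (- (p + 1)) * X `^ (p + 1 + k%:R) = X ^+ k.
    by rewrite -powRD ?(gt_eqF X0) ?implybT// addrA addNr add0r powR_mulrn// ltW.
  by rewrite /A /scale_end -[_ * X `^ (- _) * _]mulrA e exprMn; ring.
(* No integrability is presupposed: if the integral is infinite, the finite parts on both sides are
   0. *)
have [hi|hi] := boolP (\int[leb]_x (\1_`]0%R, 1%R[ x *
    (x `^ (p + 1 + k%:R - 1) * (1 - x) `^ q * expR (- (X * g x * x))))%:E \is a fin_num)%E.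
  rewrite fineM// /A /=; field; exact: lt0r_neq0 (scale_end_gt0 X0).
have -> : (\int[leb]_x (\1_`]0%R, 1%R[ x *
    (x `^ (p + 1 + k%:R - 1) * (1 - x) `^ q * expR (- (X * g x * x))))%:E = +oo)%E.
  apply/eqP; rewrite -leye_eq leNgt; apply: contra hi => hi; rewrite ge0_fin_numE//.
  by apply: integral_ge0 => x _; rewrite lee_fin.
by rewrite gt0_muley ?lte_fin//= mul0r mulr0.
Qed.

Lemma scaled_moment_cvg k :
  \int[flow_end X]_(l in D) (affine_end X ^+ k).[l] / scale_end X @[X --> +oo]
  --> gamma_moment p k.
Proof.
apply: cvg_trans (@watson_end k); apply: near_eq_cvg; near=> X.
by rewrite scaled_moment//; near: X; exact: nbhs_pinfty_gt.
Unshelve. all: by end_near. Qed.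

End Finite.
End JacobiEndpoint.

(** * Asymptotics of the peakons *)

Section Extremal.
Context {R : realType}.
Variables (u : R -> R) (mu rho : borel_measure R) (x w : nat -> R).
Hypothesis hp : peakon_data u mu x w.
Hypothesis hu : phase_space u mu.
Hypothesis hrho : is_spectral_measure u mu rho.
Variables (D : set R) (alpha beta : R).
Hypothesis mD : measurable (D : set (measurableTypeR R)).
Hypothesis carried : rho (~` D) = 0%E.
Hypothesis fin : (rho setT < +oo)%E.
Hypothesis alpha0 : 0 < alpha.
Hypothesis D_alpha : forall l, D l -> alpha <= l.
Hypothesis D_beta : forall l, D l -> l <= beta.
Local Notation L := (momfun (moment rho D)).

Lemma peakon_extremal n : exists G : {poly R},
  [/\ (size G <= n.+1)%N, G.[0] = 1, L (G ^+ 2) = expR (- x n.+1),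
      forall p : {poly R}, (size p <= n.+1)%N -> p.[0] = 1 -> L (G ^+ 2) <= L (p ^+ 2) &
      w n.+1 * L ('X * G ^+ 2) = L (G ^+ 2)].
Proof.
have yS := string_posS hp; have y0 := @string_pos_gt0 _ x; have m0 := string_mass_gt0 hp.
have orth k := string_orthogonality yS y0 m0 (moment_ge0 rho alpha0 D_alpha)
  (cauchy_expansion mD fin alpha0 D_alpha D_beta)
  (pade_bound hp hu hrho mD carried fin alpha0 D_alpha) k.
have LG k := (orth k).1; have Lo k := (orth k).2.
have sq := spoly_sqr LG Lo n.
exists (spoly (string_pos x) (string_mass x w) n); split.
- exact: (size_spoly_spolyE _ _ _).1.
- exact: (spoly_at0 _ _ _).1.
- exact: sq.
- move=> p pn p1; rewrite sq.
  exact: (spoly_min (momfun_sqr_ge0 mD fin alpha0 D_alpha D_beta) LG Lo pn p1).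
(* Here m_n = w_(n+1) exp (x_(n+1)), and L (G_n^2) = y_n is the inverse of this exponential. *)
have := spoly_mass yS LG Lo n; rewrite sq /string_mass => h.
have e0 : expR (x n.+1) != 0 by rewrite gt_eqF// expR_gt0.
by apply: (mulfI e0); rewrite mulrA [expR _ * w _]mulrC h /string_pos expRN divff.
Qed.

End Extremal.

Section EndpointAsymptotics.
Context {R : realType}.
Variables (a b alpha p q c sigma : R).
Hypothesis alpha0 : 0 < alpha.
Hypothesis p1 : -1 < p.
Hypothesis c0 : 0 < c.
Hypothesis sigma2 : sigma * sigma = 1.
Local Notation rho := (jacobi_measure a b alpha).
Local Notation D := (`]alpha, 1 + alpha[%classic : set R).
Hypothesis D_end : forall x, D (c - sigma * x) <-> 0 < x < 1.
Hypothesis weight_end : forall x, 0 < x < 1 ->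
  jacobi_weight a b alpha (c - sigma * x) = x `^ p * (1 - x) `^ q.
Variables (u0 : R -> R) (mu0 : borel_measure R) (u : R -> R -> R) (mu : R -> borel_measure R).
Variables (x w : nat -> R -> R).
Hypothesis hrho : is_spectral_measure u0 mu0 rho.
Hypothesis hflow : forall t : R, is_flow t u0 mu0 (u t) (mu t).
Hypothesis hxw : forall t : R, peakon_data (u t) (mu t) (fun n => x n t) (fun n => w n t).
Variable n : nat.

Local Notation time X := (2 * c ^+ 2 * sigma * X).
Local Notation rt X := (flow_measure (time X) rho).
Local Notation L X := (momfun (moment (rt X) D)).
Local Notation aff := (affine_end c sigma).
Local Notation A := (scale_end p c sigma).

Let mD : measurable (D : set (measurableTypeR R)). Proof. by []. Qed.

Let D_alpha l : D l -> alpha <= l.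
Proof. by rewrite /= in_itv/= => /andP[/ltW]. Qed.

Let D_beta l : D l -> l <= 1 + alpha.
Proof. by rewrite /= in_itv/= => /andP[_ /ltW]. Qed.

Let finite_rt X : (rt X setT < +oo)%E.
Proof.
have [h _ _] := (hflow (time X)).2 _ hrho.
apply: (@carried_finite_measure _ _ _ (1 + alpha) mD (flow_carried _ _ _ _) _ h) => l lD.
rewrite ger0_norm; first exact: D_beta.
exact: le_trans (ltW alpha0) (D_alpha lD).
Qed.

(** The inverse of the affine change [aff X]. Composition with the two carries polynomials between
    the spectral and the rescaled variable and preserves the degree bound. *)
Let inv X : {poly R} := c%:P - (sigma * X^-1) *: 'X.

Let inv_aff X : 0 < X -> inv X \Po aff X = 'X.
Proof.
move=> X0; rewrite /inv comp_polyB comp_polyC comp_polyZ comp_polyX /affine_end scalerA.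
rewrite (_ : sigma / X * (sigma * X) = 1) ?scale1r ?subKr//.
by rewrite mulrACA sigma2 mul1r mulVf// gt_eqF.
Qed.

Let size_aff X : (size (aff X) <= 2)%N.
Proof.
rewrite (leq_trans (size_scale_leq _ _))// (leq_trans (size_polyD _ _))//.
by rewrite geq_max size_polyN size_polyX (leq_trans (size_polyC_leq1 _)).
Qed.

Let size_inv X : (size (inv X) <= 2)%N.
Proof.
rewrite (leq_trans (size_polyD _ _))// geq_max (leq_trans (size_polyC_leq1 _))//=.
by rewrite size_polyN (leq_trans (size_scale_leq _ _))// size_polyX.
Qed.

Let size_comp2 (r s : {poly R}) : (size r <= n.+1)%N -> (size s <= 2)%N ->
  (size (r \Po s)%R <= n.+1)%N.
Proof.
move=> rn s2; rewrite (leq_trans (size_comp_poly_leq _ _))// ltnS.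
rewrite -[leqRHS]muln1 leq_mul//; first by case: (size r) rn.
by case: (size s) s2 => [|[|[]]].
Qed.

(** Moments of the flow measure in the rescaled variable, normalised by [A X] so as to have a limit.
    The normalisation does not affect the minimiser. *)
Let sg X k := L X (aff X ^+ k) / A X.

Let sgE X r : momfun (sg X) r = L X (r \Po aff X) / A X.
Proof.
rewrite comp_polyE raddf_sum mulr_suml; apply: eq_bigr => i _.
by rewrite /= linearZ/= mulrA.
Qed.

Let sg_cvg k : sg X k @[X --> +oo] --> gamma_moment p k.
Proof.
have [h _ _] := hrho.
have := @scaled_moment_cvg _ _ _ _ _ _ _ _ alpha0 p1 c0 sigma2 D_end weight_end h k.
apply: cvg_trans; apply: near_eq_cvg; apply: nearW => X.
by rewrite (integral_horner mD (finite_rt X) alpha0 D_alpha D_beta).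
Qed.

Let ext X := peakon_extremal (hxw (time X)) (hflow (time X)).1
  ((hflow (time X)).2 _ hrho) mD (flow_carried _ _ _ _) (finite_rt X) alpha0 D_alpha D_beta n.

Let G X := sval (cid (ext X)).
Let Q X := G X \Po inv X.
Let S X := (aff X).[0].

Let QG X : 0 < X -> Q X \Po aff X = G X.
Proof. by move=> X0; rewrite /Q -comp_polyA inv_aff// comp_polyXr. Qed.

Let SE X : S X = sigma * (c * X).
Proof. by rewrite /S affine_end_horner subr0; ring. Qed.

Let inv_S X : 0 < X -> (inv X).[S X] = 0.
Proof. by move=> X0; rewrite /S -horner_comp inv_aff// hornerX. Qed.

Let size_Q X : (size (Q X) <= n.+1)%N.
Proof. by have [h _ _ _ _] := svalP (cid (ext X)); exact: size_comp2. Qed.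

Let Q_S X : 0 < X -> (Q X).[S X] = 1.
Proof.
move=> X0; have [_ h _ _ _] := svalP (cid (ext X)).
by rewrite /Q horner_comp inv_S.
Qed.

Let sg_Q2 X : 0 < X -> momfun (sg X) (Q X ^+ 2) = expR (- x n.+1 (time X)) / A X.
Proof.
move=> X0; have [_ _ h _ _] := svalP (cid (ext X)).
by rewrite sgE rmorphXn/= QG// h.
Qed.

Let Q_min X : 0 < X -> forall r : {poly R}, (size r <= n.+1)%N -> r.[S X] = 1 ->
  momfun (sg X) (Q X ^+ 2) <= momfun (sg X) (r ^+ 2).
Proof.
move=> X0 r rn r1; have [_ _ _ h _] := svalP (cid (ext X)).
rewrite !sgE !rmorphXn/= QG// ler_pM2r ?invr_gt0 ?scale_end_gt0//.
by apply: h; [exact: size_comp2|rewrite horner_comp].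
Qed.

Let near_gt0 : \forall X \near +oo, (0 : R) < X.
Proof. exact: nbhs_pinfty_gt. Qed.

Let S_neq0 X : 0 < X -> S X != 0.
Proof.
move=> X0; rewrite SE !mulf_neq0 ?(gt_eqF c0) ?(gt_eqF X0)//.
by apply: contra_eq_neq sigma2 => ->; rewrite mul0r eq_sym oner_eq0.
Qed.

Let Xinv_cvg : (X : R)^-1 @[X --> +oo] --> (0 : R).
Proof. by apply/gtr0_cvgV0 => //; exact: cvg_id. Qed.

Let S_cvg : (S X)^-1 @[X --> +oo] --> (0 : R).
Proof.
have : (sigma * c)^-1 * X^-1 @[X --> +oo] --> (sigma * c)^-1 * 0.
  by apply: cvgM; [exact: cvg_cst|exact: Xinv_cvg].
rewrite mulr0; apply: cvg_trans; apply: near_eq_cvg; apply: nearW => X.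
by rewrite SE mulrA [RHS]invfM.
Qed.

(** The inverse of the weight is the mean of l with respect to G^2. Writing l = c - (sigma / X) s
    with s the rescaled variable, the mean of s is bounded by [extremal_moment_bound], so that only
    c remains. *)
Lemma endpoint_weight_cvg : w n.+1 (time X) @[X --> +oo] --> c^-1.
Proof.
have [B hB] := extremal_moment_bound p1 sg_cvg (nearW _ size_Q).
have key X : 0 < X -> (w n.+1 (time X))^-1 = c - sigma * X^-1 *
    (momfun (sg X) ('X * Q X ^+ 2) / momfun (sg X) (Q X ^+ 2)).
  move=> X0; have [_ _ h1 _ h2] := svalP (cid (ext X)); rewrite -/(G X) in h1 h2.
  have A0 := scale_end_gt0 p c sigma X0.
  have LG0 : 0 < L X (G X ^+ 2) by rewrite h1 expR_gt0.
  have [_ _ hw _ _] := hxw (time X); have w0 := hw n.+1 isT.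
  rewrite !sgE rmorphM !rmorphXn/= QG// comp_polyX.
  have lin (s : nat -> R) (r : {poly R}) :
      momfun s (aff X * r) = sigma * X * (c * momfun s r - momfun s ('X * r)).
    have -> : aff X * r = (sigma * X) *: (c *: r - 'X * r).
      by rewrite /affine_end -!mul_polyC; ring.
    by rewrite linearZ/= linearB/= linearZ.
  rewrite lin.
  rewrite -h2; move: (L X ('X * _)) h2 => l h2.
  have l0 : l != 0 by apply: contraTneq LG0 => l0; rewrite -h2 l0 mulr0 ltxx.
  have -> : sigma / X * (sigma * X * (c * (w n.+1 (time X) * l) - l) / A X /
    (w n.+1 (time X) * l / A X)) = sigma * sigma * (c - (w n.+1 (time X))^-1).
    by field; rewrite l0 (gt_eqF w0) (gt_eqF X0) (gt_eqF A0).
  by rewrite sigma2 mul1r subKr.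
have iw : (w n.+1 (time X))^-1 @[X --> +oo] --> c.
  have d0 : c - (w n.+1 (time X))^-1 @[X --> +oo] --> (0 : R).
    have BX k : k * X^-1 @[X --> +oo] --> (0 : R).
      have : k * X^-1 @[X --> +oo] --> k * 0.
        by apply: cvgM; [exact: cvg_cst|exact: Xinv_cvg].
      by rewrite mulr0.
    apply: squeeze_cvgr (BX (- B)) (BX B); near=> X.
    have X0 : 0 < X by near: X; exact: near_gt0.
    have hBX : `|momfun (sg X) ('X * Q X ^+ 2)| <= B * momfun (sg X) (Q X ^+ 2) by near: X.
    have Y0 : 0 < momfun (sg X) (Q X ^+ 2).
      by rewrite sg_Q2// divr_gt0 ?expR_gt0 ?scale_end_gt0.
    rewrite mulNr -ler_norml key// subKr normrM normrM.
    have -> : `|sigma| = 1.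
      by apply/eqP; rewrite -sqrp_eq1// -normrX expr2 sigma2 normr1.
    rewrite mul1r gtr0_norm ?invr_gt0// mulrC ler_pM2r ?invr_gt0//.
    by rewrite normrM normfV (gtr0_norm Y0) ler_pdivrMr.
  have : c - (c - (w n.+1 (time X))^-1) @[X --> +oo] --> c - 0.
    by apply: cvgB; [exact: cvg_cst|exact: d0].
  rewrite subr0; apply: cvg_trans; apply: near_eq_cvg; apply: nearW => X.
  by rewrite subKr.
have : (w n.+1 (time X))^-1^-1 @[X --> +oo] --> c^-1.
  by apply: cvgV; [rewrite gt_eqF|exact: iw].
apply: cvg_trans; apply: near_eq_cvg; apply: nearW => X.
by rewrite invrK.
Unshelve. all: by end_near. Qed.

(** The logarithm of [extremal_moment_cvg]: the factor S^(2 n) contributes 2 n ln (c X) and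
    [scale_end] contributes c sigma X + (p + 1) ln X. Writing ln X = ln (c X) - ln c puts c^(p + 1)
    into the constant. *)
Lemma endpoint_position_cvg : x n.+1 (time X) - (c * sigma * X
    + (2 * n.+1%:R + p - 1) * ln (c * X)
    - ln (c `^ (p + 1) * n`!%:R * Gamma (n.+1%:R + p))) @[X --> +oo] --> (0 : R).
Proof.
have near0 (T : R -> Prop) : (forall X, 0 < X -> T X) -> \forall X \near +oo, T X.
  by move=> h; apply: filterS near_gt0 => X /h.
have := extremal_moment_cvg p1 sg_cvg S_cvg (near0 _ S_neq0) (nearW _ size_Q)
  (near0 _ Q_S) (near0 _ Q_min).
set h := laguerre_norm p n => Zh.
have h0 : 0 < h by exact: laguerre_norm_gt0.
have lnZ : ln h - ln (momfun (sg X) (Q X ^+ 2) * S X ^+ n ^+ 2) @[X --> +oo] --> ln h - ln h.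
  apply: cvgB; first exact: cvg_cst.
  apply: continuous_cvg; [exact: continuous_ln|exact: Zh].
rewrite subrr in lnZ; apply: cvg_trans lnZ; apply: near_eq_cvg; near=> X.
have X0 : 0 < X by near: X.
rewrite sg_Q2// -exprM.
have -> : S X ^+ (n * 2) = (c * X) ^+ (n * 2).
  by rewrite SE exprMn mulnC exprM expr2 sigma2 expr1n mul1r.
have A0 := scale_end_gt0 p c sigma X0; have cX : 0 < c * X by exact: mulr_gt0.
have g0 : 0 < n.+1%:R + p by have := ler0n R n; have := p1; rewrite -natr1; lra.
have e0 := expR_gt0 (- x n.+1 (time X)); have cp0 := powR_gt0 (p + 1) c0.
have Xp0 := powR_gt0 (- (p + 1)) X0; have ec0 := expR_gt0 (- (c * sigma * X)).
have f0 : (0 : R) < n`!%:R by rewrite ltr0n fact_gt0.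
rewrite [ln (_ / _ * _)]lnM ?posrE ?divr_gt0 ?exprn_gt0// ln_div ?posrE// expRK lnXn//.
rewrite [ln (c * X)]lnM ?posrE// /scale_end [ln (expR _ * _)]lnM ?posrE// expRK ln_powR.
rewrite -[c `^ _ * _ * _]mulrA.
have hE : n`!%:R * Gamma (n.+1%:R + p) = h.
  by rewrite /h /laguerre_norm -natr1; congr (_ * Gamma _); ring.
rewrite hE lnM ?posrE// ln_powR.
by ring.
Unshelve. all: by end_near. Qed.

End EndpointAsymptotics.

Section JacobiEndpoints.
Context {R : realType}.
Variables (a b alpha : R).
Local Notation D := (`]alpha, 1 + alpha[%classic : set R).

Lemma jacobi_right_end x : D (1 + alpha - 1 * x) <-> 0 < x < 1.
Proof.
rewrite /= in_itv/= mul1r; split => /andP[h1 h2]; apply/andP; split; lra.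
Qed.

Lemma jacobi_left_end x : D (alpha - -1 * x) <-> 0 < x < 1.
Proof.
rewrite /= in_itv/= mulN1r opprK; split => /andP[h1 h2]; apply/andP; split; lra.
Qed.

Lemma jacobi_weight_right_end x : 0 < x < 1 ->
  jacobi_weight a b alpha (1 + alpha - 1 * x) = x `^ a * (1 - x) `^ b.
Proof.
move=> /jacobi_right_end xD; rewrite /jacobi_weight patchE mem_set// mulrC.
by congr (_ `^ _ * _ `^ _); ring.
Qed.

Lemma jacobi_weight_left_end x : 0 < x < 1 ->
  jacobi_weight a b alpha (alpha - -1 * x) = x `^ b * (1 - x) `^ a.
Proof.
move=> /jacobi_left_end xD; rewrite /jacobi_weight patchE mem_set//.
by congr (_ `^ _ * _ `^ _); ring.
Qed.

End JacobiEndpoints.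

Lemma cvg_subr0 {R : realType} (T : Type) (F : set_system T) (FF : Filter F) (f : T -> R) (l : R) :
  f t @[t --> F] --> l -> f t - l @[t --> F] --> (0 : R).
Proof. by move=> fl; rewrite -(subrr l); apply: cvgB; [exact: fl|exact: cvg_cst]. Qed.

Theorem theorem7p5 (R : realType) (a b alpha : R)
    (ha : -1 < a) (hb : -1 < b) (halpha : 0 < alpha)
    (u0 : R -> R) (mu0 : borel_measure R)
    (h0 : phase_space u0 mu0)
    (hrho : is_spectral_measure u0 mu0 (jacobi_measure a b alpha))
    (u : R -> R -> R) (mu : R -> borel_measure R)
    (hflow : forall t : R, is_flow t u0 mu0 (u t) (mu t))
    (x w : nat -> R -> R)
    (hxw : forall t : R,
      peakon_data (u t) (mu t) (fun n => x n t) (fun n => w n t))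
    (n : nat) (hn : (1 <= n)%N) :
  ((w n t - (1 + alpha)^-1 @[t --> +oo] --> 0) /\
   (x n t - (t / (2 * (1 + alpha))
             + (2 * n%:R + a - 1) * ln (t / (2 * (1 + alpha)))
             - ln ((1 + alpha) `^ (a + 1) * ((n.-1)`!)%:R * Gamma (n%:R + a)))
      @[t --> +oo] --> 0)) /\
  ((w n t - alpha^-1 @[t --> -oo] --> 0) /\
   (x n t - (t / (2 * alpha)
             + (2 * n%:R + b - 1) * ln (`|t| / (2 * alpha))
             - ln (alpha `^ (b + 1) * ((n.-1)`!)%:R * Gamma (n%:R + b)))
      @[t --> -oo] --> 0)).
Proof.
have a0 : 0 < 1 + alpha by rewrite addr_gt0.
have m1 : -1 * -1 = 1 :> R by rewrite mulrNN mulr1.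
(* Peaks are numbered from 1 and polynomial degrees from 0: peak k + 1 belongs to degree k. *)
case: n hn => [//|k] _ /=; split; split.
- have h := endpoint_weight_cvg halpha ha a0 (mulr1 1) (jacobi_right_end alpha)
    (jacobi_weight_right_end a b alpha) hrho hflow hxw k.
  apply: cvg_subr0.
  (* The parametrisation t = 2 c^2 sigma X is solved for X, with c = 1 + alpha and sigma = 1; thus c
     X = t / (2 c). *)
  have tX : t / (2 * (1 + alpha) ^+ 2) @[t --> +oo] --> +oo.
    by apply: gt0_cvgMly; [rewrite invr_gt0 mulr_gt0// exprn_gt0|exact: cvg_id].
  have := cvg_comp _ _ tX h; apply: cvg_trans; apply: near_eq_cvg; apply: nearW => t /=.
  by congr (w _ _); field; rewrite gt_eqF.
- have h := endpoint_position_cvg halpha ha a0 (mulr1 1) (jacobi_right_end alpha)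
    (jacobi_weight_right_end a b alpha) hrho hflow hxw k.
  have tX : t / (2 * (1 + alpha) ^+ 2) @[t --> +oo] --> +oo.
    by apply: gt0_cvgMly; [rewrite invr_gt0 mulr_gt0// exprn_gt0|exact: cvg_id].
  have := cvg_comp _ _ tX h; apply: cvg_trans; apply: near_eq_cvg; apply: nearW => t /=.
  have -> : 2 * (1 + alpha) ^+ 2 * 1 * (t / (2 * (1 + alpha) ^+ 2)) = t.
    by field; rewrite gt_eqF.
  have e : (1 + alpha) * (t / (2 * (1 + alpha) ^+ 2)) = t / (2 * (1 + alpha)).
    by field; rewrite gt_eqF.
  by rewrite mulr1 e.
- have h := endpoint_weight_cvg halpha hb halpha m1 (jacobi_left_end alpha)
    (jacobi_weight_left_end a b alpha) hrho hflow hxw k.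
  apply: cvg_subr0.
  (* With sigma = -1 and c = alpha one gets X = - t / (2 alpha^2), which is positive for t < 0, and
     c X = |t| / (2 alpha). *)
  have tX : - t / (2 * alpha ^+ 2) @[t --> -oo] --> +oo.
    by apply: gt0_cvgMly; [rewrite invr_gt0 mulr_gt0// exprn_gt0|apply/cvgNry; exact: cvg_id].
  have := cvg_comp _ _ tX h; apply: cvg_trans; apply: near_eq_cvg; apply: nearW => t /=.
  by congr (w _ _); field; rewrite gt_eqF.
- have h := endpoint_position_cvg halpha hb halpha m1 (jacobi_left_end alpha)
    (jacobi_weight_left_end a b alpha) hrho hflow hxw k.
  have tX : - t / (2 * alpha ^+ 2) @[t --> -oo] --> +oo.
    by apply: gt0_cvgMly; [rewrite invr_gt0 mulr_gt0// exprn_gt0|apply/cvgNry; exact: cvg_id].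
  have := cvg_comp _ _ tX h; apply: cvg_trans; apply: near_eq_cvg; near=> t => /=.
  have t0 : t < 0 by near: t; exact: nbhs_ninfty_lt.
  have -> : 2 * alpha ^+ 2 * -1 * (- t / (2 * alpha ^+ 2)) = t.
    by field; rewrite gt_eqF.
  have -> : alpha * -1 * (- t / (2 * alpha ^+ 2)) = t / (2 * alpha).
    by field; rewrite gt_eqF.
  have -> : alpha * (- t / (2 * alpha ^+ 2)) = `|t| / (2 * alpha).
    by rewrite ltr0_norm//; field; rewrite gt_eqF.
  by [].
Unshelve. all: by end_near. Qed.
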